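(* Let $e$ be an interior edge of $\mathcal T_h$ with $e=\partial T_+\cap\partial T_-$ for some $T_\pm\in\mathcal T_h$. Then for all $\boldsymbol v\in\boldsymbol V^h$, $$\Big|\int_e[\boldsymbol v]\Big|\le Ch_T^3\big(\|\nabla\boldsymbol v\|_{L^2(T_+)}+\|\nabla\boldsymbol v\|_{L^2(T_-)}\big),$$ where $h_T=\max\{h_{T_+},h_{T_-}\}$ and $C$ is independent of the mesh size. Here $[\boldsymbol v]|_e=\boldsymbol v_+\otimes\boldsymbol n_++\boldsymbol v_-\otimes\boldsymbol n_-$, with $\boldsymbol v_\pm=\boldsymbol v|_{T_\pm}$, $\boldsymbol n_\pm$ the outward unit normal of $\partial T_\pm$ restricted to $e$, and $(\boldsymbol a\otimes\boldsymbol b)_{i,j}=a_ib_j$.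
   Context: Mesh. $\Omega\subset\mathbb R^2$ is a sufficiently smooth domain (boundary given by finitely many local charts). $\tilde{\mathcal T}_h$ is a member of a shape-regular family of affine (straight-sided) triangulations with mesh size $h=\max_{\tilde T}\mathrm{diam}(\tilde T)$ sufficiently small, whose boundary vertices lie on $\partial\Omega$, each triangle having at most two boundary vertices; $\tilde\Omega_h=\mathrm{int}\big(\bigcup_{\tilde T\in\tilde{\mathcal T}_h}\overline{\tilde T}\big)$ is an $O(h^2)$ polygonal approximation of $\Omega$. $G:\tilde\Omega_h\to\Omega$ is a bijection with $\|G\|_{W^{1,\infty}(\tilde\Omega_h)}\le C$, $G(x)=x$ at all vertices, and $G$ the identity on every triangle with three interior vertices. $G_h$ is the piecewise quadratic nodal (vertices and edge midpoints) interpolant of $G$, with $\|DG_h\|_{W^{1,\infty}(\tilde T)}\le C$ and $\|DG_h^{-1}\|_{W^{1,\infty}(\tilde T)}\le C$ for all $\tilde T$. $\mathcal T_h=\{G_h(\tilde T):\tilde T\in\tilde{\mathcal T}_h\}$ is the isoparametric mesh and $\Omega_h=\mathrm{int}\big(\bigcup_{T\in\mathcal T_h}\overline T\big)$. $\hat T$ is the reference triangle with vertices $(1,0),(0,1),(0,0)$; for $T=G_h(\tilde T)$, $F_{\tilde T}:\hat T\to\tilde T$ is an affine bijection with $|F_{\tilde T}|_{W^{1,\infty}(\hat T)}\le Ch_T$, $|F_{\tilde T}^{-1}|_{W^{1,\infty}(\tilde T)}\le Ch_T^{-1}$, $F_T=G_h\circ F_{\tilde T}:\hat T\to T$, $h_T=\mathrm{diam}(\tilde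 T)$, and $|F_T|_{W^{m,\infty}(\hat T)}\le Ch_T^m$ ($0\le m\le2$), $|F_T^{-1}|_{W^{m,\infty}(T)}\le Ch_T^{-m}$ ($0\le m\le 3$), $c_1h_T^2\le\det(DF_T)\le c_2h_T^2$. Interior edges of $\mathcal T_h$ are straight and are edges of $\tilde{\mathcal T}_h$; if $e=F_T(\hat e)$ is a straight edge then $F_T|_{\hat e}$ is affine; if all edges of $T$ are straight then $F_T$ is affine and $T=\tilde T$. All constants are independent of the mesh size. Spaces. $\hat T^{ct}$ is the Clough–Tocher split of $\hat T$ into three triangles obtained by joining the vertices to the barycenter; $\hat{\boldsymbol V}=\{\hat{\boldsymbol v}\in [H^1(\hat T)]^2:\hat{\boldsymbol v}|_{\hat K}\in[\mathcal P_2(\hat K)]^2\ \forall\hat K\in\hat T^{ct}\}$ ($\mathcal P_k$: polynomials of degree $\le k$). With $A_T=DF_T/\det(DF_T)$: $\tilde{\boldsymbol V}(\tilde T)=\{\tilde{\boldsymbol v}:\tilde{\boldsymbol v}(F_{\tilde T}(\hat x))=\hat{\boldsymbol v}(\hat x),\ \hat{\boldsymbol v}\in\hat{\boldsymbol V}\}$, $\boldsymbol V(T)=\{\boldsymbol v:\boldsymbol v(F_T(\hat x))=A_T(\hat x)\hat{\boldsymbol v}(\hat x),\ \hat{\boldsymbol v}\in\hat{\boldsymbol V}\}$. $\mathcal N_{\hat T}$ is the set of the 4 vertices and 6 edge midpoints of $\hat T^{ct}$, $\mathcal N_{\tilde T}=F_{\tilde T}(\mathcal N_{\hat T})$. $\tilde{\boldsymbol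 V}^h=\{\tilde{\boldsymbol v}\in[H^1_0(\tilde\Omega_h)]^2:\tilde{\boldsymbol v}|_{\tilde T}\in\tilde{\boldsymbol V}(\tilde T)\ \forall\tilde T\}$. $\Psi$ is defined elementwise by: $(\Psi\tilde{\boldsymbol v})|_T\in\boldsymbol V(T)$ is the unique function with $(\Psi\tilde{\boldsymbol v})|_T(a)=\tilde{\boldsymbol v}|_{\tilde T}(\tilde a)$ for all $\tilde a\in\mathcal N_{\tilde T}$, $a=G_h(\tilde a)$. $\boldsymbol V^h=\Psi(\tilde{\boldsymbol V}^h)$. *)

(* Defs.v *)
From HB Require Import structures.
From mathcomp Require Import all_boot all_order all_algebra.
From mathcomp Require Import all_classical all_reals all_analysis.
Set Implicit Arguments.
Unset Strict Implicit.
Unset Printing Implicit Defensive.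
Import Order.TTheory GRing.Theory Num.Theory.
Import numFieldNormedType.Exports.
Local Open Scope classical_set_scope.
Local Open Scope ring_scope.

(* The plane is 'cV[R]_2 over R : realType, so that Jacobian
   matrices act on vectors by *m. *)

Section Plane.
Context {R : realType}.
Local Notation R2 := ('cV[R]_2).

Definition mkpt (x y : R) : R2 := \col_i (if i == ord0 then x else y).

(* Euclidean (Frobenius) norm; the library norm on matrices is the max norm. *)
Definition enorm m n (A : 'M[R]_(m, n)) : R :=
  Num.sqrt (\sum_i \sum_j A i j ^+ 2).

Definition dot (x y : R2) : R := \sum_i x i ord0 * y i ord0.

Definition tensor (a b : R2) : 'M[R]_2 :=
  \matrix_(i, j) (a i ord0 * b j ord0).

Definition diam (A : set R2) : R :=
  sup [set r | exists x y, [/\ A x, A y & r = enorm (x - y)]].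

Definition bdry (A : set R2) : set R2 := closure A `\` A°.

Definition segpt (a b : R2) (t : R) : R2 := (1 - t) *: a + t *: b.
Definition segment (a b : R2) : set R2 :=
  [set segpt a b t | t in [set t | 0 <= t <= 1]].
Definition midpt (a b : R2) : R2 := segpt a b (2^-1).

Definition tri (a : 'I_3 -> R2) : set R2 :=
  [set x | exists l : 'I_3 -> R,
    [/\ forall k, 0 <= l k, \sum_k l k = 1 & x = \sum_k l k *: a k]].

(* edge opposite to the vertex a k *)
Definition edge (a : 'I_3 -> R2) (k : 'I_3) : set R2 :=
  segment (a (ordS k)) (a (ordS (ordS k))).

Definition Pk (k : nat) (f : R2 -> R) : Prop :=
  exists c : nat -> nat -> R, forall x,
    f x = \sum_(i < k.+1) \sum_(j < k.+1 | (i + j <= k)%N)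
            c i j * x ord0 ord0 ^+ i * x ord_max ord0 ^+ j.

Definition affine_on (A : set R2) (f : R2 -> R2) : Prop :=
  exists (B : 'M[R]_2) (b : R2), forall x, A x -> f x = B *m x + b.

Definition evec (j : 'I_2) : R2 := delta_mx j ord0.

(* iterated classical partial derivatives; [s] lists the directions *)
Definition pder (W : normedModType R) (s : seq 'I_2) (f : R2 -> W) : R2 -> W :=
  foldr (fun j g => 'D_(evec j) g) f s.

(* Jacobian matrix, (D F)_ij = d F_i / d x_j *)
Definition Dmx (F : R2 -> R2) (x : R2) : 'M[R]_2 :=
  \matrix_(i, j) 'D_(evec j) (fun y => F y i ord0) x.

(* [ |f|_{W^{m,oo}(A)} <= C ] for a map f that is smooth on the open set A; for
   such f the weak derivatives are the classical ones and the essential suprema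
   are suprema. *)
Definition Wsemi_le p q (m : nat) (A : set R2) (f : R2 -> 'M[R]_(p.+1, q.+1))
    (C : R) : Prop :=
  (forall s x, (size s < m)%N -> A x -> differentiable (pder s f) x) /\
  (forall s x, size s = m -> A x -> enorm (pder s f x) <= C).

(* Lebesgue measure lives on R * R; [pt] identifies R * R with the plane. *)
Definition pt (z : measurableTypeR R * measurableTypeR R) : R2 := mkpt z.1 z.2.

Definition mu2 : {measure set (measurableTypeR R * measurableTypeR R)
    -> \bar R} :=
  (@lebesgue_measure R \x @lebesgue_measure R)%E.

Definition int2 (A : set R2) (f : R2 -> R) : R :=
  \int[mu2]_(z in pt @^-1` A) f (pt z).

(* ||f||_{L^2(A)}, possibly +oo *)
Definition L2norm (A : set R2) (f : R2 -> R) : \bar R :=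
  Lnorm mu2 (2%:E) ((fun z => (f (pt z))%:E) \_ (pt @^-1` A)).

Definition L2 (A : set R2) (f : R2 -> R) : Prop :=
  measurable_fun (pt @^-1` A) (f \o pt) /\ (L2norm A f < +oo)%E.

(* C_c^oo(A), as functions on the plane *)
Definition test_fun (A : set R2) (phi : R2 -> R) : Prop :=
  [/\ forall s x, differentiable (pder s phi) x,
      compact (closure [set x | phi x != 0]) &
      closure [set x | phi x != 0] `<=` A].

Definition weak_pder (A : set R2) (j : 'I_2) (u g : R2 -> R) : Prop :=
  forall phi, test_fun A phi ->
    int2 A (fun x => u x * 'D_(evec j) phi x) =
    - int2 A (fun x => g x * phi x).

Definition H1_grad (A : set R2) (u : R2 -> R) (g : 'I_2 -> R2 -> R) : Prop :=
  L2 A u /\ forall j, L2 A (g j) /\ weak_pder A j u (g j).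

Definition H1 (A : set R2) (u : R2 -> R) : Prop := exists g, H1_grad A u g.

(* H^1_0(A): closure of C_c^oo(A) in H^1(A) *)
Definition H10 (A : set R2) (u : R2 -> R) : Prop :=
  exists g, H1_grad A u g /\
    exists phi : nat -> R2 -> R,
      [/\ forall n, test_fun A (phi n),
          L2norm A (fun x => phi n x - u x) @[n --> \oo] --> 0%E &
          forall j, L2norm A (fun x => 'D_(evec j) (phi n) x - g j x)
                      @[n --> \oo] --> 0%E].

Definition Linf_le (A : set R2) (u : R2 -> R) (C : R) : Prop :=
  measurable_fun (pt @^-1` A) (u \o pt) /\
  {ae mu2, forall z, A (pt z) -> `|u (pt z)| <= C}.

(* ||u||_{W^{1,oo}(A)} <= C, with the maximum as norm of the gradient *)
Definition W1inf_le (A : set R2) (u : R2 -> R) (C : R) : Prop :=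
  Linf_le A u C /\
  forall j, exists g, weak_pder A j u g /\ Linf_le A g C.

(* componentwise: [H^1(A)]^2, [P_k]^2, ... *)
Definition vec (P : (R2 -> R) -> Prop) (v : R2 -> R2) : Prop :=
  forall i, P (fun x => v x i ord0).

Definition class_C (m : nat) (g : R -> R) : Prop :=
  (forall k x, (k < m)%N -> derivable (derive1n k g) x 1) /\
  continuous (derive1n m g).

(* Bounded domain with a boundary given by finitely many C^m charts: inside the
   open set U j, after the orthogonal change of coordinates Q j, the set lies
   strictly below the graph of gam j. *)
Definition smooth_domain (m : nat) (Om : set R2) : Prop :=
  [/\ open Om, connected Om, Om !=set0, bounded_set Om &
      exists (N : nat) (U : 'I_N -> set R2) (Q : 'I_N -> 'M[R]_2)
             (gam : 'I_N -> R -> R),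
        [/\ forall j, open (U j),
            forall j, (Q j)^T *m Q j = 1%:M,
            forall j, class_C m (gam j),
            bdry Om `<=` \bigcup_j U j &
            forall j x, U j x ->
              (Om x <-> (Q j *m x) ord_max ord0 <
                        gam j ((Q j *m x) ord0 ord0))]].

Definition refv (k : 'I_3) : R2 :=
  match val k with
  | 0%N => mkpt 1 0
  | 1%N => mkpt 0 1
  | _ => mkpt 0 0
  end.

Definition That : set R2 := tri refv.

Definition baryc : R2 := mkpt (3^-1) (3^-1).

(* closed triangle of the Clough-Tocher split containing the edge opposite to
   the vertex [refv k] *)
Definition ctK (k : 'I_3) : set R2 :=
  tri (fun l => if l == k then baryc else refv l).

(* Asking for polynomials on the closed triangles selects the continuous
   representative, whose point values are used below. *)
Definition Vhat (v : R2 -> R2) : Prop :=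
  vec (H1 (That°)) v /\
  forall k, exists p, vec (Pk 2) p /\ forall x, ctK k x -> v x = p x.

(* vertices of the Clough-Tocher split: the three vertices and the barycenter *)
Definition ctv (k : option 'I_3) : R2 := if k is Some l then refv l else baryc.

(* Any two of the four vertices are joined by one of the six edges, so these
   are the vertices (k = l) and the edge midpoints (k != l). *)
Definition Nhat : set R2 := [set x | exists k l, x = midpt (ctv k) (ctv l)].

(* The affine bijection That -> tri a mapping refv k to a k.  Every affine
   bijection between the two triangles arises in this way from an ordering of
   the vertices. *)
Definition Faff (a : 'I_3 -> R2) (x : R2) : R2 :=
  x ord0 ord0 *: a (inord 0) + x ord_max ord0 *: a (inord 1) +
  (1 - x ord0 ord0 - x ord_max ord0) *: a (inord 2).

(* Outward unit normal n of the set T along its straight boundary piece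
   segment a b. *)
Definition outward_normal (T : set R2) (a b n : R2) : Prop :=
  [/\ enorm n = 1, dot (b - a) n = 0 &
      forall t : R, 0 < t < 1 -> \forall s \near 0^'+, ~ T (segpt a b t + s *: n)].

(* integral of a matrix-valued function over segment a b w.r.t. arc length *)
Definition seg_int (a b : R2) (f : R2 -> 'M[R]_2) : 'M[R]_2 :=
  \matrix_(i, j) (enorm (b - a) *
    \int[@lebesgue_measure R]_(t in `[0, 1]) f (segpt a b t) i j).

End Plane.

(* Raw data: the ordered vertex triples of the affine triangles, the map G (given
   up to the boundary), and, for each triangle, the quadratic polynomial map
   Gh i on the plane whose restriction to the i-th triangle is G_h. *)
Record iso_mesh (R : realType) := IsoMesh {
  nelt : nat;
  vtx : 'I_nelt -> 'I_3 -> 'cV[R]_2;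
  Gmap : 'cV[R]_2 -> 'cV[R]_2;
  Gh : 'I_nelt -> 'cV[R]_2 -> 'cV[R]_2
}.

Section Mesh.
Context {R : realType} (M : iso_mesh R).
Local Notation R2 := ('cV[R]_2).
Local Notation I := ('I_(nelt M)).

(* closed affine triangle, F_Ttilde, F_T and closed isoparametric triangle *)
Definition Ttil (i : I) : set R2 := tri (vtx i).
Definition Ftil (i : I) : R2 -> R2 := Faff (vtx i).
Definition FT (i : I) : R2 -> R2 := Gh i \o Ftil i.
Definition Tel (i : I) : set R2 := FT i @` That.

Definition Omtil : set R2 := (\bigcup_(i in [set: I]) Ttil i)°.

Definition hT (i : I) : R := diam (Ttil i).
Definition meshsize : R := \big[Num.max/0]_(i < nelt M) hT i.

Definition AT (i : I) (x : R2) : 'M[R]_2 :=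
  (\det (Dmx (FT i) x))^-1 *: Dmx (FT i) x.

Definition Tedge (i : I) (k : 'I_3) : set R2 := FT i @` edge refv k.

Definition straight (e : set R2) : Prop := exists a b, e = segment a b.

Definition interior_edge (e : set R2) : Prop :=
  exists i j k l, [/\ i != j, e = Tedge i k & e = Tedge j l].

Definition conforming : Prop :=
  (forall i, injective (Ftil i)) /\
  (forall i j, i != j ->
    [\/ Ttil i `&` Ttil j = set0,
        exists k l, vtx i k = vtx j l /\ Ttil i `&` Ttil j = [set vtx i k] |
        exists k l, edge (vtx i) k = edge (vtx j) l /\
                    Ttil i `&` Ttil j = edge (vtx i) k]).

(* h_T is at most sigma times the diameter of an inscribed disc *)
Definition shape_regular (sigma : R) : Prop :=
  forall i, exists (c : R2) (r : R),
    [/\ 0 < r, [set x | enorm (x - c) <= r] `<=` Ttil i &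
        hT i <= sigma * (2 * r)].

(* The affine mesh and its relation to Om; distances between the two boundaries
   are at most K h^2. *)
Definition affine_mesh_ok (Om : set R2) (K sigma h0 : R) : Prop :=
  [/\ conforming, shape_regular sigma, meshsize <= h0,
      (forall (i : I) k, bdry Omtil (vtx i k) -> bdry Om (vtx i k)) /\
      (forall i : I, exists k, ~ bdry Omtil (vtx i k)) &
      (forall x, bdry Omtil x ->
         exists2 y, bdry Om y & enorm (x - y) <= K * meshsize ^+ 2) /\
      (forall y, bdry Om y ->
         exists2 x, bdry Omtil x & enorm (x - y) <= K * meshsize ^+ 2)].

(* Gmap is the continuous representative on the closure, which is needed for
   its values at the vertices and midpoints on the boundary. *)
Definition G_ok (Om : set R2) (K : R) : Prop :=
  [/\ set_bij Omtil Om (@Gmap R M),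
      {within closure Omtil, continuous (@Gmap R M)},
      vec (fun u => W1inf_le Omtil u K) (@Gmap R M),
      forall (i : I) k, Gmap M (vtx i k) = vtx i k &
      forall i : I, (forall k, ~ bdry Omtil (vtx i k)) ->
        forall x, Ttil i x -> Gmap M x = x].

(* Gh i interpolates G at the vertices (k = l) and edge midpoints (k != l). *)
Definition Gh_ok (K : R) : Prop :=
  forall i : I,
  [/\ vec (Pk 2) (Gh i),
      forall k l, Gh i (midpt (vtx i k) (vtx i l)) =
                  Gmap M (midpt (vtx i k) (vtx i l)),
      forall m, (m <= 1)%N -> Wsemi_le m (Ttil i)° (Dmx (Gh i)) K &
      forall m, (m <= 1)%N ->
        Wsemi_le m (Ttil i)° (fun x => invmx (Dmx (Gh i) x)) K].

Definition maps_ok (K c1 c2 : R) : Prop :=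
  forall i : I,
  [/\ Wsemi_le 1 (That°) (Ftil i) (K * hT i) /\
      Wsemi_le 1 (Ttil i)° ('pinv_(fun=> 0) That (Ftil i)) (K / hT i),
      {in That &, injective (FT i)},
      forall m, (m <= 2)%N -> Wsemi_le m (That°) (FT i) (K * hT i ^+ m),
      forall m, (m <= 3)%N ->
        Wsemi_le m (Tel i)° ('pinv_(fun=> 0) That (FT i)) (K * hT i ^- m) &
      forall x, That x ->
        c1 * hT i ^+ 2 <= \det (Dmx (FT i) x) <= c2 * hT i ^+ 2].

Definition edges_ok : Prop :=
  [/\ forall e, interior_edge e ->
        straight e /\ exists (i : I) k, e = edge (vtx i) k,
      forall i k, straight (Tedge i k) -> affine_on (edge refv k) (FT i) &
      forall i, (forall k, straight (Tedge i k)) ->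
        affine_on That (FT i) /\ Tel i = Ttil i].

Definition admissible (Om : set R2) (K c1 c2 sigma h0 : R) : Prop :=
  [/\ affine_mesh_ok Om K sigma h0, G_ok Om K, Gh_ok K, maps_ok K c1 c2 &
      edges_ok].

Definition Vtil (i : I) (v : R2 -> R2) : Prop :=
  exists vhat, Vhat vhat /\ forall x, That x -> v (Ftil i x) = vhat x.

Definition VT (i : I) (v : R2 -> R2) : Prop :=
  exists vhat, Vhat vhat /\ forall x, That x -> v (FT i x) = AT i x *m vhat x.

Definition Vtilh (v : R2 -> R2) : Prop :=
  vec (H10 Omtil) v /\ forall i, Vtil i v.

(* A function that may jump across edges is the family of its restrictions to
   the closed elements.  [Psi vt v] reads v = Psi vt. *)
Definition Psi (vt : R2 -> R2) (v : I -> R2 -> R2) : Prop :=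
  forall i, VT i (v i) /\
    forall a, (Ftil i @` Nhat) a -> v i (Gh i a) = vt a.

Definition Vh (v : I -> R2 -> R2) : Prop :=
  exists vt, Vtilh vt /\ Psi vt v.

(* ||grad v||_{L^2(T)} for v in V(T).  Such a v is smooth in T away from the
   images of the interior edges of the Clough-Tocher split and continuous across
   them, so its classical Jacobian is its weak gradient almost everywhere. *)
Definition gradL2 (i : I) (v : R2 -> R2) : \bar R :=
  L2norm (Tel i)° (fun x => enorm (Dmx v x)).

End Mesh.

(* Main.v *)
(** On a straight edge e shared by T_+ and T_- the two traces of v take the same
    values at the end points and at the midpoint, and the outward normals are
    opposite, so the Simpson sums cancel and the jump integral reduces to the
    Simpson errors of v_+ and v_-.  Pulled back to the edge of the reference
    triangle, v is DF p / det DF with p quadratic.  Expanding 1 / det DF to first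
    order in h leaves a cubic, for which Simpson's rule is exact, and a remainder
    of relative size h^2.

    Simpson's rule is also exact for constants, and constants c belong to V(T):
    c is the Piola transform of adj(DF) c, which is affine because F is quadratic.
    Hence p may be replaced by p - adj(DF) c with c the value of v at one point,
    and the Poincare inequality |p| <= C h |grad v| on a single triangle of the
    Clough-Tocher split suffices.  That inequality is obtained pointwise: Dw for w = DF p / det DF is Lipschitz with a
    constant proportional to |p|, so if |Dw| is large at one point then it is large
    on a box of side r around it, whose image contains a square of side
    comparable to r h, on which |grad v| is bounded below; the Lipschitz error is
    absorbed by taking r small.

    The normals are opposite because every triangle is positively oriented: an
    interior vertex has two interior, hence straight, edges, and there DF_T is the
    linear part of the affine map. *)

Require Import Defs.
From mathcomp Require Import all_boot all_order all_algebra.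
From mathcomp Require Import all_classical all_reals all_analysis.
From mathcomp Require Import ring lra.
Set Implicit Arguments.
Unset Strict Implicit.
Unset Printing Implicit Defensive.
Import Order.TTheory GRing.Theory Num.Theory.
Import numFieldNormedType.Exports.
Local Open Scope classical_set_scope.
Local Open Scope ring_scope.

(** * Uniform Lipschitz bounds for quadratics in two variables and their Piola quotients *)

Section QuadraticCalculus.
Context {R : realType}.
Implicit Types (c : nat -> R) (x y : R) (D : R -> R -> Prop).

(** All estimates are made on the reference triangle after the scaling [F_T = h (q2 a, q2 b)]: the
    coefficients of [a] and [b] that enter DF are bounded, those of degree two are O(h), and
    [jac a b >= c1], so every constant depends on [K], [c1] and [h0] alone. There [v] is h^-1 times
    a Piola quotient, and the derivatives of that quotient are at most C h^2 |Dv|. A square of side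
    comparable to h inside the image turns this into polynomial coefficients of size h N, with N a
    bound for the gradient norm. The second-order remainder then leaves an error h^-1 h^2 (h N) =
    h^2 N on the edge, and the edge length supplies the third power of h. The pointwise route to the
    Poincare inequality avoids a change of variables, but it requires that the image of a box under
    a quadratic map contain a square of known size, whence the quantitative local surjectivity. The
    gradient is sampled only on a box inside one Clough-Tocher triangle; coefficient bounds carry
    the estimate from there to the edge. *)

Definition q2 c x y : R :=
  c 0%N + c 1%N * x + c 2%N * y + c 3%N * x ^+ 2 + c 4%N * (x * y) + c 5%N * y ^+ 2.
Definition q2x c x y : R := c 1%N + 2 * c 3%N * x + c 4%N * y.
Definition q2y c x y : R := c 2%N + c 4%N * x + 2 * c 5%N * y.

(** One constant serves both as a bound on the values and as Lipschitz constant in the l1 norm, so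
    that sums, products and reciprocals stay in the class with explicit constants. *)
Definition lipb D (k : R) (f : R -> R -> R) : Prop :=
  [/\ 0 <= k, forall x y, D x y -> `|f x y| <= k &
   forall x y x' y', D x y -> D x' y' ->
     `|f x y - f x' y'| <= k * (`|x - x'| + `|y - y'|)].

Lemma lipb_le D k k' f : k <= k' -> lipb D k f -> lipb D k' f.
Proof.
move=> kk' [k0 b l]; split; first exact: le_trans k0 kk'.
  by move=> x y /b h; exact: le_trans h kk'.
move=> x y x' y' /l h /h {}h; apply: (le_trans h).
by apply: ler_wpM2r => //; rewrite addr_ge0.
Qed.

Lemma lipb_cst D (a k : R) : `|a| <= k -> lipb D k (fun _ _ => a).
Proof.
move=> ak; have k0 : 0 <= k by exact: le_trans ak.
by split => // x y x' y' _ _; rewrite subrr normr0 mulr_ge0 // addr_ge0.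
Qed.

Lemma lipbD D k k' f g :
  lipb D k f -> lipb D k' g -> lipb D (k + k') (fun x y => f x y + g x y).
Proof.
move=> [k0 b l] [k0' b' l']; split; first exact: addr_ge0.
  by move=> x y Dx; apply: (le_trans (ler_normD _ _)); rewrite lerD ?b ?b'.
move=> x y x' y' Dx Dx'; rewrite opprD addrACA mulrDl.
by apply: (le_trans (ler_normD _ _)); rewrite lerD ?l ?l'.
Qed.

Lemma lipbN D k f : lipb D k f -> lipb D k (fun x y => - f x y).
Proof.
move=> [k0 b l]; split => // [x y Dx|x y x' y' Dx Dx'].
  by rewrite normrN b.
by rewrite -opprD normrN l.
Qed.

Lemma lipbB D k k' f g :
  lipb D k f -> lipb D k' g -> lipb D (k + k') (fun x y => f x y - g x y).
Proof. by move=> hf hg; apply: lipbD => //; exact: lipbN. Qed.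

Lemma lipbM D k k' f g :
  lipb D k f -> lipb D k' g -> lipb D (3 * (k * k')) (fun x y => f x y * g x y).
Proof.
move=> [k0 b l] [k0' b' l']; split; first by rewrite !mulr_ge0.
  move=> x y Dx; rewrite normrM; apply: le_trans (_ : k * k' <= _).
    by apply: ler_pM => //; [exact: b | exact: b'].
  by rewrite ler_peMl ?mulr_ge0 ?ler1n.
move=> x y x' y' Dx Dx'.
have -> : f x y * g x y - f x' y' * g x' y' =
   f x y * (g x y - g x' y') + (f x y - f x' y') * g x' y' by ring.
set d := `|x - x'| + `|y - y'|.
have d0 : 0 <= d by rewrite addr_ge0.
apply: le_trans (_ : 2 * (k * k') * d <= _).
  apply: (le_trans (ler_normD _ _)); rewrite !normrM.
  have h1 : `|f x y| * `|g x y - g x' y'| <= k * (k' * d).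
    by apply: ler_pM => //; [exact: b | exact: l'].
  have h2 : `|f x y - f x' y'| * `|g x' y'| <= k * d * k'.
    by apply: ler_pM => //; [exact: l | exact: b'].
  by apply: (le_trans (lerD h1 h2)); rewrite le_eqVlt; apply/orP; left; apply/eqP; ring.
by rewrite ler_wpM2r // ler_wpM2r ?mulr_ge0 ?ler_nat.
Qed.

(** The first summand bounds the values, the second the Lipschitz constant, through 1/f - 1/f' = -(f
    - f')/(f f'). *)
Lemma lipbV D k a f : 0 < a -> (forall x y, D x y -> a <= f x y) ->
  lipb D k f -> lipb D (a^-1 + k * (a^-1 * a^-1)) (fun x y => (f x y)^-1).
Proof.
move=> a0 cf [k0 b l].
have ai : 0 <= a^-1 by rewrite invr_ge0 ltW.
have fpos x y : D x y -> 0 < f x y by move=> /cf; exact: lt_le_trans.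
have fi x y : D x y -> `|(f x y)^-1| <= a^-1.
  move=> Dx; have fp := fpos _ _ Dx.
  by rewrite gtr0_norm ?invr_gt0 // lef_pV2 ?posrE // cf.
split; first by rewrite addr_ge0 // !mulr_ge0.
  by move=> x y Dx; apply: (le_trans (fi _ _ Dx)); rewrite lerDl !mulr_ge0.
move=> x y x' y' Dx Dx'; set d := `|x - x'| + `|y - y'|.
have d0 : 0 <= d by rewrite addr_ge0.
have -> : (f x y)^-1 - (f x' y')^-1 = - (f x y - f x' y') * ((f x y)^-1 * (f x' y')^-1).
  by field; rewrite (lt0r_neq0 (fpos _ _ Dx)) (lt0r_neq0 (fpos _ _ Dx')).
rewrite normrM normrN normrM mulrDl ler_wpDl ?mulr_ge0//.
rewrite (_ : k * _ * d = (k * d) * (a^-1 * a^-1)); last by ring.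
apply: ler_pM; rewrite ?normr_ge0 ?mulr_ge0 //; first exact: l.
by apply: ler_pM => //; exact: fi.
Qed.

Lemma lipb_coord D : (forall x y, D x y -> `|x| <= 1 /\ `|y| <= 1) ->
  lipb D 1 (fun x y => x) /\ lipb D 1 (fun x y => y).
Proof.
move=> hD; split; split => //; try by move=> x y /hD[].
  by move=> x y x' y' _ _; rewrite mul1r lerDl.
by move=> x y x' y' _ _; rewrite mul1r lerDr.
Qed.

Lemma lipb_q2 D c k : 0 <= k -> (forall i, (i < 6)%N -> `|c i| <= k) ->
  (forall x y, D x y -> `|x| <= 1 /\ `|y| <= 1) -> lipb D (40 * k) (q2 c).
Proof.
move=> k0 hc hD; have [hx hy] := lipb_coord hD.
have hk i : (i < 6)%N -> lipb D k (fun _ _ => c i) by move=> ?; apply: lipb_cst; exact: hc.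
have -> : q2 c = (fun x y => (c 0%N + c 1%N * x + c 2%N * y) +
      (c 3%N * (x * x) + c 4%N * (x * y) + c 5%N * (y * y))).
  by apply/funext => x; apply/funext => y; rewrite /q2; ring.
apply: lipb_le; last first.
  apply: lipbD.
    by apply: lipbD; [apply: lipbD; [exact: hk|apply: lipbM; [exact: hk|exact: hx]]|apply: lipbM; [exact: hk|exact: hy]].
  apply: lipbD; [apply: lipbD|]; apply: lipbM; [exact: hk|apply: lipbM; [exact: hx|exact: hx]
     |exact: hk|apply: lipbM; [exact: hx|exact: hy]|exact: hk|apply: lipbM; [exact: hy|exact: hy]].
lra.
Qed.

Lemma lipb_q2xy D c k : 0 <= k -> (forall i, (0 < i < 6)%N -> `|c i| <= k) ->
  (forall x y, D x y -> `|x| <= 1 /\ `|y| <= 1) ->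
  lipb D (40 * k) (q2x c) /\ lipb D (40 * k) (q2y c).
Proof.
move=> k0 hc hD; have [hx hy] := lipb_coord hD.
have hk i : (0 < i < 6)%N -> lipb D k (fun _ _ => c i) by move=> ?; apply: lipb_cst; exact: hc.
have hk2 i : (0 < i < 6)%N -> lipb D (2 * k) (fun _ _ => 2 * c i).
  by move=> ?; apply: lipb_cst; rewrite normrM ger0_norm // ler_pM2l // hc.
split.
- rewrite /q2x; apply: lipb_le; last first.
    apply: lipbD.
      by apply: lipbD; [exact: hk|apply: lipbM; [exact: hk2|exact: hx]].
    by apply: lipbM; [exact: hk|exact: hy].
  lra.
- rewrite /q2y; apply: lipb_le; last first.
    apply: lipbD.
      by apply: lipbD; [exact: hk|apply: lipbM; [exact: hk|exact: hx]].
    by apply: lipbM; [exact: hk2|exact: hy].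
  lra.
Qed.

Definition jac a b x y : R := q2x a x y * q2y b x y - q2y a x y * q2x b x y.
Definition jacx a b x y : R :=
  2 * a 3%N * q2y b x y + q2x a x y * b 4%N - (a 4%N * q2x b x y + q2y a x y * (2 * b 3%N)).
Definition jacy a b x y : R :=
  a 4%N * q2y b x y + q2x a x y * (2 * b 5%N) - (2 * a 5%N * q2x b x y + q2y a x y * b 4%N).

(* A component of the Piola transform DF p / det DF, for F = (q2 a, q2 b) and
   p = (q2 p1, q2 p2); c is a or b according to the component. *)
Definition pnum c p1 p2 x y : R := q2x c x y * q2 p1 x y + q2y c x y * q2 p2 x y.
Definition pnumx c p1 p2 x y : R :=
  2 * c 3%N * q2 p1 x y + q2x c x y * q2x p1 x y +
  (c 4%N * q2 p2 x y + q2y c x y * q2x p2 x y).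
Definition pnumy c p1 p2 x y : R :=
  c 4%N * q2 p1 x y + q2x c x y * q2y p1 x y +
  (2 * c 5%N * q2 p2 x y + q2y c x y * q2y p2 x y).
Definition piola a b c p1 p2 x y : R := pnum c p1 p2 x y * (jac a b x y)^-1.
Definition piolax a b c p1 p2 x y : R :=
  (pnumx c p1 p2 x y * jac a b x y - pnum c p1 p2 x y * jacx a b x y) *
  ((jac a b x y)^-1 * (jac a b x y)^-1).
Definition piolay a b c p1 p2 x y : R :=
  (pnumy c p1 p2 x y * jac a b x y - pnum c p1 p2 x y * jacy a b x y) *
  ((jac a b x y)^-1 * (jac a b x y)^-1).

(** [L] is chosen before the domain and the coefficients, which makes it independent of the element.
    The constant coefficients of the map are left free because they do not enter DF; the
    coefficients of the numerator polynomials are normalised to 1, the general case following by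
    linearity. *)
Lemma lipb_piola (K c1 : R) : 0 <= K -> 0 < c1 -> exists2 L, 0 < L &
  forall D a b c p1 p2, (forall x y, D x y -> `|x| <= 1 /\ `|y| <= 1) ->
    (forall x y, D x y -> c1 <= jac a b x y) ->
    (forall i, (0 < i < 6)%N -> [/\ `|a i| <= K, `|b i| <= K & `|c i| <= K]) ->
    (forall i, (i < 6)%N -> `|p1 i| <= 1 /\ `|p2 i| <= 1) ->
    lipb D L (piolax a b c p1 p2) /\ lipb D L (piolay a b c p1 p2).
Proof.
move=> K0 c10.
have pos3 (u w : R) : 0 <= u -> 0 <= w -> 0 <= 3 * (u * w).
  by move=> u0 w0; apply: mulr_ge0; [exact: ler0n|exact: mulr_ge0].
have k40 : 0 <= 40 * K by apply: mulr_ge0; [exact: ler0n|].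
have k20 : 0 <= 2 * K by apply: mulr_ge0; [exact: ler0n|].
have k41 : 0 <= 40 * 1 :> R by rewrite mulr1; exact: ler0n.
have c1i : 0 <= c1^-1 by rewrite invr_ge0 ltW.
(* The constants that the sum and product rules produce for the Jacobian ([j0]), its partial
   derivatives ([jx]), the Piola numerator ([n0]), its partial derivatives ([nx]) and the reciprocal
   of the Jacobian ([iv]). *)
pose j0 : R := 3 * (40 * K * (40 * K)) + 3 * (40 * K * (40 * K)).
have j00 : 0 <= j0 by apply: addr_ge0; exact: pos3.
pose jx : R := (3 * (2 * K * (40 * K)) + 3 * (40 * K * (2 * K))) +
               (3 * (2 * K * (40 * K)) + 3 * (40 * K * (2 * K))).
pose n0 : R := 3 * (40 * K * (40 * 1)) + 3 * (40 * K * (40 * 1)).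
pose nx : R := (3 * (2 * K * (40 * 1)) + 3 * (40 * K * (40 * 1))) +
               (3 * (2 * K * (40 * 1)) + 3 * (40 * K * (40 * 1))).
pose iv : R := c1^-1 + j0 * (c1^-1 * c1^-1).
pose L : R := 3 * ((3 * (nx * j0) + 3 * (n0 * jx)) * (3 * (iv * iv))).
have L0 : 0 <= L.
  have iv0 : 0 <= iv by rewrite addr_ge0 // !mulr_ge0.
  have jx0 : 0 <= jx by apply: addr_ge0; apply: addr_ge0; exact: pos3.
  have n00 : 0 <= n0 by apply: addr_ge0; exact: pos3.
  have nx0 : 0 <= nx by apply: addr_ge0; apply: addr_ge0; exact: pos3.
  by apply: (pos3); [apply: addr_ge0; exact: pos3|exact: pos3].
exists (1 + L); first lra.
move=> D a b c p1 p2 hD hj hK hp.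
have hLL f : lipb D L f -> lipb D (1 + L) f by apply: lipb_le; rewrite lerDr.
have kA i (hi : (0 < i < 6)%N) := let: And3 u _ _ := hK i hi in u.
have kB i (hi : (0 < i < 6)%N) := let: And3 _ u _ := hK i hi in u.
have kC i (hi : (0 < i < 6)%N) := let: And3 _ _ u := hK i hi in u.
have p1b i (hi : (i < 6)%N) := proj1 (hp i hi).
have p2b i (hi : (i < 6)%N) := proj2 (hp i hi).
have w i : (0 < i < 6)%N -> (i < 6)%N by case/andP.
have [ax ay] := lipb_q2xy K0 kA hD.
have [bx by_] := lipb_q2xy K0 kB hD.
have [cx cy] := lipb_q2xy K0 kC hD.
have P1 := lipb_q2 ler01 p1b hD; have P2 := lipb_q2 ler01 p2b hD.
have [p1x p1y] := lipb_q2xy ler01 (fun i hi => p1b i (w i hi)) hD.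
have [p2x p2y] := lipb_q2xy ler01 (fun i hi => p2b i (w i hi)) hD.
have k2 (d : nat -> R) (hd : forall i, (0 < i < 6)%N -> `|d i| <= K) i : (0 < i < 6)%N ->
    lipb D (2 * K) (fun _ _ => 2 * d i).
  by move=> ?; apply: lipb_cst; rewrite normrM ger0_norm // ler_pM2l // hd.
have k1 (d : nat -> R) (hd : forall i, (0 < i < 6)%N -> `|d i| <= K) i : (0 < i < 6)%N ->
    lipb D (2 * K) (fun _ _ => d i).
  by move=> ?; apply: lipb_cst; rewrite (le_trans (hd _ _))//; lra.
have J : lipb D j0 (jac a b) by apply: lipbB; apply: lipbM.
have Ji : lipb D iv (fun x y => (jac a b x y)^-1) by exact: lipbV.
have Jx : lipb D jx (jacx a b).
  by apply: lipbB; apply: lipbD; apply: lipbM => //; [exact: k2|exact: k1|exact: k1|exact: k2].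
have Jy : lipb D jx (jacy a b).
  by apply: lipbB; apply: lipbD; apply: lipbM => //; [exact: k1|exact: k2|exact: k2|exact: k1].
have N : lipb D n0 (pnum c p1 p2) by apply: lipbD; apply: lipbM.
have Nx : lipb D nx (pnumx c p1 p2).
  by apply: lipbD; apply: lipbD; apply: lipbM => //; [exact: k2|exact: k1].
have Ny : lipb D nx (pnumy c p1 p2).
  by apply: lipbD; apply: lipbD; apply: lipbM => //; [exact: k1|exact: k2].
by split; apply: hLL; apply: lipbM; [apply: lipbB; exact: lipbM|exact: lipbM
 |apply: lipbB; exact: lipbM|exact: lipbM].
Qed.

End QuadraticCalculus.

(** * Quadratic maps of the plane: expansion of distances and local surjectivity *)

Section QuadraticMaps.
Context {R : realType}.
Implicit Types (a b c : nat -> R) (x y : R).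

Definition box x0 y0 r x y : Prop := `|x - x0| <= r /\ `|y - y0| <= r :> R.

(** For a quadratic the mean value theorem holds with the midpoint as intermediate point. Both
    components of a map thus share the same point, and distance estimates become linear algebra. *)
Lemma q2_sub c x y x' y' :
  q2 c x y - q2 c x' y' = q2x c ((x + x') / 2) ((y + y') / 2) * (x - x') +
                          q2y c ((x + x') / 2) ((y + y') / 2) * (y - y').
Proof. by rewrite /q2 /q2x /q2y; field. Qed.

Lemma q2_taylor c x y s t :
  q2 c (x + s) (y + t) = q2 c x y + (q2x c x y * s + q2y c x y * t) +
    (c 3%N * s ^+ 2 + c 4%N * (s * t) + c 5%N * t ^+ 2).
Proof. by rewrite /q2 /q2x /q2y; ring. Qed.

(** Cramer's rule, with the determinant kept on the left. *)
Lemma solve2_bound (a1 a2 b1 b2 s t K c1 : R) : 0 < c1 ->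
  `|a1| <= K -> `|a2| <= K -> `|b1| <= K -> `|b2| <= K ->
  c1 <= a1 * b2 - a2 * b1 ->
  c1 * (`|s| + `|t|) <= 2 * K * (`|a1 * s + a2 * t| + `|b1 * s + b2 * t|).
Proof.
move=> c10 A1 A2 B1 B2 J.
set u := a1 * s + a2 * t; set w := b1 * s + b2 * t.
have J0 : 0 < a1 * b2 - a2 * b1 by exact: lt_le_trans J.
have h1 : c1 * `|s| <= K * (`|u| + `|w|).
  apply: le_trans (_ : `|b2 * u - a2 * w| <= _).
    rewrite (_ : b2 * u - a2 * w = (a1 * b2 - a2 * b1) * s); last by rewrite /u /w; ring.
    by rewrite normrM (gtr0_norm J0) ler_wpM2r.
  by apply: (le_trans (ler_normB _ _)); rewrite !normrM mulrDr lerD // ler_wpM2r.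
have h2 : c1 * `|t| <= K * (`|u| + `|w|).
  apply: le_trans (_ : `|a1 * w - b1 * u| <= _).
    rewrite (_ : a1 * w - b1 * u = (a1 * b2 - a2 * b1) * t); last by rewrite /u /w; ring.
    by rewrite normrM (gtr0_norm J0) ler_wpM2r.
  by apply: (le_trans (ler_normB _ _)); rewrite !normrM addrC mulrDr lerD // ler_wpM2r.
by rewrite mulrDr; apply: (le_trans (lerD h1 h2)); rewrite le_eqVlt; apply/orP; left; apply/eqP; ring.
Qed.

Definition nondeg K (c1 : R) a b (D : R -> R -> Prop) : Prop :=
  forall x y, D x y -> [/\ `|q2x a x y| <= K, `|q2y a x y| <= K,
    `|q2x b x y| <= K, `|q2y b x y| <= K & c1 <= jac a b x y].

Lemma box_mid x0 y0 r x y x' y' : box x0 y0 r x y -> box x0 y0 r x' y' ->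
  box x0 y0 r ((x + x') / 2) ((y + y') / 2).
Proof.
move=> []; rewrite !ler_norml => /andP[h1 h2] /andP[h3 h4].
move=> []; rewrite !ler_norml => /andP[h1' h2'] /andP[h3' h4'].
by split; rewrite ler_norml; apply/andP; split; lra.
Qed.

Lemma quad_lower_lip (K c1 : R) a b x0 y0 r x y x' y' : 0 < c1 ->
  nondeg K c1 a b (box x0 y0 r) -> box x0 y0 r x y -> box x0 y0 r x' y' ->
  c1 * (`|x - x'| + `|y - y'|) <=
  2 * K * (`|q2 a x y - q2 a x' y'| + `|q2 b x y - q2 b x' y'|).
Proof.
move=> c10 nd h h'; have [A1 A2 B1 B2 J] := nd _ _ (box_mid h h').
by rewrite !q2_sub; exact: solve2_bound.
Qed.

Lemma continuous_q2 c : continuous (fun z : R * R => q2 c z.1 z.2).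
Proof.
move=> z; rewrite /q2.
have X : (fun z : R * R => z.1) @ z --> z.1 by apply: cvg_fst.
have Y : (fun z : R * R => z.2) @ z --> z.2 by apply: cvg_snd.
apply: cvgD; last by apply: cvgMl_tmp; exact: (cvgM Y Y).
apply: cvgD; last by apply: cvgMl_tmp; exact: (cvgM X Y).
apply: cvgD; last by apply: cvgMl_tmp; exact: (cvgM X X).
apply: cvgD; last by apply: cvgMl_tmp.
by apply: cvgD; [exact: cvg_cst|apply: cvgMl_tmp].
Qed.

(** Damped Newton step: for a quadratic map with residual u and Newton direction d, the residual
    after the step t d is exactly (1 - t) u + t^2 e, with e the quadratic part of the map at d. Its
    squared norm is |u|^2 - 2 t |u|^2 + O(t^2), and [rho] keeps the step inside the box. *)
Lemma descent (u1 u2 e1 e2 d1 d2 rho : R) : 0 < u1 ^+ 2 + u2 ^+ 2 -> 0 < rho ->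
  exists t : R, [/\ 0 < t, `|t * d1| <= rho, `|t * d2| <= rho &
   ((1 - t) * u1 + t ^+ 2 * e1) ^+ 2 + ((1 - t) * u2 + t ^+ 2 * e2) ^+ 2 < u1 ^+ 2 + u2 ^+ 2].
Proof.
set U := u1 ^+ 2 + u2 ^+ 2 => U0 rho0.
(* [B] dominates the coefficient of t^2 for 0 < t <= 1; the summand 1 allows division by it. *)
pose B := U + 2 * (`|u1 * e1| + `|u2 * e2|) + (e1 ^+ 2 + e2 ^+ 2) + 1.
have e0 : 0 <= e1 ^+ 2 + e2 ^+ 2 by rewrite addr_ge0 ?sqr_ge0.
have n1 := normr_ge0 (u1 * e1); have n2 := normr_ge0 (u2 * e2).
have B0 : 1 <= B by rewrite /B; lra.
pose S := 1 + `|d1| + `|d2|.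
have S0 : 1 <= S by rewrite /S -addrA lerDl addr_ge0.
pose t := Num.min 1 (Num.min (U / B) (rho / S)).
have t0 : 0 < t.
  by rewrite /t !lt_min ltr01 /= !divr_gt0 //; [exact: lt_le_trans S0|exact: lt_le_trans B0].
have t1 : t <= 1 by rewrite /t ge_min lexx.
have tB : t * B <= U.
  rewrite -ler_pdivlMr; last exact: lt_le_trans B0.
  by rewrite /t !ge_min lexx /= orbT.
have tS : t * S <= rho.
  rewrite -ler_pdivlMr; last exact: lt_le_trans S0.
  by rewrite /t !ge_min lexx /= !orbT.
exists t; split => //.
- rewrite normrM (gtr0_norm t0); apply: le_trans tS; rewrite ler_pM2l // /S.
  by rewrite -addrA addrCA lerDl addr_ge0.
- rewrite normrM (gtr0_norm t0); apply: le_trans tS; rewrite ler_pM2l // /S.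
  by rewrite lerDr addr_ge0.
have -> : ((1 - t) * u1 + t ^+ 2 * e1) ^+ 2 + ((1 - t) * u2 + t ^+ 2 * e2) ^+ 2 =
  U - t * (2 * U - t * (U + 2 * (1 - t) * (u1 * e1 + u2 * e2) + t ^+ 2 * (e1 ^+ 2 + e2 ^+ 2))).
  by rewrite /U; ring.
rewrite gtrBl mulr_gt0 // subr_gt0.
apply: le_lt_trans (_ : t * B < _); last by lra.
rewrite ler_pM2l // /B.
have h1 : (1 - t) * (u1 * e1 + u2 * e2) <= `|u1 * e1| + `|u2 * e2|.
  apply: le_trans (_ : 1 * (`|u1 * e1| + `|u2 * e2|) <= _); last by rewrite mul1r.
  apply: le_trans (_ : (1 - t) * (`|u1 * e1| + `|u2 * e2|) <= _).
    by apply: ler_wpM2l; [lra|rewrite lerD ?ler_norm].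
  by apply: ler_wpM2r; [lra|lra].
have h2 : t ^+ 2 * (e1 ^+ 2 + e2 ^+ 2) <= e1 ^+ 2 + e2 ^+ 2.
  by rewrite ler_piMl // exprn_ile1 // ltW.
lra.
Qed.

(* A minimiser of |F - z|^2 over the box is interior because F expands distances
   from the centre; a Newton step would decrease the functional unless F = z. *)
Lemma quad_surj (K c1 : R) a b x0 y0 r z1 z2 : 0 < K -> 0 < c1 -> 0 < r ->
  nondeg K c1 a b (box x0 y0 r) ->
  `|z1 - q2 a x0 y0| + `|z2 - q2 b x0 y0| < c1 * r / (8 * K) ->
  exists x y, [/\ box x0 y0 r x y, q2 a x y = z1 & q2 b x y = z2].
Proof.
move=> K0 c10 r0 nd hz.
pose g (z : R * R) := (q2 a z.1 z.2 - z1) ^+ 2 + (q2 b z.1 z.2 - z2) ^+ 2.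
have cg : continuous g.
  move=> z; rewrite /g; apply: cvgD.
    by apply: (@cvgM _ _ _ _ (fun z => q2 a z.1 z.2 - z1) (fun z => q2 a z.1 z.2 - z1));
     (apply: cvgB; [exact: continuous_q2|exact: cvg_cst]).
  by apply: (@cvgM _ _ _ _ (fun z => q2 b z.1 z.2 - z2) (fun z => q2 b z.1 z.2 - z2));
     (apply: cvgB; [exact: continuous_q2|exact: cvg_cst]).
pose A : set (R * R) := `[x0 - r, x0 + r] `*` `[y0 - r, y0 + r].
have AE z : A z <-> box x0 y0 r z.1 z.2.
  rewrite /A /= !in_itv /= /box !ler_distl; split=> [[-> ->]//|[-> ->]//].
have cA : compact A by apply: compact_setX; exact: segment_compact.
have A0 : A !=set0 by exists (x0, y0); apply/AE; split; rewrite /= subrr normr0 ltW.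
have [[x y] /set_mem /AE /= Axy gmin] := compact_EVT_min A0 cA (continuous_subspaceT cg).
have K8 : 0 < 8 * K by rewrite mulr_gt0.
have gc : g (x, y) <= (`|z1 - q2 a x0 y0| + `|z2 - q2 b x0 y0|) ^+ 2.
  apply: le_trans (_ : g (x0, y0) <= _).
    by apply: gmin; apply/mem_set/AE; split; rewrite /= subrr normr0 ltW.
  rewrite /g /= -(real_normK (num_real (_ - z1))) -(real_normK (num_real (_ - z2))).
  rewrite (distrC _ z1) (distrC _ z2).
  have := normr_ge0 (z1 - q2 a x0 y0); have := normr_ge0 (z2 - q2 b x0 y0); nra.
have [hx|hx] := eqVneq ((q2 a x y - z1) ^+ 2 + (q2 b x y - z2) ^+ 2) 0.
  exists x, y; split => //; apply/eqP; rewrite -subr_eq0 -sqrf_eq0.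
    by move/eqP: hx; rewrite paddr_eq0 ?sqr_ge0 // => /andP[].
  by move/eqP: hx; rewrite paddr_eq0 ?sqr_ge0 // => /andP[].
exfalso.
have U0 : 0 < (q2 a x y - z1) ^+ 2 + (q2 b x y - z2) ^+ 2.
  by rewrite lt_neqAle eq_sym hx addr_ge0 ?sqr_ge0.
have c0 : box x0 y0 r x0 y0 by split; rewrite subrr normr0 ltW.
(* With Z the l1 distance from the target to the image of the centre, a minimiser with l1 distance
   at least [r] from the centre would have an image more than 4 Z away from that of the centre,
   hence a residual above 3 Z, whereas the centre already achieves Z. *)
have inn : `|x - x0| + `|y - y0| < r.
  rewrite ltNge; apply/negP => rle.
  have := quad_lower_lip c10 nd Axy c0.
  set P := `|q2 a x y - _|; set Q := `|q2 b x y - _| => hlow.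
  set Z := `|z1 - _| + _ in hz gc.
  have h1 : c1 * r <= 2 * K * (P + Q) by apply: le_trans hlow; rewrite ler_pM2l.
  have h2 : 8 * K * Z < c1 * r by rewrite mulrC -ltr_pdivlMr.
  have h3 : 4 * Z < P + Q by rewrite -(ltr_pM2l K0); lra.
  have hP : P <= `|q2 a x y - z1| + `|z1 - q2 a x0 y0| by rewrite /P ler_distD.
  have hQ : Q <= `|q2 b x y - z2| + `|z2 - q2 b x0 y0| by rewrite /Q ler_distD.
  have Z0 : 0 <= Z by rewrite addr_ge0.
  have h4 : 3 * Z < `|q2 a x y - z1| + `|q2 b x y - z2| by move: hP hQ h3; rewrite /Z; lra.
  move: gc; rewrite /g /= -(real_normK (num_real (_ - z1))) -(real_normK (num_real (_ - z2))).
  set p := `|q2 a x y - z1| in h4 *; set q := `|q2 b x y - z2| in h4 *.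
  have h5 : 0 < (p + q - 3 * Z) * (p + q + 3 * Z) by apply: mulr_gt0; lra.
  by have := sqr_ge0 (p - q); have := sqr_ge0 p; have := sqr_ge0 q; nra.
have [A1 A2 B1 B2 J] := nd _ _ Axy.
have J0 : jac a b x y != 0 by rewrite gt_eqF // (lt_le_trans c10).
pose u1 := q2 a x y - z1; pose u2 := q2 b x y - z2.
pose d1 := - (q2y b x y * u1 - q2y a x y * u2) / jac a b x y.
pose d2 := - (q2x a x y * u2 - q2x b x y * u1) / jac a b x y.
have E1 : q2x a x y * d1 + q2y a x y * d2 = - u1.
  by rewrite /d1 /d2; move: J0; rewrite /jac => J0; field.
have E2 : q2x b x y * d1 + q2y b x y * d2 = - u2.
  by rewrite /d1 /d2; move: J0; rewrite /jac => J0; field.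
have rho0 : 0 < r - (`|x - x0| + `|y - y0|) by rewrite subr_gt0.
have [t [t0 ht1 ht2]] := descent (a 3%N * d1 ^+ 2 + a 4%N * (d1 * d2) + a 5%N * d2 ^+ 2)
  (b 3%N * d1 ^+ 2 + b 4%N * (d1 * d2) + b 5%N * d2 ^+ 2) d1 d2 U0 rho0.
apply/negP; rewrite -leNgt -/u1 -/u2.
have : g (x, y) <= g (x + t * d1, y + t * d2).
  apply: gmin; apply/mem_set/AE; split => /=.
    rewrite addrAC; apply: (le_trans (ler_normD _ _)).
    have := normr_ge0 (y - y0); lra.
  rewrite addrAC; apply: (le_trans (ler_normD _ _)).
  have := normr_ge0 (x - x0); lra.
rewrite /g /= !q2_taylor -/u1 -/u2.
have <- : q2 a x y + (q2x a x y * (t * d1) + q2y a x y * (t * d2)) +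
     (a 3%N * (t * d1) ^+ 2 + a 4%N * (t * d1 * (t * d2)) + a 5%N * (t * d2) ^+ 2) - z1
  = (1 - t) * u1 + t ^+ 2 * (a 3%N * d1 ^+ 2 + a 4%N * (d1 * d2) + a 5%N * d2 ^+ 2).
  rewrite (_ : q2x a x y * (t * d1) + q2y a x y * (t * d2) = t * (q2x a x y * d1 + q2y a x y * d2)); last by ring.
  by rewrite E1 /u1; ring.
have <- : q2 b x y + (q2x b x y * (t * d1) + q2y b x y * (t * d2)) +
     (b 3%N * (t * d1) ^+ 2 + b 4%N * (t * d1 * (t * d2)) + b 5%N * (t * d2) ^+ 2) - z2
  = (1 - t) * u2 + t ^+ 2 * (b 3%N * d1 ^+ 2 + b 4%N * (d1 * d2) + b 5%N * d2 ^+ 2).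
  rewrite (_ : q2x b x y * (t * d1) + q2y b x y * (t * d2) = t * (q2x b x y * d1 + q2y b x y * d2)); last by ring.
  by rewrite E2 /u2; ring.
by [].
Qed.

End QuadraticMaps.

(** * Lower bounds for L2 norms from values on a square *)

Section SobolevLowerBound.
Context {R : realType}.
Import HBNNSimple.

(** [f] may be non-measurable: [k] times the indicator of [Q] is one of the simple functions below
    it, and the integral is the supremum over these. *)
Lemma le_integral_ge (d : measure_display) (T : measurableType d)
    (mu : {measure set T -> \bar R}) (f : T -> \bar R) (Q : set T) (k : R) :
  measurable Q -> 0 <= k -> (forall x, 0%E <= f x)%E ->
  (forall x, Q x -> k%:E <= f x)%E -> (k%:E * mu Q <= \int[mu]_x f x)%E.
Proof.
move=> mQ k0 f0 kf; rewrite ge0_integralTE //.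
apply: le_ereal_sup_tmp; exists (k%:E * mu Q)%E => //.
exists (scale_nnsfun (indic_nnsfun R mQ) k0).
  move=> x; rewrite [scale_nnsfun _ _ x]/= measurable_realfun.mindicE; case: (boolP (x \in Q)) => [/set_mem Qx|_].
    by rewrite mulr1 kf.
  by rewrite mulr0.
transitivity (k%:E * sintegral mu (\1_Q : T -> R))%E; last by rewrite sintegral_indic.
exact: (sintegralrM mu k (indic_nnsfun R mQ)).
Qed.

Lemma mu2_square (a1 a2 s : R) : 0 <= s ->
  mu2 (`]a1, a1 + s[ `*` `]a2, a2 + s[) = (s ^+ 2)%:E.
Proof.
move=> s0; rewrite [LHS]product_measure1E //=. rewrite (lebesgue_measure_itv `]a1, a1 + s[) (lebesgue_measure_itv `]a2, a2 + s[) /= !lte_fin.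
move: s0; rewrite le_eqVlt => /orP[/eqP <-|s0].
  by rewrite !addr0 !ltxx expr0n /= mule0.
by rewrite !ltrDl s0 -!EFinB -EFinM; congr EFin; ring.
Qed.

(** Takes the place of a change of variables: the image of a reference box will enter only through a
    square that it contains. *)
Lemma L2norm_ge_square (A : set 'cV[R]_2) (f : 'cV[R]_2 -> R) (k s a1 a2 : R) :
  0 <= k -> 0 <= s ->
  (forall y1 y2, a1 < y1 < a1 + s -> a2 < y2 < a2 + s ->
     A (mkpt y1 y2) /\ k <= `|f (mkpt y1 y2)|) ->
  ((k * s)%:E <= L2norm A f)%E.
Proof.
move=> k0 s0 h; rewrite /L2norm unlock /=.
have ks : (k * s = (k ^+ 2 * s ^+ 2) `^ 2^-1)%R.
  by rewrite -exprMn powR12_sqrt ?sqr_ge0 // sqrtr_sqr ger0_norm // mulr_ge0.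
rewrite ks -poweR_EFin; apply: gt0_ler_poweR => //.
- by rewrite in_itv /= leey andbT lee_fin mulr_ge0 ?sqr_ge0.
- by rewrite in_itv /= leey andbT integral_ge0 // => x _; exact: poweR_ge0.
rewrite EFinM -(mu2_square a1 a2 s0); refine (@le_integral_ge _ _ mu2 _ (`]a1, a1 + s[ `*` `]a2, a2 + s[) (k ^+ 2) _ _ _ _).
- by apply: measurableX.
- exact: sqr_ge0.
- by move=> x; exact: poweR_ge0.
move=> [y1 y2] [/=]; rewrite !in_itv /= => h1 h2.
have [Ay ky] := h _ _ h1 h2.
rewrite /patch mem_set //=. rewrite lee_fin powR_mulrn //.
by rewrite ler_pXn2r // nnegrE (le_trans k0).
Qed.

End SobolevLowerBound.

(** * Partial derivatives of quadratics and Piola quotients *)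

Section PlaneCalculus.
Context {R : realType}.
Implicit Types (a b c p q : nat -> R) (x y : R).

Lemma is_derive_q2x c x y : is_derive x 1 (fun t => q2 c t y) (q2x c x y).
Proof.
pose f : R -> R := cst (c 0%N + c 2%N * y + c 5%N * y ^+ 2) + (c 1%N + c 4%N * y) \*: (id : R -> R)
  + c 3%N \*: ((id : R -> R) ^+ 2).
have -> : (fun t => q2 c t y) = f.
  by apply/funext => t; rewrite /q2 /f !fctE /= /GRing.scale /=; ring.
by apply: is_derive_eq; rewrite /q2x /= /GRing.scale /=; ring.
Qed.

Lemma is_derive_q2y c x y : is_derive y 1 (fun t => q2 c x t) (q2y c x y).
Proof.
(* The coefficients after exchanging the two variables. *)
pose c' i : R := nth 0 [:: c 0%N; c 2%N; c 1%N; c 5%N; c 4%N; c 3%N] i.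
have -> : (fun t => q2 c x t) = (fun t => q2 c' t x).
  by apply/funext => t; rewrite /q2 /c' /=; ring.
by apply: is_derive_eq (is_derive_q2x c' y x) _; rewrite /q2x /q2y /c' /=; ring.
Qed.

Lemma is_derive_affine (k l x : R) : is_derive x 1 (fun t => k + l * t) l.
Proof.
pose f : R -> R := cst k + l \*: (id : R -> R).
have -> : (fun t => k + l * t) = f by apply/funext => t; rewrite /f !fctE.
by apply: is_derive_eq; rewrite add0r /GRing.scale /= mulr1.
Qed.

Lemma is_derive_mulE (f g : R -> R) x df dg d : is_derive x 1 f df -> is_derive x 1 g dg ->
  df * g x + f x * dg = d -> is_derive x 1 (fun t => f t * g t) d.
Proof.
move=> hf hg <-; apply: is_derive_eq (is_deriveM hf hg) _.
by rewrite /GRing.scale /= addrC mulrC.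
Qed.

Lemma is_derive_q2xx c x y : is_derive x 1 (fun t => q2x c t y) (2 * c 3%N).
Proof.
have -> : (fun t => q2x c t y) = (fun t => (c 1%N + c 4%N * y) + 2 * c 3%N * t).
  by apply/funext => t; rewrite /q2x; ring.
exact: is_derive_affine.
Qed.

Lemma is_derive_q2xy c x y : is_derive y 1 (fun t => q2x c x t) (c 4%N).
Proof. exact: is_derive_affine. Qed.

Lemma is_derive_q2yx c x y : is_derive x 1 (fun t => q2y c t y) (c 4%N).
Proof.
have -> : (fun t => q2y c t y) = (fun t => (c 2%N + 2 * c 5%N * y) + c 4%N * t).
  by apply/funext => t; rewrite /q2y; ring.
exact: is_derive_affine.
Qed.

Lemma is_derive_q2yy c x y : is_derive y 1 (fun t => q2y c x t) (2 * c 5%N).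
Proof. exact: is_derive_affine. Qed.

Lemma is_derive_piolax a b c p q x y : jac a b x y != 0 ->
  is_derive x 1 (fun t => piola a b c p q t y) (piolax a b c p q x y).
Proof.
move=> J; have := (is_derive_q2xx, is_derive_q2yx, is_derive_q2x) => -[[dx dy] d].
rewrite /piola /pnum; apply: is_derive_mulE.
by rewrite /piolax /pnum /pnumx /jacx /GRing.scale /=; field.
Qed.

Lemma is_derive_piolay a b c p q x y : jac a b x y != 0 ->
  is_derive y 1 (fun t => piola a b c p q x t) (piolay a b c p q x y).
Proof.
move=> J; have := (is_derive_q2xy, is_derive_q2yy, is_derive_q2y) => -[[dx dy] d].
rewrite /piola /pnum; apply: is_derive_mulE.
by rewrite /piolay /pnum /pnumy /jacy /GRing.scale /=; field.
Qed.

Lemma mvt_bound (f df : R -> R) (s t G : R) :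
  (forall u, Num.min s t <= u <= Num.max s t -> is_derive u 1 f (df u) /\ `|df u| <= G) ->
  `|f s - f t| <= G * `|s - t|.
Proof.
wlog st : s t / s <= t.
  move=> h hyp; case: (leP s t) => [st|/ltW ts]; first exact: h.
  by rewrite distrC (distrC s); apply: h => // u; rewrite minC maxC; exact: hyp.
rewrite (min_idPl st) (max_idPr st) => hyp.
have [u ust E] : exists2 u, u \in `[s, t] & f t - f s = df u * (t - s).
  apply: MVT_segment => // [u|].
    by rewrite in_itv /= => /andP[/ltW su /ltW ut]; have [] := hyp u; rewrite ?su ?ut.
  apply: derivable_within_continuous => u; rewrite in_itv /= => hu.
  by have [hd _] := hyp _ hu; exact: (@ex_derive _ _ _ _ _ _ _ hd).
rewrite distrC E normrM (distrC s) ler_wpM2r //.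
by move: ust; rewrite in_itv /= => /hyp[].
Qed.

(** Partial derivatives suffice along the path that turns at the corner (x', y), which lies in the
    box. *)
Lemma box_mvt (W Wx Wy : R -> R -> R) (x0 y0 r G x y x' y' : R) :
  (forall x y, box x0 y0 r x y -> [/\ is_derive x 1 (fun t => W t y) (Wx x y),
     is_derive y 1 (fun t => W x t) (Wy x y), `|Wx x y| <= G & `|Wy x y| <= G]) ->
  box x0 y0 r x y -> box x0 y0 r x' y' ->
  `|W x y - W x' y'| <= G * (`|x - x'| + `|y - y'|).
Proof.
move=> h [hx hy] [hx' hy'].
have btw (k s t u : R) : `|s - k| <= r -> `|t - k| <= r ->
    Num.min s t <= u <= Num.max s t -> `|u - k| <= r.
  rewrite !ler_norml => /andP[s1 s2] /andP[t1 t2] /andP[].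
  rewrite ge_min le_max => /orP[u1|u1] /orP[u2|u2]; apply/andP; split; lra.
apply: (le_trans (ler_distD (W x' y) _ _)); rewrite mulrDr; apply: lerD.
  apply: (@mvt_bound (fun t => W t y) (fun t => Wx t y)) => u hu.
  by have [] := h u y; first by split => //; exact: btw hu.
apply: (@mvt_bound (fun t => W x' t) (fun t => Wy x' t)) => u hu.
by have [] := h x' u; first by split => //; exact: btw hu.
Qed.

Definition plane (f : R -> R -> R) (z : 'cV[R]_2) : R := f (z ord0 ord0) (z ord_max ord0).

Lemma mkptE (z : 'cV[R]_2) : mkpt (z ord0 ord0) (z ord_max ord0) = z.
Proof.
apply/matrixP => i j; rewrite mxE (ord1 j); case: eqP => [->//|/eqP h].
by congr (z _ _); apply/val_inj; case: i h => [[|[|//]]].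
Qed.

Lemma mkpt0 x y : mkpt x y ord0 ord0 = x. Proof. by rewrite mxE. Qed.
Lemma mkpt1 x y : mkpt x y ord_max ord0 = y. Proof. by rewrite mxE. Qed.

Lemma derive_planex (f : 'cV[R]_2 -> R) x y :
  'D_(evec ord0) f (mkpt x y) = 'D_1 (fun t => f (mkpt t y)) x.
Proof.
rewrite /derive /= (_ : (fun h : R => h^-1 *: (f (h *: evec ord0 + mkpt x y) - f (mkpt x y))) =
   (fun h => h^-1 *: (f (mkpt (h *: 1 + x) y) - f (mkpt x y)))) //.
apply/funext => h; congr (_ *: (f _ - _)); rewrite -[LHS]mkptE; congr mkpt; rewrite !mxE /=.
  by rewrite /GRing.scale /=.
by rewrite mulr0 add0r.
Qed.

Lemma derive_planey (f : 'cV[R]_2 -> R) x y :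
  'D_(evec ord_max) f (mkpt x y) = 'D_1 (fun t => f (mkpt x t)) y.
Proof.
rewrite /derive /= (_ : (fun h : R => h^-1 *: (f (h *: evec ord_max + mkpt x y) - f (mkpt x y))) =
   (fun h => h^-1 *: (f (mkpt x (h *: 1 + y)) - f (mkpt x y)))) //.
apply/funext => h; congr (_ *: (f _ - _)); rewrite -[LHS]mkptE; congr mkpt; rewrite !mxE /=.
  by rewrite mulr0 add0r.
by rewrite /GRing.scale /=.
Qed.

Lemma differentiable_q2 c z : differentiable (plane (q2 c)) z.
Proof.
have X := @differentiable_coord R _ _ z ord0 ord0.
have Y := @differentiable_coord R _ _ z ord_max ord0.
rewrite /plane /q2; repeat (apply: differentiableD || apply: differentiableM ||
  exact: differentiable_cst || exact: X || exact: Y).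
Qed.

Lemma differentiable_q2xy c z : differentiable (plane (q2x c)) z /\ differentiable (plane (q2y c)) z.
Proof.
have X := @differentiable_coord R _ _ z ord0 ord0.
have Y := @differentiable_coord R _ _ z ord_max ord0.
by split; rewrite /plane /q2x /q2y; repeat (apply: differentiableD || apply: differentiableM ||
  exact: differentiable_cst || exact: X || exact: Y).
Qed.

Lemma differentiable_piola a b c p q z : plane (jac a b) z != 0 ->
  differentiable (plane (piola a b c p q)) z.
Proof.
move=> J.
have [ax ay] := differentiable_q2xy a z.
have [bx by_] := differentiable_q2xy b z.
have [cx cy] := differentiable_q2xy c z.
have P := differentiable_q2 p z; have Q := differentiable_q2 q z.
apply: differentiableM; first by apply: differentiableD; exact: differentiableM.
by apply: differentiableV => //; apply: differentiableB; exact: differentiableM.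
Qed.

End PlaneCalculus.

(** * Chain rule, and recovery of quadratic coefficients from values *)

Section Poincare.
Context {R : realType}.
Implicit Types (a b c p q : nat -> R) (x y : R).

Lemma mkptD_evec x y : mkpt x y = x *: evec ord0 + y *: evec ord_max :> 'cV[R]_2.
Proof.
rewrite -[RHS]mkptE; congr mkpt; rewrite !mxE /=; first by rewrite mulr1 mulr0 addr0.
by rewrite mulr1 mulr0 add0r.
Qed.

Lemma linear_comb2 (V : lmodType R) (L : {linear V -> R}) (s t : R) (u w : V) :
  L (s *: u + t *: w) = s * L u + t * L w.
Proof. by rewrite linearD !linearZ. Qed.

Lemma derive_chain2 (g f1 f2 : 'cV[R]_2 -> R) (z e : 'cV[R]_2) :
  differentiable f1 z -> differentiable f2 z -> differentiable g (mkpt (f1 z) (f2 z)) ->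
  'D_e (fun t => g (mkpt (f1 t) (f2 t))) z =
    'D_e f1 z * 'D_(evec ord0) g (mkpt (f1 z) (f2 z)) +
    'D_e f2 z * 'D_(evec ord_max) g (mkpt (f1 z) (f2 z)).
Proof.
move=> d1 d2 dg.
have dS (f : 'cV[R]_2 -> R) (u : 'cV[R]_2) : differentiable f z ->
    is_diff z (fun t => f t *: u) (fun t => 'd f z t *: u).
  move=> df; have df' : is_diff z f ('d f z) by exact: differentiableP.
  exact: (is_diff_comp df' (is_diff_scalel (f z) u)).
pose F := (fun t => f1 t *: (evec ord0 : 'cV[R]_2)) + (fun t => f2 t *: (evec ord_max : 'cV[R]_2)).
have FE t : mkpt (f1 t) (f2 t) = F t by rewrite mkptD_evec.
have dF : is_diff z F ((fun t => 'd f1 z t *: evec ord0) + (fun t => 'd f2 z t *: evec ord_max)).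
  by apply: is_diffD; exact: dS.
have -> : (fun t => g (mkpt (f1 t) (f2 t))) = g \o F by apply/funext => t; rewrite FE.
rewrite FE in dg *.
have dFz : differentiable F z by case: dF.
rewrite deriveE; last exact: differentiable_comp.
rewrite diff_comp //= (_ : 'd F z e = 'd f1 z e *: evec ord0 + 'd f2 z e *: evec ord_max); last first.
  by case: dF => _ ->.
rewrite (deriveE e d1) (deriveE e d2) (deriveE (evec ord0) dg) (deriveE (evec ord_max) dg).
exact: (linear_comb2 ('d g (F z))).
Qed.

Lemma entry_le_enorm m n (A : 'M[R]_(m, n)) i j : `|A i j| <= enorm A.
Proof.
rewrite /enorm -sqrtr_sqr ler_sqrt; last by apply: sumr_ge0 => *; apply: sumr_ge0 => *; exact: sqr_ge0.
rewrite (bigD1 i) //= (bigD1 j) //= -addrA lerDl addr_ge0 //.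
  by apply: sumr_ge0 => *; exact: sqr_ge0.
by apply: sumr_ge0 => *; apply: sumr_ge0 => *; exact: sqr_ge0.
Qed.

(** [g] is a differentiable local representative of a component of [v], in practice [W] composed
    with the inverse chart; the bound is then the chain rule for [W] as [g] composed with (f1,
    f2). *)
Lemma derive_le_Dmx (v : 'cV[R]_2 -> 'cV[R]_2) (g W f1 f2 : 'cV[R]_2 -> R) (z : 'cV[R]_2) i j k :
  differentiable f1 z -> differentiable f2 z -> differentiable g (mkpt (f1 z) (f2 z)) ->
  (\forall y \near mkpt (f1 z) (f2 z), v y i ord0 = g y) ->
  (\forall t \near z, g (mkpt (f1 t) (f2 t)) = W t) ->
  `|'D_(evec j) f1 z| <= k -> `|'D_(evec j) f2 z| <= k ->
  `|'D_(evec j) W z| <= 2 * k * enorm (Dmx v (mkpt (f1 z) (f2 z))).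
Proof.
move=> d1 d2 dg vg gW k1 k2.
rewrite -(@near_eq_derive _ _ _ _ _ _ (evec j) gW) (derive_chain2 _ d1 d2 dg).
set A := Dmx v _.
have E l : 'D_(evec l) g (mkpt (f1 z) (f2 z)) = A i l.
  by rewrite mxE; apply/esym; exact: near_eq_derive vg.
rewrite !E; apply: (le_trans (ler_normD _ _)); rewrite !normrM.
have -> : 2 * k * enorm A = k * enorm A + k * enorm A by ring.
by apply: lerD; apply: ler_pM => //; exact: entry_le_enorm.
Qed.

(** Differences of six samples (the centre, its four axis neighbours at distance [rho], one corner)
    give the Taylor coefficients at (X, Y); second differences cost rho^-2. Re-expanding at the
    origin gives factors 9 in degree one and 1 + 9 + 9 + 2 + 4 + 2 = 27 in degree zero. *)
Lemma q2_coef_bound c X Y rho e : 0 < rho <= 1 -> `|X| <= 1 -> `|Y| <= 1 ->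
  (forall x y, box X Y rho x y -> `|q2 c x y| <= e) ->
  forall i, (i < 6)%N -> `|c i| <= 27 / rho ^+ 2 * e.
Proof.
move=> /andP[r0 r1] X1 Y1 h.
have bx (s t : R) : `|s| <= rho -> `|t| <= rho -> `|q2 c (X + s) (Y + t)| <= e.
  by move=> hs ht; apply: h; split; rewrite addrAC subrr add0r.
have rr : `|rho| <= rho by rewrite ger0_norm // ltW.
have rn : `|- rho| <= rho by rewrite normrN.
have r00 : `|0 : R| <= rho by rewrite normr0 ltW.
have := (bx _ _ r00 r00, bx _ _ rr r00, bx _ _ rn r00) => -[[]].
have := (bx _ _ r00 rr, bx _ _ r00 rn, bx _ _ rr rr) => -[[]].
rewrite !q2_taylor.
set q := q2 c X Y; set u := q2x c X Y; set w := q2y c X Y.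
have E1 : c 1%N = u - 2 * c 3%N * X - c 4%N * Y by rewrite /u /q2x; ring.
have E2 : c 2%N = w - 2 * c 5%N * Y - c 4%N * X by rewrite /w /q2y; ring.
have E0 : c 0%N = q - (c 1%N * X + c 2%N * Y + (c 3%N * (X * X) + c 4%N * (X * Y) + c 5%N * (Y * Y))).
  by rewrite /q /q2; ring.
move=> H1 H2 H3 H4 H5 H6.
have e0 : 0 <= e by exact: le_trans H4.
have ri : 0 < rho ^+ 2 by rewrite exprn_gt0.
pose E := e / rho ^+ 2.
have eE : e = E * rho ^+ 2 by rewrite /E mulfVK // gt_eqF.
have E0' : 0 <= E by rewrite divr_ge0 // ltW.
have eleE : e <= E by rewrite eE ler_piMr // exprn_ile1 // ltW.
have scale k (t : R) : `|t * rho ^+ 2| <= k * e -> `|t| <= k * E.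
  by rewrite normrM (gtr0_norm ri) eE mulrA ler_pM2r.
have C3 : `|c 3%N| <= 2 * E.
  apply: scale; move: H4 H5 H6; clear; rewrite !ler_norml => /andP[? ?] /andP[? ?] /andP[? ?].
  by apply/andP; split; lra.
have C5 : `|c 5%N| <= 2 * E.
  apply: scale; move: H4 H1 H2; clear; rewrite !ler_norml => /andP[? ?] /andP[? ?] /andP[? ?].
  by apply/andP; split; lra.
have C4 : `|c 4%N| <= 4 * E.
  apply: scale; move: H4 H1 H5 H3; clear; rewrite !ler_norml => /andP[? ?] /andP[? ?] /andP[? ?] /andP[? ?].
  by apply/andP; split; lra.
have scale1 (t : R) : `|t * rho| <= e -> `|t| <= E.
  move=> ht; rewrite -[E]mul1r; apply: scale; rewrite mul1r expr2 mulrA normrM (gtr0_norm r0).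
  by apply: le_trans (ler_piMr _ r1) ht.
have U : `|u| <= E.
  apply: scale1; move: H5 H6; clear; rewrite !ler_norml => /andP[? ?] /andP[? ?].
  by apply/andP; split; lra.
have W : `|w| <= E.
  apply: scale1; move: H1 H2; clear; rewrite !ler_norml => /andP[? ?] /andP[? ?].
  by apply/andP; split; lra.
have mulle (s t k : R) : `|s| <= k -> `|t| <= 1 -> `|s * t| <= k.
  move=> hs ht; rewrite normrM -[k]mulr1; exact: ler_pM.
have C1 : `|c 1%N| <= 9 * E.
  have := mulle _ _ _ C3 X1; have := mulle _ _ _ C4 Y1.
  rewrite E1; move: U; clear; rewrite !ler_norml => /andP[? ?] /andP[? ?] /andP[? ?].
  by apply/andP; split; lra.
have C2 : `|c 2%N| <= 9 * E.
  have := mulle _ _ _ C5 Y1; have := mulle _ _ _ C4 X1.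
  rewrite E2; move: W; clear; rewrite !ler_norml => /andP[? ?] /andP[? ?] /andP[? ?].
  by apply/andP; split; lra.
have C0 : `|c 0%N| <= 27 * E.
  have q0 : `|q| <= E.
    by apply: le_trans eleE; apply: le_trans H4; rewrite !mulr0 expr0n /= !mulr0 !addr0.
  have := mulle _ _ _ C1 X1; have := mulle _ _ _ C2 Y1.
  have := mulle _ _ _ C3 (mulle _ _ _ X1 X1).
  have := mulle _ _ _ C4 (mulle _ _ _ X1 Y1).
  have := mulle _ _ _ C5 (mulle _ _ _ Y1 Y1).
  rewrite E0; move: q0; clear; rewrite !ler_norml => /andP[? ?] /andP[? ?] /andP[? ?] /andP[? ?] /andP[? ?] /andP[? ?].
  by apply/andP; split; lra.
have -> : 27 / rho ^+ 2 * e = 27 * E by rewrite /E; ring.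
have up k (t : R) : k <= 27 -> `|t| <= k * E -> `|t| <= 27 * E.
  by move=> hk /le_trans; apply; rewrite ler_wpM2r.
by move=> [|[|[|[|[|[|//]]]]]] _ //; [apply: up C1|apply: up C2|apply: up C3|apply: up C4|apply: up C5]; rewrite ler_nat.
Qed.

End Poincare.

(** * Piola patches and their gradients *)

Section PiolaPoincare.
Context {R : realType}.
Implicit Types (a b c p q : nat -> R) (x y : R).

Lemma piola_scale a b c p q p' q' (M : R) : (forall i, (i < 6)%N -> p i = M * p' i) ->
  (forall i, (i < 6)%N -> q i = M * q' i) ->
  (forall x y, piolax a b c p q x y = M * piolax a b c p' q' x y) /\
  (forall x y, piolay a b c p q x y = M * piolay a b c p' q' x y).
Proof.
have E f f' x y : (forall i, (i < 6)%N -> f i = M * f' i) ->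
    [/\ q2 f x y = M * q2 f' x y, q2x f x y = M * q2x f' x y & q2y f x y = M * q2y f' x y].
  by move=> hf; split; rewrite /q2 /q2x /q2y !hf //; ring.
move=> hp hq; split=> x y; have [p1 p2 p3] := E _ _ x y hp; have [q1 q2 q3] := E _ _ x y hq.
  by rewrite /piolax /pnum /pnumx p1 p2 q1 q2; ring.
by rewrite /piolay /pnum /pnumy p1 p3 q1 q3; ring.
Qed.

Lemma lipb_piola_le (K c1 : R) : 0 <= K -> 0 < c1 -> exists2 L, 0 < L &
  forall D a b c p q M, (forall x y, D x y -> `|x| <= 1 /\ `|y| <= 1) ->
    (forall x y, D x y -> c1 <= jac a b x y) ->
    (forall i, (0 < i < 6)%N -> [/\ `|a i| <= K, `|b i| <= K & `|c i| <= K]) ->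
    0 <= M -> (forall i, (i < 6)%N -> `|p i| <= M /\ `|q i| <= M) ->
    lipb D (L * M) (piolax a b c p q) /\ lipb D (L * M) (piolay a b c p q).
Proof.
move=> K0 c10; have [L L0 hL] := lipb_piola K0 c10; exists L => // D a b c p q M hD hj hK M0 hpq.
have E (f : nat -> R) : (forall i, (i < 6)%N -> `|f i| <= M) ->
    (forall i, (i < 6)%N -> f i = M * (f i / M)) /\ (forall i, (i < 6)%N -> `|f i / M| <= 1).
  move=> hf; have [M00|M00] := eqVneq M 0.
    split=> i /hf; rewrite M00 normr_le0 => /eqP ->; first by rewrite mul0r.
    by rewrite mul0r normr0.
  have Mp : 0 < M by rewrite lt_neqAle eq_sym M00.
  split=> i /hf hi; first by rewrite mulrC mulfVK.
  by rewrite normrM normfV (gtr0_norm Mp) ler_pdivrMr // mul1r.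
have [p1 p2] := E p (fun i hi => proj1 (hpq i hi)).
have [q1 q2] := E q (fun i hi => proj2 (hpq i hi)).
have [Ex Ey] := piola_scale a b c p1 q1.
have [lx ly] := hL D a b c _ _ hD hj hK (fun i hi => conj (p2 i hi) (q2 i hi)).
have sc f g : lipb D L f -> (forall x y, g x y = M * f x y) -> lipb D (L * M) g.
  move=> [_ fb fl] gE; split; first by rewrite mulr_ge0 // ltW.
    by move=> x y /fb; rewrite gE normrM (ger0_norm M0) mulrC => h; exact: ler_wpM2r.
  move=> x y x' y' Dx Dx'; rewrite !gE -mulrBr normrM (ger0_norm M0) (mulrC L) -mulrA.
  by rewrite ler_wpM2l // fl.
by split; [exact: sc lx Ex|exact: sc ly Ey].
Qed.

(** An element seen near the centre (X, Y) of a Clough-Tocher triangle: [S] is the element, [phi]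
    the inverse of its map, whose components are [h] times the quadratics [a] and [b]. The scaling h
    / h^2 of DF / det DF yields the factor h^-1. The box has radius [2 rho] to leave room for moving
    away from points of the box of radius [rho]. The vector [k] allows a constant to be split off
    without changing [v]. *)
Record patch (K c1 h rho X Y : R) a b p q (S : set 'cV[R]_2)
    (phi v : 'cV[R]_2 -> 'cV[R]_2) (k : 'cV[R]_2) : Prop := Patch {
  patch_h : 0 < h;
  patch_unit : forall x y, box X Y (2 * rho) x y -> `|x| <= 1 /\ `|y| <= 1;
  patch_coef : forall i, (0 < i < 6)%N -> `|a i| <= K /\ `|b i| <= K;
  patch_jac : forall x y, box X Y (2 * rho) x y -> c1 <= jac a b x y;
  patch_img : forall x y, box X Y (2 * rho) x y -> S (mkpt (h * q2 a x y) (h * q2 b x y));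
  patch_inv : forall z, S° z -> differentiable phi z /\
     mkpt (h * plane (q2 a) (phi z)) (h * plane (q2 b) (phi z)) = z;
  patch_left : forall x y, box X Y (2 * rho) x y ->
     phi (mkpt (h * q2 a x y) (h * q2 b x y)) = mkpt x y;
  patch_val : forall x y, box X Y (2 * rho) x y ->
     v (mkpt (h * q2 a x y) (h * q2 b x y)) =
       k + h^-1 *: mkpt (piola a b a p q x y) (piola a b b p q x y) }.

Lemma is_derive_scal (k : R) (f : R -> R) (x df : R) :
  is_derive x 1 f df -> is_derive x 1 (fun t => k * f t) (k * df).
Proof.
by move=> h; apply: (is_derive_mulE (is_derive_cst k x 1) h); rewrite mul0r add0r.
Qed.

Lemma is_derive_addl (k : R) (f : R -> R) (x df : R) :
  is_derive x 1 f df -> is_derive x 1 (fun t => k + f t) df.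
Proof.
by move=> h; apply: is_derive_eq (is_deriveD (is_derive_cst k x 1) h) _; rewrite add0r.
Qed.

Lemma q2xy_bound (K : R) c x y : `|x| <= 1 -> `|y| <= 1 ->
  (forall i, (0 < i < 6)%N -> `|c i| <= K) -> `|q2x c x y| <= 4 * K /\ `|q2y c x y| <= 4 * K.
Proof.
move=> hx hy hc.
have mulle (s t k : R) : `|s| <= k -> `|t| <= 1 -> `|s * t| <= k.
  by move=> hs ht; rewrite normrM -[k]mulr1; exact: ler_pM.
have := (hc 1%N isT, hc 2%N isT) => -[c1 c2].
have := (mulle _ _ _ (hc 3%N isT) hx, mulle _ _ _ (hc 4%N isT) hx, mulle _ _ _ (hc 4%N isT) hy,
  mulle _ _ _ (hc 5%N isT) hy) => -[[[]]].
rewrite /q2x /q2y; move: c1 c2; rewrite !ler_norml.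
move=> /andP[? ?] /andP[? ?] /andP[? ?] /andP[? ?] /andP[? ?] /andP[? ?].
by split; apply/andP; split; lra.
Qed.

Lemma near_box X Y rho x y : `|x - X| < rho -> `|y - Y| < rho ->
  \forall z \near mkpt x y, box X Y rho ((z : 'cV[R]_2) ord0 ord0) (z ord_max ord0).
Proof.
move=> hx hy.
have c0 := @coord_continuous R 2 1 ord0 ord0 (mkpt x y).
have c1 := @coord_continuous R 2 1 ord_max ord0 (mkpt x y).
have n0 : \forall t \near (x : R), `|t - X| <= rho.
  have : (fun t => `|t - X|) @ x --> `|x - X| by apply: cvg_norm; apply: cvgB; [exact: cvg_id|exact: cvg_cst].
  by move/cvgr_le; apply.
have n1 : \forall t \near (y : R), `|t - Y| <= rho.
  have : (fun t => `|t - Y|) @ y --> `|y - Y| by apply: cvg_norm; apply: cvgB; [exact: cvg_id|exact: cvg_cst].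
  by move/cvgr_le; apply.
rewrite -(mkpt0 x y) in n0; rewrite -(mkpt1 x y) in n1.
by near=> z; split; near: z; [exact: (c0 [set t | `|t - X| <= rho] n0)|exact: (c1 [set t | `|t - Y| <= rho] n1)].
Unshelve. all: by end_near. Qed.

Section Patch.
Variables (K c1 h rho X Y : R) (a b p q : nat -> R) (S : set 'cV[R]_2).
Variables (phi v : 'cV[R]_2 -> 'cV[R]_2) (k : 'cV[R]_2).
Hypotheses (K0 : 0 < K) (c10 : 0 < c1) (rho0 : 0 < rho).
Hypothesis P : patch K c1 h rho X Y a b p q S phi v k.

Definition comp2 (i : 'I_2) := if i == ord0 then a else b.

(** The formula for [v] becomes a differentiable function near the image point after composition
    with [phi]. The entries of DF being at most 4 K h, the chain rule bounds h^-1 times the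
    derivative of the Piola quotient by 2 (4 K h) |Dv|. *)
Lemma patch_grad i x y : `|x - X| < 2 * rho -> `|y - Y| < 2 * rho ->
  S° (mkpt (h * q2 a x y) (h * q2 b x y)) ->
  let G := enorm (Dmx v (mkpt (h * q2 a x y) (h * q2 b x y))) in
  `|piolax a b (comp2 i) p q x y| <= 8 * K * h ^+ 2 * G /\
  `|piolay a b (comp2 i) p q x y| <= 8 * K * h ^+ 2 * G.
Proof.
move=> hx hy Sxy G.
have h0 := patch_h P.
have bxy : box X Y (2 * rho) x y by split; exact: ltW.
have [x1 y1] := patch_unit P bxy.
have J0 x' y' : box X Y (2 * rho) x' y' -> jac a b x' y' != 0.
  by move=> /(patch_jac P) hj; rewrite gt_eqF // (lt_le_trans c10).
pose f1 := plane (fun x y => h * q2 a x y); pose f2 := plane (fun x y => h * q2 b x y).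
have zE : mkpt (f1 (mkpt x y)) (f2 (mkpt x y)) = mkpt (h * q2 a x y) (h * q2 b x y).
  by rewrite /f1 /f2 /plane mkpt0 mkpt1.
pose g (z : 'cV[R]_2) := k i ord0 + h^-1 * plane (piola a b (comp2 i) p q) (phi z).
pose W := plane (fun x y => k i ord0 + h^-1 * piola a b (comp2 i) p q x y).
have [dphi _] := patch_inv P Sxy.
have phiE := patch_left P bxy.
have mE x' y' : (mkpt (piola a b a p q x' y') (piola a b b p q x' y')) i ord0 = piola a b (comp2 i) p q x' y'.
  by rewrite mxE /comp2; case: ifP.
have df1 : differentiable f1 (mkpt x y).
  by apply: differentiableM; [exact: differentiable_cst|exact: differentiable_q2].
have df2 : differentiable f2 (mkpt x y).
  by apply: differentiableM; [exact: differentiable_cst|exact: differentiable_q2].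
have dg : differentiable g (mkpt (f1 (mkpt x y)) (f2 (mkpt x y))).
  rewrite zE; apply: differentiableD; first exact: differentiable_cst.
  apply: differentiableM; first exact: differentiable_cst.
  apply: differentiable_comp => //; rewrite phiE; apply: differentiable_piola.
  by rewrite /plane mkpt0 mkpt1 J0.
have vg : \forall z \near mkpt (f1 (mkpt x y)) (f2 (mkpt x y)), v z i ord0 = g z.
  rewrite zE; have nS : \forall z \near mkpt (h * q2 a x y) (h * q2 b x y), S° z.
    by apply: open_nbhs_nbhs; split => //; exact: open_interior.
  have nb : \forall z \near mkpt (h * q2 a x y) (h * q2 b x y),
      box X Y (2 * rho) (phi z ord0 ord0) (phi z ord_max ord0).
    have cphi : phi @ mkpt (h * q2 a x y) (h * q2 b x y) --> phi (mkpt (h * q2 a x y) (h * q2 b x y)).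
      exact: differentiable_continuous.
    rewrite phiE in cphi.
    exact: (cphi [set z : 'cV[R]_2 | box X Y (2 * rho) (z ord0 ord0) (z ord_max ord0)] (near_box hx hy)).
  near=> z.
  have Sz : S° z by near: z.
  have bz : box X Y (2 * rho) (phi z ord0 ord0) (phi z ord_max ord0) by near: z.
  have [_ zz] := patch_inv P Sz.
  rewrite -[in LHS]zz /plane (patch_val P bz) mxE [X in _ + X]mxE mE //.
have gW : \forall t \near mkpt x y, g (mkpt (f1 t) (f2 t)) = W t.
  near=> t.
  have bt : box X Y (2 * rho) (t ord0 ord0) (t ord_max ord0) by near: t; exact: near_box.
  by rewrite /g /f1 /f2 /plane (patch_left P bt) mkpt0 mkpt1.
have hb (c : nat -> R) : (forall i, (0 < i < 6)%N -> `|c i| <= K) ->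
    `|h * q2x c x y| <= h * (4 * K) /\ `|h * q2y c x y| <= h * (4 * K).
  move=> /(q2xy_bound x1 y1) [Hx Hy].
  by rewrite !normrM (gtr0_norm h0) !ler_pM2l.
have [ax ay] := hb a (fun i hi => proj1 (patch_coef P hi)).
have [bx by_] := hb b (fun i hi => proj2 (patch_coef P hi)).
have Dx (c : nat -> R) : 'D_(evec ord0) (plane (fun x y => h * q2 c x y)) (mkpt x y) = h * q2x c x y.
  rewrite derive_planex /plane; under eq_fun do rewrite mkpt0 mkpt1.
  by have [_ ->] := is_derive_scal h (is_derive_q2x c x y).
have Dy (c : nat -> R) : 'D_(evec ord_max) (plane (fun x y => h * q2 c x y)) (mkpt x y) = h * q2y c x y.
  rewrite derive_planey /plane; under eq_fun do rewrite mkpt0 mkpt1.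
  by have [_ ->] := is_derive_scal h (is_derive_q2y c x y).
have Wx : 'D_(evec ord0) W (mkpt x y) = h^-1 * piolax a b (comp2 i) p q x y.
  rewrite derive_planex /W /plane; under eq_fun do rewrite mkpt0 mkpt1.
  by have [_ ->] := is_derive_addl (k i ord0) (is_derive_scal h^-1 (is_derive_piolax (comp2 i) p q (J0 _ _ bxy))).
have Wy : 'D_(evec ord_max) W (mkpt x y) = h^-1 * piolay a b (comp2 i) p q x y.
  rewrite derive_planey /W /plane; under eq_fun do rewrite mkpt0 mkpt1.
  by have [_ ->] := is_derive_addl (k i ord0) (is_derive_scal h^-1 (is_derive_piolay (comp2 i) p q (J0 _ _ bxy))).
have hfin t : `|h^-1 * t| <= 2 * (h * (4 * K)) * G -> `|t| <= 8 * K * h ^+ 2 * G.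
  rewrite normrM gtr0_norm ?invr_gt0 // -(ler_pM2l h0) mulrA divff ?gt_eqF // mul1r.
  by move/le_trans; apply; rewrite le_eqVlt; apply/orP; left; apply/eqP; ring.
split; apply: hfin.
- rewrite -Wx /G -zE; apply: (derive_le_Dmx df1 df2 dg vg gW); by rewrite Dx.
- rewrite -Wy /G -zE; apply: (derive_le_Dmx df1 df2 dg vg gW); by rewrite Dy.
Unshelve. all: by end_near. Qed.

End Patch.
End PiolaPoincare.

(** * The pointwise Poincare inequality *)

Section PoincareInequality.
Context {R : realType}.
Implicit Types (a b c p q : nat -> R) (x y : R).

Lemma patch_lower (K c1 h rho X Y : R) a b p q S phi v k (f : R -> R -> R) (L r N x1 y1 : R) :
  0 < K -> 0 < c1 -> 0 < rho -> patch K c1 h rho X Y a b p q S phi v k ->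
  lipb (box X Y (2 * rho)) L f ->
  (forall x y, `|x - X| < 2 * rho -> `|y - Y| < 2 * rho ->
     S° (mkpt (h * q2 a x y) (h * q2 b x y)) ->
     `|f x y| <= 8 * K * h ^+ 2 * enorm (Dmx v (mkpt (h * q2 a x y) (h * q2 b x y)))) ->
  (L2norm S° (fun z => enorm (Dmx v z)) <= N%:E)%E ->
  box X Y rho x1 y1 -> 0 < r <= rho / 2 ->
  `|f x1 y1| <= 16 * 32 * K ^+ 2 / c1 * (h * N / r) + 4 * L * r.
Proof.
move=> K0 c10 rho0 P [L0 fb fl] fG hN [bx by_] /andP[r0 rr].
have h0 := patch_h P.
set g := `|f x1 y1|.
have N0 : 0 <= N by rewrite -lee_fin; apply: le_trans hN; exact: Lnorm_ge0.
(* In the first case the Lipschitz term alone suffices. In the second, [f] varies by at most 2 L r <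
   g / 2 on the box of radius [r], so it stays above g / 2 there. *)
have [gL|gL] := leP g (4 * L * r).
  apply: (le_trans gL); rewrite lerDr; apply: mulr_ge0.
    by apply: divr_ge0; [apply: mulr_ge0; [apply: mulr_ge0; exact: ler0n|exact: sqr_ge0]|exact: ltW].
  by apply: divr_ge0; [apply: mulr_ge0 => //; exact: ltW|exact: ltW].
have b1 x y : box x1 y1 r x y -> [/\ `|x - X| < 2 * rho, `|y - Y| < 2 * rho &
    box X Y (2 * rho) x y].
  move=> [ux uy].
  have hx : `|x - X| < 2 * rho by apply: le_lt_trans (ler_distD x1 _ _) _; lra.
  have hy : `|y - Y| < 2 * rho by apply: le_lt_trans (ler_distD y1 _ _) _; lra.
  by split => //; split; exact: ltW.
(* [s / h] is the radius granted by [quad_surj] when the derivatives are bounded by [4 K]; each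
   coordinate takes half of it, which makes a square of side [s]. *)
pose s := h * (c1 * r / (8 * (4 * K))).
have s0 : 0 < s by rewrite !mulr_gt0 // invr_gt0 !mulr_gt0.
have K4 : 0 < 4 * K by rewrite mulr_gt0.
have nd : nondeg (4 * K) c1 a b (box x1 y1 r).
  move=> x y /b1 [_ _ bxy]; have [ux uy] := patch_unit P bxy.
  have [? ?] := q2xy_bound ux uy (fun i hi => proj1 (patch_coef P hi)).
  have [? ?] := q2xy_bound ux uy (fun i hi => proj2 (patch_coef P hi)).
  by split => //; exact: (patch_jac P bxy).
pose a1 := h * q2 a x1 y1 - s / 2; pose a2 := h * q2 b x1 y1 - s / 2.
have sq z1 z2 : a1 < z1 < a1 + s -> a2 < z2 < a2 + s -> exists x y,
   [/\ box x1 y1 r x y, mkpt z1 z2 = mkpt (h * q2 a x y) (h * q2 b x y) & S (mkpt z1 z2)].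
  move=> /andP[u1 u2] /andP[w1 w2].
  have d1 : `|z1 / h - q2 a x1 y1| < s / 2 / h.
    have -> : z1 / h - q2 a x1 y1 = (z1 - h * q2 a x1 y1) / h by field; rewrite gt_eqF.
    rewrite normrM normfV (gtr0_norm h0) ltr_pM2r ?invr_gt0 // ltr_norml.
    by move: u1 u2; rewrite /a1 => ? ?; apply/andP; split; lra.
  have d2 : `|z2 / h - q2 b x1 y1| < s / 2 / h.
    have -> : z2 / h - q2 b x1 y1 = (z2 - h * q2 b x1 y1) / h by field; rewrite gt_eqF.
    rewrite normrM normfV (gtr0_norm h0) ltr_pM2r ?invr_gt0 // ltr_norml.
    by move: w1 w2; rewrite /a2 => ? ?; apply/andP; split; lra.
  have sh : s / 2 / h + s / 2 / h = c1 * r / (8 * (4 * K)).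
    by rewrite /s; field; rewrite !gt_eqF.
  have [x [y [bxy e1 e2]]] := quad_surj K4 c10 r0 nd
    (eq_ind _ (fun t => _ < t) (ltrD d1 d2) _ sh).
  have E : mkpt z1 z2 = mkpt (h * q2 a x y) (h * q2 b x y).
    by rewrite e1 e2 !(mulrC h) !mulfVK ?gt_eqF.
  exists x, y; split => //; rewrite E; apply: (patch_img P).
  by have [] := b1 _ _ bxy.
have key : ((g / 2 / (8 * K * h ^+ 2) * s)%:E <= L2norm S° (fun z => enorm (Dmx v z)))%E.
  have H0 : 0 < 8 * K * h ^+ 2 by rewrite !mulr_gt0 // exprn_gt0.
  apply: (L2norm_ge_square (a1 := a1) (a2 := a2)); [|exact: ltW|].
    by apply: divr_ge0; [apply: divr_ge0 => //; exact: normr_ge0|exact: ltW].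
  move=> z1 z2 u w; have [x [y [bxy E _]]] := sq _ _ u w.
  have [hx hy bx'] := b1 _ _ bxy.
  have So : S° (mkpt z1 z2).
    have ha : `|z1 - (a1 + s / 2)| < s / 2.
      by case/andP: u => ? ?; rewrite ltr_norml; apply/andP; split; lra.
    have hb : `|z2 - (a2 + s / 2)| < s / 2.
      by case/andP: w => ? ?; rewrite ltr_norml; apply/andP; split; lra.
    (* The square is open: [e] lies strictly between the max-distance to its centre and half its
       side, so a whole neighbourhood of the point stays in it. *)
    pose d := Num.max `|z1 - (a1 + s / 2)| `|z2 - (a2 + s / 2)|.
    have ds : d < s / 2 by rewrite gt_max ha hb.
    pose e := (d + s / 2) / 2.
    have ha' : `|z1 - (a1 + s / 2)| < e.
      by apply: (@le_lt_trans _ _ d); [rewrite le_max lexx|rewrite /e; lra].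
    have hb' : `|z2 - (a2 + s / 2)| < e.
      by apply: (@le_lt_trans _ _ d); [rewrite le_max lexx orbT|rewrite /e; lra].
    have := near_box ha' hb'; apply: filterS => z [z1' z2'].
    have es : e < s / 2 by rewrite /e; lra.
    have hz (t w' : R) : `|t - (w' + s / 2)| <= e -> e < s / 2 -> w' < t < w' + s.
      by rewrite ler_norml => /andP[? ?] ?; apply/andP; split; lra.
    have [x' [y' [_ _]]] := sq _ _ (hz _ _ z1' es) (hz _ _ z2' es).
    by rewrite mkptE.
  split => //; rewrite ger0_norm ?sqrtr_ge0 //.
  have Gx := fG x y hx hy; rewrite -E in Gx; have {}Gx := Gx So.
  rewrite ler_pdivrMr // [leRHS]mulrC; apply: le_trans Gx.
  have c0 : box x1 y1 r x1 y1 by split; rewrite subrr normr0 ltW.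
  have [_ _ c0'] := b1 _ _ c0.
  have l1 : `|f x1 y1 - f x y| <= L * (2 * r).
    apply: le_trans (fl _ _ _ _ c0' bx') _; apply: ler_wpM2l => //.
    by case: bxy; rewrite (distrC x1) (distrC y1); lra.
  have l2 : g <= `|f x1 y1 - f x y| + `|f x y|.
    by rewrite /g -{1}(subrK (f x y) (f x1 y1)) ler_normD.
  lra.
have := le_trans key hN; rewrite lee_fin.
have -> : g / 2 / (8 * K * h ^+ 2) * s = g * (c1 * r / (16 * 32 * K ^+ 2 * h)).
  by rewrite /s; field; rewrite !gt_eqF.
rewrite -ler_pdivlMr; last by rewrite divr_gt0 ?mulr_gt0 ?exprn_gt0.
have -> : N / (c1 * r / (16 * 32 * K ^+ 2 * h)) = 16 * 32 * K ^+ 2 / c1 * (h * N / r).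
  by field; rewrite !gt_eqF.
move/le_trans; apply; rewrite lerDl; apply: mulr_ge0; last exact: ltW.
by apply: mulr_ge0.
Qed.

(** The Piola transform is inverted by the adjugate of DF, whose entries are at most [4 K]. *)
Lemma piola_inv_bound (K G : R) a b p q x y : `|x| <= 1 -> `|y| <= 1 -> jac a b x y != 0 ->
  (forall i, (0 < i < 6)%N -> `|a i| <= K /\ `|b i| <= K) ->
  `|piola a b a p q x y| <= G -> `|piola a b b p q x y| <= G ->
  `|q2 p x y| <= 8 * K * G /\ `|q2 q x y| <= 8 * K * G.
Proof.
move=> hx hy J hab Ga Gb.
have [ax ay] := q2xy_bound hx hy (fun i hi => proj1 (hab i hi)).
have [bx by_] := q2xy_bound hx hy (fun i hi => proj2 (hab i hi)).
have E1 : q2 p x y = q2y b x y * piola a b a p q x y - q2y a x y * piola a b b p q x y.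
  by move: J; rewrite /piola /pnum /jac => J; field.
have E2 : q2 q x y = q2x a x y * piola a b b p q x y - q2x b x y * piola a b a p q x y.
  by move: J; rewrite /piola /pnum /jac => J; field.
have -> : 8 * K * G = 4 * K * G + 4 * K * G by ring.
by rewrite E1 E2; split; apply: (le_trans (ler_normB _ _)); rewrite !normrM; apply: lerD; apply: ler_pM => //;
  rewrite -normrM.
Qed.

End PoincareInequality.

Section PoincareInequality2.
Context {R : realType}.
Implicit Types (a b c p q : nat -> R) (x y : R).

Lemma piola_poincare (K c1 rho : R) : 0 < K -> 0 < c1 -> 0 < rho <= 1 -> exists2 C, 0 < C &
  forall h X Y a b p q S phi v k N, `|X| <= 1 -> `|Y| <= 1 ->
    patch K c1 h rho X Y a b p q S phi v k -> q2 p X Y = 0 -> q2 q X Y = 0 ->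
    (L2norm S° (fun z => enorm (Dmx v z)) <= N%:E)%E ->
    forall i, (i < 6)%N -> `|p i| <= C * (h * N) /\ `|q i| <= C * (h * N).
Proof.
move=> K0 c10 /andP[rho0 rho1].
have [L L0 hL] := lipb_piola_le (ltW K0) c10.
pose A : R := 16 * 32 * K ^+ 2 / c1.
have A0 : 0 < A by rewrite divr_gt0 // !mulr_gt0 // exprn_gt0.
(* [B] converts a gradient bound into a bound on the sum of all coefficients: 2 from integrating the
   gradient away from the centre, 8 K from inverting the Piola transform, 27 / rho^2 from
   [q2_coef_bound], and 12 coefficients. *)
pose B : R := 12 * (27 / rho ^+ 2 * (8 * K * 2)).
have B0 : 0 < B by rewrite !mulr_gt0 // invr_gt0 exprn_gt0.
(* The second entry makes the Lipschitz contribution [B * (4 * (L * M) * r)] at most [M / 2]. *)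
pose r := Num.min (rho / 2) (8 * L * B)^-1.
have LB : 0 < 8 * L * B by apply: mulr_gt0 => //; apply: mulr_gt0.
have r0 : 0 < r by rewrite lt_min divr_gt0 //= invr_gt0.
have rr : 0 < r <= rho / 2 by rewrite r0 ge_min lexx.
exists (2 * (B * A / r)); first by apply: mulr_gt0 => //; apply: divr_gt0 => //; exact: mulr_gt0.
move=> h X Y a b p q S phi v k N X1 Y1 P pX qX hN.
(* [M] is the quantity to be bounded and also enters the Lipschitz constant of the gradient; half of
   it is absorbed at the end. *)
pose M := \sum_(i < 6) (`|p i| + `|q i|).
have pM i : (i < 6)%N -> `|p i| <= M /\ `|q i| <= M.
  move=> hi; rewrite /M (bigD1 (Ordinal hi)) //=.
  have S0 : 0 <= \sum_(j < 6 | j != Ordinal hi) (`|p j| + `|q j|).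
    by apply: sumr_ge0 => *; rewrite addr_ge0.
  by have := normr_ge0 (p i); have := normr_ge0 (q i) => ? ?; split; lra.
have M0 : 0 <= M by apply: sumr_ge0 => *; rewrite addr_ge0.
pose G := A * (h * N / r) + 4 * (L * M) * r.
have N0 : 0 <= N by rewrite -lee_fin; apply: le_trans hN; exact: Lnorm_ge0.
have h0 := patch_h P.
have G0 : 0 <= G.
  apply: addr_ge0; apply: mulr_ge0; try exact: ltW.
    by apply: divr_ge0; [apply: mulr_ge0 => //; exact: ltW|exact: ltW].
  by apply: mulr_ge0 => //; apply: mulr_ge0 => //; exact: ltW.
have inb x y : box X Y rho x y -> box X Y (2 * rho) x y by case=> ? ?; split; lra.
have J0 x y : box X Y rho x y -> jac a b x y != 0.
  by move=> /inb /(patch_jac P) hj; rewrite gt_eqF // (lt_le_trans c10).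
have gb (i : 'I_2) x y : box X Y rho x y -> `|piolax a b (comp2 a b i) p q x y| <= G /\
    `|piolay a b (comp2 a b i) p q x y| <= G.
  move=> bxy.
  have hK j : (0 < j < 6)%N -> [/\ `|a j| <= K, `|b j| <= K & `|comp2 a b i j| <= K].
    by move=> /(patch_coef P)[? ?]; split => //; rewrite /comp2; case: ifP.
  have [lx ly] := hL _ _ _ _ p q M (patch_unit P) (patch_jac P) hK M0 pM.
  split.
    apply: (patch_lower K0 c10 rho0 P lx _ hN bxy rr) => x' y' hx hy Sx.
    by have [] := patch_grad c10 P i hx hy Sx.
  apply: (patch_lower K0 c10 rho0 P ly _ hN bxy rr) => x' y' hx hy Sx.
  by have [] := patch_grad c10 P i hx hy Sx.
have b0 : box X Y rho X Y by split; rewrite subrr normr0 ltW.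
have wb (i : 'I_2) x y : box X Y rho x y -> `|piola a b (comp2 a b i) p q x y| <= 2 * G.
  move=> bxy.
  have W0 : piola a b (comp2 a b i) p q X Y = 0 by rewrite /piola /pnum pX qX !mulr0 addr0 mul0r.
  have H x' y' (b' : box X Y rho x' y') := And4 (is_derive_piolax (comp2 a b i) p q (J0 _ _ b'))
    (is_derive_piolay (comp2 a b i) p q (J0 _ _ b')) (proj1 (gb i _ _ b')) (proj2 (gb i _ _ b')).
  have := box_mvt H bxy b0; rewrite W0 subr0 => /le_trans; apply.
  by rewrite mulrC; apply: ler_wpM2r; [exact: G0|case: bxy => ? ?; lra].
have pqb x y : box X Y rho x y -> `|q2 p x y| <= 8 * K * (2 * G) /\ `|q2 q x y| <= 8 * K * (2 * G).
  move=> bxy; have [x1 y1] := patch_unit P (inb _ _ bxy).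
  by apply: (piola_inv_bound x1 y1 (J0 _ _ bxy) (patch_coef P)); [exact: (wb ord0)|exact: (wb ord_max)].
have rho01 : 0 < rho <= 1 by rewrite rho0.
have cp := q2_coef_bound rho01 X1 Y1 (fun x y bxy => proj1 (pqb x y bxy)).
have cq := q2_coef_bound rho01 X1 Y1 (fun x y bxy => proj2 (pqb x y bxy)).
have MB : M <= B * G.
  have -> : B * G = \sum_(i < 6) (27 / rho ^+ 2 * (8 * K * (2 * G)) + 27 / rho ^+ 2 * (8 * K * (2 * G))).
    by rewrite sumr_const card_ord /B -mulr_natl; ring.
  by apply: ler_sum => i _; rewrite lerD ?cp ?cq.
have rLB : 8 * L * B * r <= 1.
  rewrite mulrC -ler_pdivlMr // mul1r /r ge_min lexx orbT //.
have M2 : B * (4 * (L * M) * r) <= M / 2.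
  rewrite (_ : B * _ = (8 * L * B * r) * (M / 2)); last by field.
  by rewrite ler_piMl // divr_ge0.
have M3 : M <= 2 * (B * A / r) * (h * N).
  move: MB; rewrite /G mulrDr (_ : 2 * (B * A / r) * (h * N) = 2 * (B * (A * (h * N / r)))); last by ring.
  lra.
by move=> i hi; have [? ?] := pM i hi; split; apply: le_trans M3.
Qed.

End PoincareInequality2.

(** * Cubic approximation of a Piola quotient along a segment *)

Section CubicApproximation.
Context {R : realType}.
Implicit Types (a b c p q : nat -> R) (x y : R).

Definition cub (e : nat -> R) (t : R) : R := e 0%N + e 1%N * t + e 2%N * t ^+ 2 + e 3%N * t ^+ 3.

(* First-order expansion of 1/j in the small coefficient j1: the discarded terms
   are of second order. *)
Lemma quot_cubic (c1 k h h0 P m l j0 j1 j2 t : R) : 0 < c1 -> 0 <= h <= h0 -> 0 <= t <= 1 ->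
  `|m| <= P -> `|l| <= h * P -> `|j0| <= k -> `|j1| <= k * h -> `|j2| <= k * h ^+ 2 ->
  c1 <= j0 -> c1 <= j0 + t * j1 + t ^+ 2 * j2 ->
  `|(m + t * l) / (j0 + t * j1 + t ^+ 2 * j2) - (m / j0 + t * (l / j0) - t * (j1 / j0 ^+ 2 * m))|
   <= (k * k * (2 + h0) / c1 ^+ 3 + k * (1 + h0) / c1 ^+ 2) * (h ^+ 2 * P).
Proof.
move=> c10 /andP[h_0 hh0] /andP[t0 t1] hm hl hj0 hj1 hj2 cj0 cj.
set j := j0 + t * j1 + t ^+ 2 * j2 in cj *.
have P0 : 0 <= P by exact: le_trans hm.
have k0 : 0 <= k by exact: le_trans hj0.
have J0 : 0 < j0 by exact: lt_le_trans cj0.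
have J : 0 < j by exact: lt_le_trans cj.
have inv (u : R) : c1 <= u -> `|u^-1| <= c1^-1.
  move=> cu; have u0 : 0 < u by exact: lt_le_trans cu.
  by rewrite gtr0_norm ?invr_gt0 // lef_pV2.
have E1 : j0^-1 - j^-1 = (t * j1 + t ^+ 2 * j2) * (j^-1 * j0^-1).
  by rewrite /j in J *; field; rewrite !gt_eqF.
have E2 : j^-1 - j0^-1 + t * (j1 / j0 ^+ 2) =
    (t * j1 * (t * j1 + t ^+ 2 * j2) - t ^+ 2 * j2 * j0) * (j^-1 * (j0^-1 * j0^-1)).
  by rewrite /j in J *; field; rewrite !gt_eqF.
(* [l] already carries a factor [h], so for it the zeroth-order expansion of 1/j is enough; only [m]
   requires the first-order one. *)
have -> : (m + t * l) / j - (m / j0 + t * (l / j0) - t * (j1 / j0 ^+ 2 * m)) =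
   m * (j^-1 - j0^-1 + t * (j1 / j0 ^+ 2)) - t * l * (j0^-1 - j^-1) by ring.
have tb (s : R) (e : R) : `|s| <= e -> `|t * s| <= e.
  by move=> hs; rewrite normrM (ger0_norm t0) -[e]mul1r; apply: ler_pM.
have tb2 (s : R) (e : R) : `|s| <= e -> `|t ^+ 2 * s| <= e.
  by move=> hs; rewrite expr2 -mulrA; apply: (tb _ _ (tb _ _ hs)).
have kh0 : 0 <= k * h by exact: mulr_ge0.
have B1 : `|t * j1 + t ^+ 2 * j2| <= k * (1 + h0) * h.
  apply: (le_trans (ler_normD _ _)); apply: (le_trans (lerD (tb _ _ hj1) (tb2 _ _ hj2))).
  have : k * h * h <= k * h * h0 by exact: ler_wpM2l.
  rewrite expr2; lra.
have I1 := inv _ cj; have I0 := inv _ cj0.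
have ci : 0 <= c1^-1 by rewrite invr_ge0 ltW.
have A1 : `|t * l * (j0^-1 - j^-1)| <= k * (1 + h0) / c1 ^+ 2 * (h ^+ 2 * P).
  rewrite E1 normrM.
  have -> : k * (1 + h0) / c1 ^+ 2 * (h ^+ 2 * P) =
     h * P * (k * (1 + h0) * h * (c1^-1 * c1^-1)) by field; rewrite gt_eqF.
  apply: ler_pM => //; first exact: (tb _ _ hl).
  by rewrite !normrM -[`|t * j1 + _|]/(`|t * j1 + t ^+ 2 * j2|); apply: ler_pM => //; apply: ler_pM.
have A2 : `|m * (j^-1 - j0^-1 + t * (j1 / j0 ^+ 2))| <= k * k * (2 + h0) / c1 ^+ 3 * (h ^+ 2 * P).
  rewrite E2 normrM.
  have -> : k * k * (2 + h0) / c1 ^+ 3 * (h ^+ 2 * P) =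
     P * (k * k * (2 + h0) * h ^+ 2 * (c1^-1 * (c1^-1 * c1^-1))) by field; rewrite gt_eqF.
  apply: ler_pM => //.
  rewrite (normrM _ (j^-1 * _)); apply: ler_pM => //; last first.
    by rewrite !normrM; apply: ler_pM => //; apply: ler_pM.
  apply: (le_trans (ler_normB _ _)).
  have -> : k * k * (2 + h0) * h ^+ 2 = k * h * (k * (1 + h0) * h) + k * h ^+ 2 * k by ring.
  apply: lerD; rewrite normrM; apply: ler_pM => //; first exact: (tb _ _ hj1).
  exact: (tb2 _ _ hj2).
by apply: (le_trans (ler_normB _ _)); rewrite mulrDl; exact: lerD.
Qed.

(** Along a segment DF is affine in t with slope O(h), because the second-order coefficients are
    O(h). The numerator is therefore M + t L with M, L quadratic in t and L = O(h), and the
    first-order expansion of [quot_cubic] is a polynomial of degree three. *)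
Lemma piola_cubic (K c1 h0 : R) : 0 < K -> 0 < c1 -> 0 < h0 -> exists2 C, 0 < C &
  forall h P a b c p q (x0 y0 d1 d2 : R), 0 < h <= h0 ->
    (forall i, (0 < i < 6)%N -> [/\ `|a i| <= K, `|b i| <= K & `|c i| <= K]) ->
    (forall i, (2 < i < 6)%N -> [/\ `|a i| <= K * h, `|b i| <= K * h & `|c i| <= K * h]) ->
    (forall i, (i < 6)%N -> `|p i| <= P /\ `|q i| <= P) ->
    `|x0| <= 1 -> `|y0| <= 1 -> `|d1| <= 1 -> `|d2| <= 1 ->
    (forall t, 0 <= t <= 1 -> [/\ `|x0 + t * d1| <= 1, `|y0 + t * d2| <= 1 &
        c1 <= jac a b (x0 + t * d1) (y0 + t * d2)]) ->
    exists e, forall t, 0 <= t <= 1 ->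
      `|piola a b c p q (x0 + t * d1) (y0 + t * d2) - cub e t| <= C * (h ^+ 2 * P).
Proof.
move=> K0 c10 h00.
(* The entries of DF are at most 4 K and their slopes at most 4 K h; the linear coefficient of the
   Jacobian consists of four products of one of each. *)
pose k : R := 64 * (K * K).
have k0 : 0 < k by apply: mulr_gt0 => //; exact: mulr_gt0.
pose C0 : R := k * k * (2 + h0) / c1 ^+ 3 + k * (1 + h0) / c1 ^+ 2.
have C00 : 0 < C0.
  have h1 : 0 < 2 + h0 by lra.
  have h2 : 0 < 1 + h0 by lra.
  apply: addr_gt0; apply: divr_gt0; rewrite ?exprn_gt0 //; apply: mulr_gt0 => //.
  exact: mulr_gt0.
(* [48 K P] bounds the numerator: two products of an entry at most 4 K and a quadratic at most 6
   P. *)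
exists (C0 * (48 * K)); first by apply: mulr_gt0 => //; exact: mulr_gt0.
move=> h P a b c p q x0 y0 d1 d2 /andP[hpos hh0] hK hKh hP X0 Y0 D1 D2 ht.
pose s (f : nat -> R) := 2 * f 3%N * d1 + f 4%N * d2.
pose w (f : nat -> R) := f 4%N * d1 + 2 * f 5%N * d2.
have qxE f t : q2x f (x0 + t * d1) (y0 + t * d2) = q2x f x0 y0 + t * s f.
  by rewrite /q2x /s; ring.
have qyE f t : q2y f (x0 + t * d1) (y0 + t * d2) = q2y f x0 y0 + t * w f.
  by rewrite /q2y /w; ring.
have mulle (u v' k' : R) : `|u| <= k' -> `|v'| <= 1 -> `|u * v'| <= k'.
  by move=> hs ht'; rewrite normrM -[k']mulr1; exact: ler_pM.
have sb f : (forall i, (2 < i < 6)%N -> `|f i| <= K * h) -> `|s f| <= 4 * K * h /\ `|w f| <= 4 * K * h.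
  move=> hf; have := (mulle _ _ _ (hf 3%N isT) D1, mulle _ _ _ (hf 4%N isT) D2, mulle _ _ _ (hf 4%N isT) D1,
     mulle _ _ _ (hf 5%N isT) D2) => -[[[]]].
  have Kh0 : 0 <= K * h by apply: mulr_ge0; exact: ltW.
  rewrite /s /w; move: Kh0; clear; rewrite !ler_norml => ? /andP[? ?] /andP[? ?] /andP[? ?] /andP[? ?].
  by split; apply/andP; split; lra.
have [sa wa] := sb a (fun i hi => let: And3 u _ _ := hKh i hi in u).
have [sbb wb] := sb b (fun i hi => let: And3 _ u _ := hKh i hi in u).
have [sc wc] := sb c (fun i hi => let: And3 _ _ u := hKh i hi in u).
have [ax ay] := q2xy_bound X0 Y0 (fun i hi => let: And3 u _ _ := hK i hi in u).
have [bx by_] := q2xy_bound X0 Y0 (fun i hi => let: And3 _ u _ := hK i hi in u).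
have [cx cy] := q2xy_bound X0 Y0 (fun i hi => let: And3 _ _ u := hK i hi in u).
have pb f x y : (forall i, (i < 6)%N -> `|f i| <= P) -> `|x| <= 1 -> `|y| <= 1 -> `|q2 f x y| <= 6 * P.
  move=> hf hx hy.
  have -> : q2 f x y = f 0%N + f 1%N * x + f 2%N * y + f 3%N * x * x + f 4%N * x * y + f 5%N * y * y.
    by rewrite /q2; ring.
  have := (hf 0%N isT, mulle _ _ _ (hf 1%N isT) hx, mulle _ _ _ (hf 2%N isT) hy,
    mulle _ _ _ (mulle _ _ _ (hf 3%N isT) hx) hx, mulle _ _ _ (mulle _ _ _ (hf 4%N isT) hx) hy,
    mulle _ _ _ (mulle _ _ _ (hf 5%N isT) hy) hy) => -[[[[[]]]]] H0 H1 H2 H3 H4 H5.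
  have -> : 6 * P = P + P + P + P + P + P by ring.
  by do 5 (apply: le_trans (ler_normD _ _) _; apply: lerD => //).
have P0 : 0 <= P by exact: le_trans (normr_ge0 _) (proj1 (hP 0%N isT)).
pose cf (f : nat -> R) (i : nat) : R := nth 0 [:: q2 f x0 y0; q2x f x0 y0 * d1 + q2y f x0 y0 * d2;
   f 3%N * d1 ^+ 2 + f 4%N * (d1 * d2) + f 5%N * d2 ^+ 2] i.
have cfE f t : q2 f (x0 + t * d1) (y0 + t * d2) = cf f 0%N + cf f 1%N * t + cf f 2%N * t ^+ 2.
  by rewrite q2_taylor /cf /=; ring.
pose m i := q2x c x0 y0 * cf p i + q2y c x0 y0 * cf q i.
pose l i := s c * cf p i + w c * cf q i.
pose j0 := jac a b x0 y0.
pose j1 := q2x a x0 y0 * w b + s a * q2y b x0 y0 - (q2y a x0 y0 * s b + w a * q2x b x0 y0).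
pose j2 := s a * w b - w a * s b.
have jE t : jac a b (x0 + t * d1) (y0 + t * d2) = j0 + t * j1 + t ^+ 2 * j2.
  by rewrite /j0 /jac !qxE !qyE /j1 /j2; ring.
pose e (i : nat) : R := nth 0 [:: m 0%N / j0; m 1%N / j0 + l 0%N / j0 - j1 / j0 ^+ 2 * m 0%N;
  m 2%N / j0 + l 1%N / j0 - j1 / j0 ^+ 2 * m 1%N; l 2%N / j0 - j1 / j0 ^+ 2 * m 2%N] i.
exists e => t ht01; have [xt yt jt] := ht t ht01.
have t00 : 0 <= (0 : R) <= 1 by rewrite lexx ler01.
have [_ _] := ht 0 t00; rewrite jE mul0r expr0n mul0r !addr0 => cj0.
rewrite jE in jt.
set M := q2x c x0 y0 * q2 p (x0 + t * d1) (y0 + t * d2) + q2y c x0 y0 * q2 q (x0 + t * d1) (y0 + t * d2).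
set L := s c * q2 p (x0 + t * d1) (y0 + t * d2) + w c * q2 q (x0 + t * d1) (y0 + t * d2).
have ML : piola a b c p q (x0 + t * d1) (y0 + t * d2) = (M + t * L) / (j0 + t * j1 + t ^+ 2 * j2).
  by rewrite /piola jE /pnum qxE qyE /M /L; congr (_ / _); ring.
have eE : cub e t = M / j0 + t * (L / j0) - t * (j1 / j0 ^+ 2 * M).
  by rewrite /M /L !cfE /cub /e /= /m /l; ring.
have hp := pb p _ _ (fun i hi => proj1 (hP i hi)) xt yt.
have hq := pb q _ _ (fun i hi => proj2 (hP i hi)) xt yt.
have sum2 (u1 u2 w1 w2 k1 k2 : R) : `|u1| <= k1 -> `|u2| <= k1 -> `|w1| <= k2 -> `|w2| <= k2 ->
    `|u1 * w1 + u2 * w2| <= 2 * (k1 * k2).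
  move=> *; apply: le_trans (ler_normD _ _) _; rewrite !normrM mulr_natl mulr2n.
  by apply: lerD; apply: ler_pM.
have dif2 (u1 u2 w1 w2 k1 k2 : R) : `|u1| <= k1 -> `|u2| <= k1 -> `|w1| <= k2 -> `|w2| <= k2 ->
    `|u1 * w1 - u2 * w2| <= 2 * (k1 * k2).
  by move=> ? ? ? ?; rewrite -mulrN; apply: sum2 => //; rewrite normrN.
have hM : `|M| <= 48 * K * P.
  by apply: le_trans (sum2 _ _ _ _ _ _ cx cy hp hq) _; rewrite le_eqVlt; apply/orP; left; apply/eqP; ring.
have hL : `|L| <= h * (48 * K * P).
  by apply: le_trans (sum2 _ _ _ _ _ _ sc wc hp hq) _; rewrite le_eqVlt; apply/orP; left; apply/eqP; ring.
have KK : 0 <= K * K by apply: mulr_ge0; exact: ltW.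
have hj0 : `|j0| <= k.
  apply: le_trans (dif2 _ _ _ _ _ _ ax ay by_ bx) _; rewrite /k; clear -KK; lra.
have hj1 : `|j1| <= k * h.
  have -> : j1 = (q2x a x0 y0 * w b + q2y b x0 y0 * s a) - (q2y a x0 y0 * s b + q2x b x0 y0 * w a).
    by rewrite /j1; ring.
  apply: le_trans (ler_normB _ _) _.
  apply: le_trans (lerD (sum2 _ _ _ _ _ _ ax by_ wb sa) (sum2 _ _ _ _ _ _ ay bx sbb wa)) _.
  by rewrite le_eqVlt /k; apply/orP; left; apply/eqP; ring.
have hj2 : `|j2| <= k * h ^+ 2.
  apply: le_trans (dif2 _ _ _ _ _ _ sa wa wb sbb) _.
  have : 0 <= K * K * h ^+ 2 by apply: mulr_ge0 => //; exact: sqr_ge0.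
  by rewrite /k expr2; clear => ?; lra.
have hh : 0 <= h <= h0 by rewrite ltW.
rewrite ML eE; apply: le_trans (quot_cubic c10 hh ht01 hM hL hj0 hj1 hj2 cj0 jt) _.
by rewrite le_eqVlt /C0; apply/orP; left; apply/eqP; ring.
Qed.

End CubicApproximation.

(** * The estimate on one element *)

Section ElementEstimate.
Context {R : realType}.
Implicit Types (a b c p q : nat -> R) (x y : R).

(* The constant field w = (w1, w2) is the Piola transform of adj(DF) w, which is
   affine because F is quadratic. *)
Lemma piola_sub_const a b p q (w1 w2 : R) : exists p' q',
  forall x y, jac a b x y != 0 ->
    [/\ q2 p' x y = q2 p x y - (q2y b x y * w1 - q2y a x y * w2),
        q2 q' x y = q2 q x y - (q2x a x y * w2 - q2x b x y * w1),
        piola a b a p' q' x y = piola a b a p q x y - w1 &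
        piola a b b p' q' x y = piola a b b p q x y - w2].
Proof.
exists (fun i => nth 0 [:: p 0%N - (b 2%N * w1 - a 2%N * w2); p 1%N - (b 4%N * w1 - a 4%N * w2);
  p 2%N - (2 * b 5%N * w1 - 2 * a 5%N * w2); p 3%N; p 4%N; p 5%N] i).
exists (fun i => nth 0 [:: q 0%N - (a 1%N * w2 - b 1%N * w1); q 1%N - (2 * a 3%N * w2 - 2 * b 3%N * w1);
  q 2%N - (a 4%N * w2 - b 4%N * w1); q 3%N; q 4%N; q 5%N] i).
move=> x y J; set p' := fun i => _; set q' := fun i => _.
have E1 : q2 p' x y = q2 p x y - (q2y b x y * w1 - q2y a x y * w2).
  by rewrite /q2 /q2y /p' /=; ring.
have E2 : q2 q' x y = q2 q x y - (q2x a x y * w2 - q2x b x y * w1).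
  by rewrite /q2 /q2x /q' /=; ring.
split=> //; rewrite /piola /pnum E1 E2; move: J; rewrite /jac => J; field; exact: J.
Qed.

Lemma piola_inv a b p q x y : jac a b x y != 0 ->
  q2 p x y = q2y b x y * piola a b a p q x y - q2y a x y * piola a b b p q x y /\
  q2 q x y = q2x a x y * piola a b b p q x y - q2x b x y * piola a b a p q x y.
Proof. by rewrite /piola /pnum /jac => J; split; field. Qed.

(** The segment need not meet the box around (X, Y). The two are linked by the polynomials [p] and
    [q] alone: the gradient on the box bounds their coefficients, and these control the remainder on
    the segment. *)
Lemma elt_cubic (K c1 h0 rho : R) : 0 < K -> 0 < c1 -> 0 < h0 -> 0 < rho <= 1 -> exists2 C, 0 < C &
  forall h X Y x0 y0 d1 d2 a b p q S phi v N, h <= h0 -> `|X| <= 1 -> `|Y| <= 1 ->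
    patch K c1 h rho X Y a b p q S phi v 0 ->
    (forall i, (2 < i < 6)%N -> `|a i| <= K * h /\ `|b i| <= K * h) ->
    `|x0| <= 1 -> `|y0| <= 1 -> `|d1| <= 1 -> `|d2| <= 1 ->
    (forall t, 0 <= t <= 1 -> [/\ `|x0 + t * d1| <= 1, `|y0 + t * d2| <= 1,
        c1 <= jac a b (x0 + t * d1) (y0 + t * d2) &
        v (mkpt (h * q2 a (x0 + t * d1) (y0 + t * d2)) (h * q2 b (x0 + t * d1) (y0 + t * d2))) =
        h^-1 *: mkpt (piola a b a p q (x0 + t * d1) (y0 + t * d2))
                     (piola a b b p q (x0 + t * d1) (y0 + t * d2))]) ->
    (L2norm S° (fun z => enorm (Dmx v z)) <= N%:E)%E ->
    forall i : 'I_2, exists e, forall t, 0 <= t <= 1 ->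
      `|v (mkpt (h * q2 a (x0 + t * d1) (y0 + t * d2)) (h * q2 b (x0 + t * d1) (y0 + t * d2))) i ord0
        - cub e t| <= C * (h ^+ 2 * N).
Proof.
move=> K0 c10 h00 hrho.
have [C1 C10 hC1] := piola_poincare K0 c10 hrho.
have [C2 C20 hC2] := piola_cubic K0 c10 h00.
exists (C2 * C1); first exact: mulr_gt0.
move=> h X Y x0 y0 d1 d2 a b p q S phi v N hh0 X1 Y1 P hK2 x01 y01 d11 d21 hv hN i.
have h_0 := patch_h P.
have rho0 : 0 < rho by case/andP: hrho.
have bX : box X Y (2 * rho) X Y.
  by split; rewrite subrr normr0; apply: mulr_ge0 => //; exact: ltW.
have Jn x y : c1 <= jac a b x y -> jac a b x y != 0.
  by move=> h1; rewrite gt_eqF // (lt_le_trans c10).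
pose w1 := piola a b a p q X Y; pose w2 := piola a b b p q X Y.
have [p' [q' hpq]] := piola_sub_const a b p q w1 w2.
have JX := Jn _ _ (patch_jac P bX).
(* The subtracted constant moves into the additive vector of the patch, so that [v], and with it the
   gradient norm, stays the same. *)
have P' : patch K c1 h rho X Y a b p' q' S phi v (h^-1 *: mkpt w1 w2).
  case: P => ? ? ? hj ? ? ? hval; split => // x y bxy.
  have [_ _ -> ->] := hpq _ _ (Jn _ _ (hj _ _ bxy)).
  rewrite hval // add0r -scalerDr; congr (_ *: _).
  rewrite -[RHS]mkptE !mxE /=; congr mkpt; ring.
have p0 : q2 p' X Y = 0.
  by have [-> _ _ _] := hpq _ _ JX; have [-> _] := piola_inv p q JX; rewrite subrr.
have q0 : q2 q' X Y = 0.
  by have [_ -> _ _] := hpq _ _ JX; have [_ ->] := piola_inv p q JX; rewrite subrr.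
have hb := hC1 _ _ _ _ _ _ _ _ _ _ _ _ X1 Y1 P' p0 q0 hN.
have hh : 0 < h <= h0 by rewrite h_0.
have kb j : (0 < j < 6)%N -> [/\ `|a j| <= K, `|b j| <= K & `|comp2 a b i j| <= K].
  by move=> /(patch_coef P)[? ?]; split => //; rewrite /comp2; case: ifP.
have kb2 j : (2 < j < 6)%N -> [/\ `|a j| <= K * h, `|b j| <= K * h & `|comp2 a b i j| <= K * h].
  by move=> /hK2[? ?]; split => //; rewrite /comp2; case: ifP.
have hj t : 0 <= t <= 1 -> [/\ `|x0 + t * d1| <= 1, `|y0 + t * d2| <= 1 &
    c1 <= jac a b (x0 + t * d1) (y0 + t * d2)] by move=> /hv[].
have [e he] := hC2 _ _ _ _ _ _ _ _ _ _ _ hh kb kb2 hb x01 y01 d11 d21 hj.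
pose w := if i == ord0 then w1 else w2.
exists (fun j => h^-1 * (e j + if j == 0%N then w else 0)) => t ht.
have [_ _ /Jn J ->] := hv t ht.
have [_ _ E1 E2] := hpq _ _ J.
have -> : (h^-1 *: mkpt (piola a b a p q (x0 + t * d1) (y0 + t * d2))
   (piola a b b p q (x0 + t * d1) (y0 + t * d2))) i ord0 =
   h^-1 * (piola a b (comp2 a b i) p' q' (x0 + t * d1) (y0 + t * d2) + w).
  by rewrite !mxE /comp2 /w; case: ifP => _; rewrite ?E1 ?E2 subrK.
have -> : cub (fun j => h^-1 * (e j + if j == 0%N then w else 0)) t = h^-1 * (cub e t + w).
  by rewrite /cub /=; ring.
rewrite -mulrBr opprD addrACA subrr addr0 normrM gtr0_norm ?invr_gt0 //.
rewrite mulrC ler_pdivrMr //; apply: le_trans (he t ht) _.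
by rewrite le_eqVlt; apply/orP; left; apply/eqP; ring.
Qed.

End ElementEstimate.

(** * Coordinates for the mesh maps *)

Section MeshCharts.
Context {R : realType}.
Implicit Types (a b c p q : nat -> R) (x y : R).
Local Notation R2 := ('cV[R]_2).

Lemma Pk2_q2 (f : R2 -> R) : Pk 2 f -> exists c, forall z, f z = plane (q2 c) z.
Proof.
case=> d hd; exists (fun i => nth 0 [:: d 0%N 0%N; d 1%N 0%N; d 0%N 1%N; d 2%N 0%N; d 1%N 1%N; d 0%N 2%N] i) => z.
rewrite hd /plane /q2 /= !big_ord_recl big_ord0 /=.
by do 3 rewrite big_mkcond !big_ord_recl big_ord0 /=; rewrite /bump /= !expr0 !expr1; ring.
Qed.

Lemma q2_affine c (u0 u1 u2 w0 w1 w2 : R) : exists d, forall x y,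
  q2 c (u0 + u1 * x + u2 * y) (w0 + w1 * x + w2 * y) = q2 d x y.
Proof.
exists (fun i => nth 0 [:: q2 c u0 w0;
  q2x c u0 w0 * u1 + q2y c u0 w0 * w1; q2x c u0 w0 * u2 + q2y c u0 w0 * w2;
  c 3%N * u1 ^+ 2 + c 4%N * (u1 * w1) + c 5%N * w1 ^+ 2;
  2 * c 3%N * u1 * u2 + c 4%N * (u1 * w2 + u2 * w1) + 2 * c 5%N * w1 * w2;
  c 3%N * u2 ^+ 2 + c 4%N * (u2 * w2) + c 5%N * w2 ^+ 2] i) => x y.
by rewrite /q2 /q2x /q2y /=; ring.
Qed.

Lemma FaffE (t : 'I_3 -> R2) (z : R2) i : Faff t z i ord0 =
  t (inord 2) i ord0 + (t (inord 0) i ord0 - t (inord 2) i ord0) * z ord0 ord0 +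
  (t (inord 1) i ord0 - t (inord 2) i ord0) * z ord_max ord0.
Proof. by rewrite !mxE; ring. Qed.

Lemma FT_q2 (M : iso_mesh R) (i : 'I_(nelt M)) : vec (Pk 2) (@Gh _ M i) ->
  exists a b, forall z, FT i z = mkpt (plane (q2 a) z) (plane (q2 b) z).
Proof.
move=> hG.
have H (j : 'I_2) : exists d, forall z, FT i z j ord0 = plane (q2 d) z.
  have [c hc] := Pk2_q2 (hG j).
  have [d hd] := q2_affine c (vtx i (inord 2) ord0 ord0)
     (vtx i (inord 0) ord0 ord0 - vtx i (inord 2) ord0 ord0) (vtx i (inord 1) ord0 ord0 - vtx i (inord 2) ord0 ord0)
     (vtx i (inord 2) ord_max ord0) (vtx i (inord 0) ord_max ord0 - vtx i (inord 2) ord_max ord0)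
     (vtx i (inord 1) ord_max ord0 - vtx i (inord 2) ord_max ord0).
  by exists d => z; rewrite /FT /= hc /plane /Ftil !FaffE hd.
have [a ha] := H ord0; have [b hb] := H ord_max.
by exists a, b => z; rewrite -ha -hb mkptE.
Qed.

Lemma derive_q2 c z : 'D_(evec ord0) (plane (q2 c)) z = plane (q2x c) z /\
  'D_(evec ord_max) (plane (q2 c)) z = plane (q2y c) z.
Proof.
rewrite -(mkptE z) derive_planex derive_planey /plane !mkpt0 !mkpt1; split.
  under eq_fun do rewrite mkpt0 mkpt1.
  by have [_ ->] := is_derive_q2x c (z ord0 ord0) (z ord_max ord0).
under eq_fun do rewrite mkpt0 mkpt1.
by have [_ ->] := is_derive_q2y c (z ord0 ord0) (z ord_max ord0).
Qed.

Lemma Dmx_q2 (F : R2 -> R2) a b z : (forall z, F z = mkpt (plane (q2 a) z) (plane (q2 b) z)) ->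
  [/\ Dmx F z ord0 ord0 = plane (q2x a) z, Dmx F z ord0 ord_max = plane (q2y a) z,
      Dmx F z ord_max ord0 = plane (q2x b) z & Dmx F z ord_max ord_max = plane (q2y b) z].
Proof.
move=> hF; have E0 : (fun u => F u ord0 ord0) = plane (q2 a) by apply/funext => u; rewrite hF mkpt0.
have E1 : (fun u => F u ord_max ord0) = plane (q2 b) by apply/funext => u; rewrite hF mkpt1.
have [? ?] := derive_q2 a z; have [? ?] := derive_q2 b z.
by split; rewrite mxE ?E0 ?E1.
Qed.

Lemma det2 (A : 'M[R]_2) : \det A = A ord0 ord0 * A ord_max ord_max - A ord0 ord_max * A ord_max ord0.
Proof.
rewrite (expand_det_row _ ord0) !big_ord_recl big_ord0 addr0 /cofactor !det_mx11 !mxE /=.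
have -> : lift ord0 ord0 = ord_max :> 'I_2 by apply/val_inj.
have -> : lift ord_max ord0 = ord0 :> 'I_2 by apply/val_inj.
by rewrite expr0 expr1 mul1r mulN1r mulrN.
Qed.

Lemma det_q2 (F : R2 -> R2) a b z : (forall z, F z = mkpt (plane (q2 a) z) (plane (q2 b) z)) ->
  \det (Dmx F z) = plane (jac a b) z.
Proof. by move=> hF; have [e1 e2 e3 e4] := Dmx_q2 z hF; rewrite det2 e1 e2 e3 e4. Qed.

Lemma tri_That x y : 0 <= x -> 0 <= y -> x + y <= 1 -> @That R (mkpt x y).
Proof.
move=> x0 y0 xy; exists (fun k => nth 0 [:: x; y; 1 - x - y] k); split.
- by case=> [[|[|[|//]]]] /= _ //; lra.
- by rewrite !big_ord_recl big_ord0 /=; ring.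
rewrite !big_ord_recl big_ord0 /= /refv /=.
by rewrite -[RHS]mkptE !mxE /=; congr mkpt; ring.
Qed.

Lemma That_coord z : @That R z -> [/\ 0 <= z ord0 ord0, 0 <= z ord_max ord0 & z ord0 ord0 + z ord_max ord0 <= 1].
Proof.
case=> l [l0 l1 ->]; move: l1; rewrite !big_ord_recl !big_ord0 /= /refv /= !mxE /=.
have := l0 ord0; have := l0 (lift ord0 ord0); have := l0 (lift ord0 (lift ord0 ord0)).
by move=> ? ? ? ?; split; lra.
Qed.

Lemma That_box x y r : 0 < r -> r < x -> r < y -> x + y + 2 * r < 1 ->
  (@That R)° (mkpt x y).
Proof.
move=> r0 rx ry xy.
have hx : `|x - x| < r by rewrite subrr normr0.
have hy : `|y - y| < r by rewrite subrr normr0.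
have := near_box hx hy; apply: filterS => z [].
rewrite !ler_norml => /andP[? ?] /andP[? ?].
by rewrite -(mkptE z); apply: tri_That; lra.
Qed.

Lemma pder1_entry (F : R2 -> R2) z j i : differentiable F z ->
  (pder [:: j] F z) i ord0 = 'D_(evec j) (fun u => F u i ord0) z.
Proof.
by move=> dF; rewrite /pder /= derive_mx ?mxE //; exact: diff_derivable.
Qed.

Lemma pder2_entry (F : R2 -> R2) A z j k i : open A -> A z ->
  (forall s u, (size s < 2)%N -> A u -> differentiable (pder s F) u) ->
  (pder [:: j; k] F z) i ord0 =
  'D_(evec j) (fun w => 'D_(evec k) (fun u => F u i ord0) w) z.
Proof.
move=> oA Az dF.
rewrite (pder1_entry (F := pder [:: k] F)); last exact: (dF [:: k]).
apply: near_eq_derive; have : \forall u \near z, A u by exact: open_nbhs_nbhs.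
by apply: filterS => u Au; rewrite pder1_entry //; exact: (dF [::]).
Qed.

End MeshCharts.

Section ElementCharts.
Context {R : realType}.
Implicit Types (a b c p q : nat -> R) (x y : R).
Local Notation R2 := ('cV[R]_2).

(** [F_T] is a quadratic polynomial, so its derivatives at one interior point, here the barycenter,
    determine all but the constant coefficients. The second derivatives there are at most K h^2;
    shifting the first ones to the origin adds another K h^2 <= K h0 h. Division by h gives [a] and
    [b]. *)
Lemma FT_chart (M : iso_mesh R) (K c1 c2 h0 : R) (i : 'I_(nelt M)) :
  0 < K -> 0 < c1 -> Gh_ok M K -> maps_ok M K c1 c2 -> hT i <= h0 ->
  0 < hT i /\ exists a b, [/\
    forall z, FT i z = mkpt (hT i * plane (q2 a) z) (hT i * plane (q2 b) z),
    forall j, (0 < j < 6)%N -> `|a j| <= K * (1 + h0) /\ `|b j| <= K * (1 + h0),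
    forall j, (2 < j < 6)%N -> `|a j| <= K * hT i /\ `|b j| <= K * hT i &
    forall x y, 0 <= x -> 0 <= y -> x + y <= 1 -> c1 <= jac a b x y].
Proof.
move=> K0 c10 hG hM hh; set h := hT i in hh *.
have [PkG _ _ _] := hG i; have [_ inj W _ hdet] := hM i.
have [A [B FE]] := FT_q2 PkG.
have w1 := W 1%N isT; have w2 := W 2%N isT; rewrite -/h in w1 w2.
pose z0 : R2 := mkpt (3^-1) (3^-1).
have z0i : (@That R)° z0 by apply: (@That_box _ _ _ (12^-1)); lra.
have E0 : (fun u => FT i u ord0 ord0) = plane (q2 A) by apply/funext => u; rewrite FE mkpt0.
have E1 : (fun u => FT i u ord_max ord0) = plane (q2 B) by apply/funext => u; rewrite FE mkpt1.
have b1 j k : `|'D_(evec j) (fun u => FT i u k ord0) z0| <= K * h.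
  case: w1 => d1 /(_ [:: j] z0 erefl z0i); rewrite expr1; apply: le_trans.
  rewrite -(pder1_entry (F := FT i)); last exact: (d1 [::]).
  exact: entry_le_enorm.
have b2 j k l : `|'D_(evec j) (fun w => 'D_(evec l) (fun u => FT i u k ord0) w) z0| <= K * h ^+ 2.
  case: w2 => d2 /(_ [:: j; l] z0 erefl z0i); apply: le_trans.
  rewrite -(pder2_entry _ _ _ (@open_interior _ _) z0i d2).
  exact: entry_le_enorm.
have h_0 : 0 <= h by rewrite -(pmulr_rge0 _ K0); apply: le_trans (b1 ord0 ord0).
have hder c : (forall j, `|'D_(evec j) (plane (q2 c)) z0| <= K * h) ->
   (forall j l, `|'D_(evec j) (fun w => 'D_(evec l) (plane (q2 c)) w) z0| <= K * h ^+ 2) ->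
   (forall j, (2 < j < 6)%N -> `|c j| <= K * h ^+ 2) /\
   (forall j, (0 < j < 6)%N -> `|c j| <= K * (1 + h0) * h).
  move=> D1 D2.
  have dx : (fun w => 'D_(evec ord0) (plane (q2 c)) w) = plane (q2x c).
    by apply/funext => w; have [] := derive_q2 c w.
  have dy : (fun w => 'D_(evec ord_max) (plane (q2 c)) w) = plane (q2y c).
    by apply/funext => w; have [] := derive_q2 c w.
  have := (D2 ord0 ord0, D2 ord0 ord_max, D2 ord_max ord_max); rewrite dx dy.
  rewrite !derive_planex !derive_planey /plane.
  under eq_fun do rewrite mkpt0 mkpt1.
  have [_ ->] := is_derive_q2xx c (3^-1) (3^-1).
  under eq_fun do rewrite mkpt0 mkpt1.
  have [_ ->] := is_derive_q2yx c (3^-1) (3^-1).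
  under eq_fun do rewrite mkpt0 mkpt1.
  have [_ ->] := is_derive_q2yy c (3^-1) (3^-1).
  rewrite !normrM !(ger0_norm (ler0n R 2)) => -[[C3 C4 C5]].
  have := (D1 ord0, D1 ord_max); have [-> ->] := derive_q2 c z0.
  rewrite /plane /z0 mkpt0 mkpt1 => -[C1 C2].
  have n3 := normr_ge0 (c 3%N); have n5 := normr_ge0 (c 5%N).
  have hi : K * h ^+ 2 <= K * h0 * h.
    by rewrite expr2 mulrA -mulrA (mulrC h) mulrA ler_wpM2r // ler_wpM2l // ltW.
  have Kh : 0 <= K * h by apply: mulr_ge0 => //; exact: ltW.
  have H2 j : (2 < j < 6)%N -> `|c j| <= K * h ^+ 2.
    by case: j => [|[|[|[|[|[|//]]]]]] // _; lra.
  have hs : K * (1 + h0) * h = K * h + K * h0 * h by ring.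
  split=> // -[|[|[|j]]] // hj; last by rewrite hs; have := H2 _ (hj : (2 < j.+3 < 6)%N); lra.
    have -> : c 1%N = q2x c 3^-1 3^-1 - (2 * c 3%N * 3^-1 + c 4%N * 3^-1) by rewrite /q2x; ring.
    rewrite hs; apply: le_trans (ler_normB _ _) _; apply: lerD => //.
    apply: le_trans (ler_normD _ _) _; rewrite !normrM (ger0_norm (ler0n R 2)) (@ger0_norm _ 3^-1) //; lra.
  have -> : c 2%N = q2y c 3^-1 3^-1 - (2 * c 5%N * 3^-1 + c 4%N * 3^-1) by rewrite /q2y; ring.
  rewrite hs; apply: le_trans (ler_normB _ _) _; apply: lerD => //.
  apply: le_trans (ler_normD _ _) _; rewrite !normrM (ger0_norm (ler0n R 2)) (@ger0_norm _ 3^-1) //; lra.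
have [A2 A1] := hder A (fun j => eq_ind _ (fun f => `|'D_(evec j) f z0| <= K * h) (b1 j ord0) _ E0)
  (fun j l => eq_ind _ (fun f => `|'D_(evec j) (fun w => 'D_(evec l) f w) z0| <= K * h ^+ 2) (b2 j ord0 l) _ E0).
have [B2 B1] := hder B (fun j => eq_ind _ (fun f => `|'D_(evec j) f z0| <= K * h) (b1 j ord_max) _ E1)
  (fun j l => eq_ind _ (fun f => `|'D_(evec j) (fun w => 'D_(evec l) f w) z0| <= K * h ^+ 2) (b2 j ord_max l) _ E1).
(* With h = 0 the bounds would make [F_T] constant, against its injectivity on the reference
   triangle. *)
have hp : 0 < h.
  rewrite lt_neqAle h_0 andbT; apply/eqP => h00; move: A1 B1; rewrite -h00 mulr0 => A1 B1.
  have F0 : FT i (mkpt 0 0) = FT i (mkpt 1 0).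
    have z (f : nat -> R) : (forall j, (0 < j < 6)%N -> `|f j| <= 0) -> plane (q2 f) (mkpt 0 0) = plane (q2 f) (mkpt 1 0).
      move=> hf; have f0 j : (0 < j < 6)%N -> f j = 0.
        by move=> /hf; rewrite normr_le0 => /eqP.
      by rewrite /plane !mkpt0 !mkpt1 /q2 (f0 1%N) // (f0 2%N) // (f0 3%N) // (f0 4%N) // (f0 5%N) // !mul0r.
    by rewrite !FE (z _ A1) (z _ B1).
  have T0 : @That R (mkpt 0 0) by apply: tri_That; lra.
  have T1 : @That R (mkpt 1 0) by apply: tri_That; lra.
  have := inj _ _ (mem_set T0) (mem_set T1) F0 => /matrixP /(_ ord0 ord0).
  by rewrite !mkpt0 => /eqP; rewrite eq_sym oner_eq0.
split => //; exists (fun j => A j / h), (fun j => B j / h).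
have sc c x y : h * q2 (fun j => c j / h) x y = q2 c x y.
  by rewrite /q2; field; rewrite gt_eqF.
split.
- by move=> z; rewrite FE /plane !sc.
- by move=> j hj; rewrite !normrM normfV (gtr0_norm hp) !ler_pdivrMr // A1 // B1.
- move=> j hj; rewrite !normrM normfV (gtr0_norm hp) !ler_pdivrMr // -mulrA -expr2.
  by rewrite A2 // B2.
- move=> x y x0 y0 xy; have := hdet _ (tri_That x0 y0 xy) => /andP[+ _].
  rewrite (det_q2 _ FE) /plane mkpt0 mkpt1 -ler_pdivlMr ?exprn_gt0 //.
  suff -> : jac (fun j => A j / h) (fun j => B j / h) x y = jac A B x y / h ^+ 2 by [].
  by rewrite /jac /q2x /q2y; field; rewrite gt_eqF.
Qed.

End ElementCharts.

(** * From the reference edge to an edge of the mesh *)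

Section EdgeEstimate.
Context {R : realType}.
Implicit Types (a b c p q : nat -> R) (x y : R).
Local Notation R2 := ('cV[R]_2).

Lemma I3_case (P : 'I_3 -> Prop) : P (inord 0) -> P (inord 1) -> P (inord 2) -> forall k, P k.
Proof.
move=> h0 h1 h2 [[|[|[|//]]] hk].
- by have -> : Ordinal hk = inord 0 by apply/val_inj; rewrite /= inordK.
- by have -> : Ordinal hk = inord 1 by apply/val_inj; rewrite /= inordK.
- by have -> : Ordinal hk = inord 2 by apply/val_inj; rewrite /= inordK.
Qed.

Lemma ordS3 : [/\ ordS (inord 0) = inord 1 :> 'I_3, ordS (inord 1) = inord 2 :> 'I_3 &
  ordS (inord 2) = inord 0 :> 'I_3].
Proof. by split; apply/val_inj; rewrite /= !inordK. Qed.

Lemma refvE : [/\ refv (inord 0) = mkpt 1 0 :> R2, refv (inord 1) = mkpt 0 1 :> R2 &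
  refv (inord 2) = mkpt 0 0 :> R2].
Proof. by split; rewrite /refv /= inordK. Qed.

Lemma sum3 (V : nmodType) (f : 'I_3 -> V) : \sum_k f k = f (inord 0) + f (inord 1) + f (inord 2).
Proof.
rewrite !big_ord_recl big_ord0 addr0 addrA.
by congr (f _ + f _ + f _); apply/val_inj; rewrite /= inordK.
Qed.

Lemma tri_mkpt (t : 'I_3 -> R2) x y (l0 l1 l2 : R) : 0 <= l0 -> 0 <= l1 -> 0 <= l2 -> l0 + l1 + l2 = 1 ->
  x = l0 * t (inord 0) ord0 ord0 + l1 * t (inord 1) ord0 ord0 + l2 * t (inord 2) ord0 ord0 ->
  y = l0 * t (inord 0) ord_max ord0 + l1 * t (inord 1) ord_max ord0 + l2 * t (inord 2) ord_max ord0 ->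
  tri t (mkpt x y).
Proof.
move=> h0 h1 h2 h3 -> ->; exists (fun k : 'I_3 => nth 0 [:: l0; l1; l2] k); split.
- by case=> [[|[|[|//]]]].
- by rewrite sum3 /= !inordK.
by rewrite sum3 !inordK //= -[RHS]mkptE !mxE.
Qed.

(** With [ctY], the centroid of the Clough-Tocher triangle [ctK k]. *)
Definition ctX (k : 'I_3) : R := if k == inord 0 then 9^-1 else 4 / 9.
Definition ctY (k : 'I_3) : R := if k == inord 1 then 9^-1 else 4 / 9.

Lemma I3_neq : [/\ (inord 0 == inord 1 :> 'I_3) = false, (inord 0 == inord 2 :> 'I_3) = false,
 (inord 1 == inord 0 :> 'I_3) = false, (inord 1 == inord 2 :> 'I_3) = false &
 (inord 2 == inord 0 :> 'I_3) = false /\ (inord 2 == inord 1 :> 'I_3) = false].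
Proof. by split; rewrite -?(inj_eq val_inj) /= ?inordK //; split; rewrite -(inj_eq val_inj) /= !inordK. Qed.

Lemma ct_box k x y : box (ctX k) (ctY k) (36^-1) x y ->
  [/\ 0 <= x, 0 <= y, x + y <= 1 & ctK k (mkpt x y)].
Proof.
have [n01 n02 n10 n12 [n20 n21]] := I3_neq; have [r0 r1 r2] := refvE.
elim/I3_case: k; rewrite /box /ctX /ctY ?eqxx ?n01 ?n10 ?n20 ?n21 !ler_norml =>
  -[/andP[? ?] /andP[? ?]]; (split; [lra|lra|lra|]).
(* Here and in the other two cases the weights are the barycentric coordinates of (x, y) in
   [ctK k]. *)
- apply: (tri_mkpt (l0 := 3 * x) (l1 := y - x) (l2 := 1 - 2 * x - y)); try lra;
  rewrite /= ?eqxx ?n01 ?n02 ?n10 ?n12 ?n20 ?n21 ?r0 ?r1 ?r2 !mxE /=; lra.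
- apply: (tri_mkpt (l0 := x - y) (l1 := 3 * y) (l2 := 1 - 2 * y - x)); try lra;
  rewrite /= ?eqxx ?n01 ?n02 ?n10 ?n12 ?n20 ?n21 ?r0 ?r1 ?r2 !mxE /=; lra.
- apply: (tri_mkpt (l0 := 2 * x + y - 1) (l1 := x + 2 * y - 1) (l2 := 3 * (1 - x - y))); try lra;
  rewrite /= ?eqxx ?n01 ?n02 ?n10 ?n12 ?n20 ?n21 ?r0 ?r1 ?r2 !mxE /=; lra.
Qed.

Lemma segpt_mkpt (u w : R2) t : segpt u w t =
  mkpt (u ord0 ord0 + t * (w ord0 ord0 - u ord0 ord0)) (u ord_max ord0 + t * (w ord_max ord0 - u ord_max ord0)).
Proof. by rewrite -[LHS]mkptE !mxE; congr mkpt; ring. Qed.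

Lemma ct_edge (k : 'I_3) t : 0 <= t <= 1 ->
  ctK k (segpt (refv (ordS k)) (refv (ordS (ordS k))) t : R2) /\
  That (segpt (refv (ordS k)) (refv (ordS (ordS k))) t : R2).
Proof.
move=> /andP[t0 t1]; have [n01 n02 n10 n12 [n20 n21]] := I3_neq; have [r0 r1 r2] := refvE.
have [s0 s1 s2] := ordS3.
rewrite segpt_mkpt; elim/I3_case: k; rewrite ?s0 ?s1 ?s2 ?s0 ?s1 ?s2 ?r0 ?r1 ?r2 !mxE /=; (split; [|by apply: tri_That; lra]).
- apply: (tri_mkpt (l0 := 0) (l1 := 1 - t) (l2 := t)); try lra;
  rewrite /= ?eqxx ?n01 ?n02 ?n10 ?n12 ?n20 ?n21 ?r0 ?r1 ?r2 !mxE /=; lra.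
- apply: (tri_mkpt (l0 := t) (l1 := 0) (l2 := 1 - t)); try lra;
  rewrite /= ?eqxx ?n01 ?n02 ?n10 ?n12 ?n20 ?n21 ?r0 ?r1 ?r2 !mxE /=; lra.
- apply: (tri_mkpt (l0 := 1 - t) (l1 := t) (l2 := 0)); try lra;
  rewrite /= ?eqxx ?n01 ?n02 ?n10 ?n12 ?n20 ?n21 ?r0 ?r1 ?r2 !mxE /=; lra.
Qed.

Lemma That_refv (k : 'I_3) : That (refv k : R2).
Proof.
by have [r0 r1 r2] := refvE; elim/I3_case: k; rewrite ?r0 ?r1 ?r2; apply: tri_That; lra.
Qed.

Lemma ctXY_le1 k : `|ctX k| <= 1 /\ `|ctY k| <= 1.
Proof. by rewrite /ctX /ctY; split; case: ifP => _; rewrite ger0_norm; lra. Qed.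

(** DF carries a factor h and its determinant a factor h^2. *)
Lemma AT_piola (M : iso_mesh R) (i : 'I_(nelt M)) h a b p q z : h != 0 ->
  (forall z, FT i z = mkpt (h * plane (q2 a) z) (h * plane (q2 b) z)) ->
  plane (jac a b) z != 0 ->
  AT i z *m mkpt (plane (q2 p) z) (plane (q2 q) z) =
  h^-1 *: mkpt (plane (piola a b a p q) z) (plane (piola a b b p q) z).
Proof.
move=> h0 hF J.
have sc c x y : h * q2 c x y = q2 (fun j => h * c j) x y by rewrite /q2; ring.
have scx c x y : q2x (fun j => h * c j) x y = h * q2x c x y by rewrite /q2x; ring.
have scy c x y : q2y (fun j => h * c j) x y = h * q2y c x y by rewrite /q2y; ring.
have hF' z' : FT i z' = mkpt (plane (q2 (fun j => h * a j)) z') (plane (q2 (fun j => h * b j)) z').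
  by rewrite hF /plane !sc.
have [e1 e2 e3 e4] := Dmx_q2 z hF'.
rewrite /AT -scalemxAl (det_q2 z hF'); move: (Dmx (FT i) z) e1 e2 e3 e4 => D e1 e2 e3 e4.
have l0 : lift ord0 ord0 = ord_max :> 'I_2 by exact/val_inj.
move: J; rewrite -[RHS]mkptE -[LHS]mkptE /plane /jac => J.
congr mkpt; rewrite !mxE !big_ord_recl big_ord0 !mxE /= l0 ?e1 ?e2 ?e3 ?e4 /plane /piola /pnum /jac
  !scx !scy; field; rewrite J h0 /=.
  by rewrite (_ : _ - _ = h * h * (q2x a (z ord0 ord0) (z ord_max ord0) * q2y b (z ord0 ord0) (z ord_max ord0) -
    q2y a (z ord0 ord0) (z ord_max ord0) * q2x b (z ord0 ord0) (z ord_max ord0))); [rewrite !mulf_neq0|ring].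
by rewrite (_ : _ - _ = h * h * (q2x a (z ord0 ord0) (z ord_max ord0) * q2y b (z ord0 ord0) (z ord_max ord0) -
    q2y a (z ord0 ord0) (z ord_max ord0) * q2x b (z ord0 ord0) (z ord_max ord0))); [rewrite !mulf_neq0|ring].
Qed.

(** The edge opposite to vertex [k] lies in the single Clough-Tocher triangle [ctK k], where the
    reference function is one polynomial; the box used by the Poincare inequality is placed in that
    same triangle. *)
Lemma elt_edge_cubic (K c1 h0 : R) : 0 < K -> 0 < c1 -> 0 < h0 -> exists2 C, 0 < C &
  forall (M : iso_mesh R) (c2 : R) (i : 'I_(nelt M)) (k : 'I_3) v N, Gh_ok M K -> maps_ok M K c1 c2 ->
    hT i <= h0 -> VT i v -> (gradL2 i v <= N%:E)%E ->
    forall l : 'I_2, exists e, forall t, 0 <= t <= 1 ->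
      `|v (FT i (segpt (refv (ordS k)) (refv (ordS (ordS k))) t)) l ord0 - cub e t| <= C * (hT i ^+ 2 * N).
Proof.
move=> K0 c10 h00.
have K10 : 0 < K * (1 + h0) by apply: mulr_gt0 => //; lra.
(* A patch uses the box of radius [2 rho], and radius 1/36 fits in [ctK k]. *)
have rho01 : 0 < (72^-1 : R) <= 1 by apply/andP; split; lra.
have [C C0 hC] := elt_cubic K10 c10 h00 rho01.
exists C => // M c2 i k v N hG hM hh [vh [[_ hvh] vE]] hN.
have [hp [a [b [FE ab ab2 Jab]]]] := FT_chart K0 c10 hG hM hh.
have [_ inj Wpinv Winv _] := hM i.
have [w [hw wE]] := hvh k.
have [p pE] := Pk2_q2 (hw ord0); have [q qE] := Pk2_q2 (hw ord_max).
have wq z : w z = mkpt (plane (q2 p) z) (plane (q2 q) z) by rewrite -pE -qE mkptE.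
have hval z : That z -> ctK k z -> v (FT i z) =
    (hT i)^-1 *: mkpt (plane (piola a b a p q) z) (plane (piola a b b p q) z).
  move=> Tz Cz; rewrite vE // wE // wq; apply: AT_piola => //; first by rewrite gt_eqF.
  by have [? ? ?] := That_coord Tz; rewrite gt_eqF // (lt_le_trans c10) // Jab.
have FE2 x y : FT i (mkpt x y) = mkpt (hT i * q2 a x y) (hT i * q2 b x y).
  by rewrite FE /plane !mkpt0 !mkpt1.
have two : 2 * 72^-1 = 36^-1 :> R by lra.
have P : patch (K * (1 + h0)) c1 (hT i) (72^-1) (ctX k) (ctY k) a b p q (Tel i)
     ('pinv_(fun=> 0) That (FT i)) v 0.
  split; rewrite ?two //.
  - by move=> x y /ct_box[]; clear => ? ? ? _; rewrite !ger0_norm //; split; lra.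
  - by move=> x y /ct_box[? ? ? _]; exact: Jab.
  - by move=> x y /ct_box[? ? ? _]; rewrite -FE2; exists (mkpt x y) => //; exact: tri_That.
  - move=> z Sz; split; first by have [d _] := Winv 1%N isT; exact: (d [::]).
    have Tz : Tel i z by exact: interior_subset Sz.
    by rewrite -FE pinvK //; exact: mem_set.
  - by move=> x y /ct_box[? ? ? _]; rewrite -FE2 pinvKV //; apply: mem_set; exact: tri_That.
  move=> x y /ct_box[? ? ? Cxy]; rewrite -FE2 add0r hval //; last exact: tri_That.
  by rewrite /plane !mkpt0 !mkpt1.
have [cX cY] := ctXY_le1 k.
have ab2' j : (2 < j < 6)%N -> `|a j| <= K * (1 + h0) * hT i /\ `|b j| <= K * (1 + h0) * hT i.
  have le : K * hT i <= K * (1 + h0) * hT i.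
    by apply: ler_wpM2r; [exact: ltW|apply: ler_peMr; [exact: ltW|lra]].
  by move=> /ab2[? ?]; split; exact: le_trans le.
pose u : R2 := refv (ordS k); pose u' : R2 := refv (ordS (ordS k)).
have [u0 u1 u2] := That_coord (That_refv (ordS k)); have [u0' u1' u2'] := That_coord (That_refv (ordS (ordS k))).
rewrite -/u -/u' in u0 u1 u2 u0' u1' u2' *.
have segE t : FT i (segpt u u' t) = mkpt
   (hT i * q2 a (u ord0 ord0 + t * (u' ord0 ord0 - u ord0 ord0)) (u ord_max ord0 + t * (u' ord_max ord0 - u ord_max ord0)))
   (hT i * q2 b (u ord0 ord0 + t * (u' ord0 ord0 - u ord0 ord0)) (u ord_max ord0 + t * (u' ord_max ord0 - u ord_max ord0))).
  by rewrite segpt_mkpt FE2.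
have nle (s : R) : -1 <= s -> s <= 1 -> `|s| <= 1 by move=> ? ?; rewrite ler_norml; apply/andP.
move=> l.
have U0 : `|u ord0 ord0| <= 1 by apply: nle; move: u0 u1 u2 u0' u1' u2'; clear => *; lra.
have U1 : `|u ord_max ord0| <= 1 by apply: nle; move: u0 u1 u2 u0' u1' u2'; clear => *; lra.
have D0 : `|u' ord0 ord0 - u ord0 ord0| <= 1 by apply: nle; move: u0 u1 u2 u0' u1' u2'; clear => *; lra.
have D1 : `|u' ord_max ord0 - u ord_max ord0| <= 1 by apply: nle; move: u0 u1 u2 u0' u1' u2'; clear => *; lra.
have [|e he] := hC _ _ _ _ _ _ _ _ _ _ _ _ _ v N hh cX cY P ab2' U0 U1 D0 D1 _ hN l.
  move=> t ht; have [Ct Tt] := ct_edge k ht; rewrite -/u -/u' in Ct Tt.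
  have [t0 t1 t2] := That_coord Tt; rewrite segpt_mkpt mkpt0 mkpt1 in t0 t1 t2.
  have [T1 T2] : u ord0 ord0 + t * (u' ord0 ord0 - u ord0 ord0) <= 1 /\
    u ord_max ord0 + t * (u' ord_max ord0 - u ord_max ord0) <= 1 by move: t0 t1 t2; clear => *; split; lra.
  split; [by rewrite ger0_norm|by rewrite ger0_norm|exact: Jab|].
  by rewrite -segE hval // segpt_mkpt /plane !mkpt0 !mkpt1.
by exists e => t ht; rewrite segE; exact: he.
Qed.

End EdgeEstimate.

(** * Simpson's rule with an approximating cubic *)

Section Simpson.
Context {R : realType}.
Import HBNNSimple.

Lemma le_maxe2 (x y z : \bar R) : (x <= y)%E -> (Order.max x z <= Order.max y z)%E.
Proof. by move=> xy; rewrite ge_max !le_max xy lexx orbT. Qed.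

(* The integral of a nonnegative function is by construction a supremum over the
   simple functions below it, hence monotone even for non-measurable functions. *)
Lemma le_integral_any (d : measure_display) (T : measurableType d)
    (mu : {measure set T -> \bar R}) (D : set T) (f g : T -> \bar R) :
  (forall x, D x -> f x <= g x)%E -> (\int[mu]_(x in D) f x <= \int[mu]_(x in D) g x)%E.
Proof.
move=> fg.
have mono (u w : T -> \bar R) : (forall x, 0 <= u x)%E -> (forall x, 0 <= w x)%E ->
    (forall x, D x -> u x <= w x)%E -> (\int[mu]_(x in D) u x <= \int[mu]_(x in D) w x)%E.
  move=> u0 w0 uw; rewrite (ge0_integralE _ (fun x _ => u0 x)) (ge0_integralE _ (fun x _ => w0 x)).
  apply: ereal_sup_le => _ /= [k ku <-]; exists k => // x; apply: le_trans (ku x) _.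
  by rewrite !patchE; case: (boolP (x \in D)) => [/set_mem Dx|_]; [exact: uw|exact: lexx].
rewrite (integralE mu D f) (integralE mu D g); apply: leeB; apply: mono => // x Dx; rewrite ?funeposE ?funenegE.
  by apply: le_maxe2 => //; exact: fg.
by apply: le_maxe2 => //; rewrite leeN2; exact: fg.
Qed.

Definition int_cub (e : nat -> R) : R := e 0%N + e 1%N / 2 + e 2%N / 3 + e 3%N / 4.

Lemma int_cubE (e : nat -> R) :
  (\int[@lebesgue_measure R]_(t in `[0%R, 1%R]) (cub e t)%:E = (int_cub e)%:E)%E.
Proof.
pose F : R -> R := e 0%N \*: (id : R -> R) + (e 1%N / 2) \*: ((id : R -> R) ^+ 2) + (e 2%N / 3) \*: ((id : R -> R) ^+ 3) + (e 3%N / 4) \*: ((id : R -> R) ^+ 4).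
pose f : R -> R := cst (e 0%N) + e 1%N \*: (id : R -> R) + e 2%N \*: ((id : R -> R) ^+ 2) + e 3%N \*: ((id : R -> R) ^+ 3).
have fE : cub e = f by apply/funext => t; rewrite /f !fctE.
have dF (t : R) : is_derive t 1 F (cub e t).
  by apply: is_derive_eq; rewrite /GRing.scale /= /cub; field.
have df (t : R) : derivable f t 1 by [].
have cont (g : R -> R) : (forall t : R, derivable g t 1) -> continuous g.
  by move=> dg t; apply/differentiable_continuous/derivable1_diffP.
have cF : continuous F by apply: cont => t; exact: (@ex_derive _ _ _ _ _ _ _ (dF t)).
rewrite (@continuous_FTC2 R (cub e) F 0 1 ltr01).
- have FE t : F t = e 0%N * t + e 1%N / 2 * t ^+ 2 + e 2%N / 3 * t ^+ 3 + e 3%N / 4 * t ^+ 4 by [].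
  by rewrite -EFinB; congr EFin; rewrite !FE /int_cub; field.
- by rewrite fE; apply: continuous_subspaceT; exact: cont.
- split => [t _||]; first exact: (@ex_derive _ _ _ _ _ _ _ (dF t)).
    by apply: cvg_at_right_filter; exact: cF.
  by apply: cvg_at_left_filter; exact: cF.
- by move=> t _; rewrite derive1E; have [_ ->] := dF t.
Qed.

Lemma simpson_cub (e : nat -> R) : int_cub e = (cub e 0 + 4 * cub e (2^-1) + cub e 1) / 6.
Proof. by rewrite /int_cub /cub; field. Qed.

(** [F] lies between the cubics [cub e - eps] and [cub e + eps], and monotonicity of the integral
    costs one [eps]. At the three nodes [F] vanishes, so the cubic is at most [eps] there, and so is
    its Simpson sum, which is its exact integral. *)
Lemma simpson_bound (F : R -> R) (e : nat -> R) (eps : R) :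
  (forall t, 0 <= t <= 1 -> `|F t - cub e t| <= eps) -> F 0 = 0 -> F (2^-1) = 0 -> F 1 = 0 ->
  `|\int[@lebesgue_measure R]_(t in `[0, 1]) F t| <= 2 * eps.
Proof.
move=> h F0 F2 F1.
pose up (s : R) (j : nat) : R := e j + if j == 0%N then s else 0.
have upE s t : cub (up s) t = cub e t + s by rewrite /cub /up /=; ring.
have upI s : int_cub (up s) = int_cub e + s by rewrite /int_cub /up /=; ring.
have U : (\int[@lebesgue_measure R]_(t in `[0%R, 1%R]) (F t)%:E <= (int_cub e + eps)%:E)%E.
  rewrite -upI -int_cubE; apply: le_integral_any => t; rewrite /= in_itv /= => ht.
  by rewrite lee_fin upE; move: (h t ht); rewrite ler_norml => /andP[? ?]; lra.
have L : ((int_cub e - eps)%:E <= \int[@lebesgue_measure R]_(t in `[0%R, 1%R]) (F t)%:E)%E.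
  rewrite -upI -int_cubE; apply: le_integral_any => t; rewrite /= in_itv /= => ht.
  by rewrite lee_fin upE; move: (h t ht); rewrite ler_norml => /andP[? ?]; lra.
have fin : (\int[@lebesgue_measure R]_(t in `[0%R, 1%R]) (F t)%:E \is a fin_num)%E.
  by rewrite fin_numElt (lt_le_trans _ L) ?ltNyr // (le_lt_trans U) // ltry.
rewrite /Rintegral; move: U L; rewrite -(fineK fin) !lee_fin; set I := fine _ => U L.
have h0 : `|cub e 0| <= eps by have := h 0; rewrite F0 sub0r normrN; apply; apply/andP; split; lra.
have h2 : `|cub e 2^-1| <= eps by have := h 2^-1; rewrite F2 sub0r normrN; apply; apply/andP; split; lra.
have h1 : `|cub e 1| <= eps by have := h 1; rewrite F1 sub0r normrN; apply; apply/andP; split; lra.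
rewrite simpson_cub in U L; move: h0 h1 h2; rewrite !ler_norml => /andP[? ?] /andP[? ?] /andP[? ?].
by rewrite /=; apply/andP; split; lra.
Qed.

End Simpson.

(** * Barycentric coordinates and segments *)

Section PlanarGeometry.
Context {R : realType}.
Local Notation R2 := ('cV[R]_2).
Implicit Types (u w z : R2) (t : 'I_3 -> R2).
Local Notation "z .1x" := (z ord0 ord0) (at level 2, format "z .1x").
Local Notation "z .2x" := (z ord_max ord0) (at level 2, format "z .2x").

Lemma ordS3E : ((ordS (inord 0) = inord 1 :> 'I_3) * (ordS (inord 1) = inord 2 :> 'I_3) *
  (ordS (inord 2) = inord 0 :> 'I_3))%type.
Proof. by have [? ? ?] := ordS3. Qed.

Lemma cV2_ext u w : u.1x = w.1x -> u.2x = w.2x -> u = w.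
Proof. by move=> h1 h2; rewrite -(mkptE u) -(mkptE w) h1 h2. Qed.

Definition cross u w : R := u.1x * w.2x - u.2x * w.1x.

(** Twice the signed area. *)
Definition area t : R := cross (t (inord 1) - t (inord 0)) (t (inord 2) - t (inord 0)).

(** The barycentric coordinate of [z] at vertex [k], as a quotient of signed areas and thus
    independent of the orientation. *)
Definition bc t (k : 'I_3) z : R :=
  cross (t (ordS (ordS k)) - t (ordS k)) (z - t (ordS k)) / area t.

Lemma area_cyc t k : area t = cross (t (ordS k) - t k) (t (ordS (ordS k)) - t k).
Proof.
by elim/I3_case: k; rewrite !ordS3E /area /cross !mxE; ring.
Qed.

Lemma bc_sum t z : area t != 0 -> \sum_k bc t k z = 1.
Proof.
rewrite sum3 /bc !ordS3E /area /cross !mxE => A; field; exact: A.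
Qed.

Lemma bc_comb t z : area t != 0 -> z = \sum_k bc t k z *: t k.
Proof.
rewrite sum3 /bc !ordS3E /area /cross => A.
by apply: cV2_ext; rewrite !mxE in A *; field; exact: A.
Qed.

Lemma bc_lin t k (l : 'I_3 -> R) : area t != 0 -> \sum_k l k = 1 ->
  bc t k (\sum_k l k *: t k) = l k.
Proof.
rewrite !sum3 => A l1.
have E : l (inord 0) = 1 - l (inord 1) - l (inord 2) by rewrite -l1; ring.
move: A; elim/I3_case: k; rewrite /bc !ordS3E /area /cross !mxE => A; rewrite E; field; exact: A.
Qed.

Lemma tri_bc t z : area t != 0 -> (tri t z <-> forall k, 0 <= bc t k z).
Proof.
move=> A; split=> [[l [l0 l1 ->]] k|h]; first by rewrite bc_lin.
by exists (fun k => bc t k z); split => //; [exact: bc_sum|exact: bc_comb].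
Qed.

Lemma bc_vtx t k l : area t != 0 -> bc t k (t l) = (k == l)%:R.
Proof.
move=> A; have -> : t l = \sum_m (m == l)%:R *: t m.
  by rewrite (bigD1 l) //= eqxx scale1r big1 ?addr0 // => m /negbTE ->; rewrite scale0r.
by rewrite bc_lin // (bigD1 l) //= eqxx big1 ?addr0 // => m /negbTE ->.
Qed.

Lemma bc_segpt t k u w (s : R) : bc t k (segpt u w s) = (1 - s) * bc t k u + s * bc t k w.
Proof.
rewrite /bc !mulrA -mulrDl; congr (_ / _); rewrite /cross /segpt !mxE; ring.
Qed.

Lemma continuous_bc t k : continuous (bc t k).
Proof.
move=> z; suff : differentiable (bc t k) z by exact: differentiable_continuous.
have X := @differentiable_coord R _ _ z ord0 ord0.
have Y := @differentiable_coord R _ _ z ord_max ord0.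
pose a1 := t (ordS (ordS k)) - t (ordS k).
have -> : bc t k = (fun z => (a1.1x * (z.2x - (t (ordS k)).2x) - a1.2x * (z.1x - (t (ordS k)).1x)) * (area t)^-1).
  by apply/funext => y; rewrite /bc /cross /a1 !mxE.
apply: differentiableM; last exact: differentiable_cst.
by apply: differentiableB; apply: differentiableM; try exact: differentiable_cst;
  apply: differentiableB; try exact: differentiable_cst; [exact: Y|exact: X].
Qed.

Lemma tri_interior t z : area t != 0 -> (forall k, 0 < bc t k z) -> (tri t)° z.
Proof. 
move=> A h; have : \forall y \near z, forall k, 0 < bc t k y.
  apply: (@filter_forall _ _ (fun (k : 'I_3) (y : R2) => 0 < bc t k y) _ (nbhs_filter z)) => k.
  by apply: (cvgr_gt (bc t k z)); [exact: continuous_bc|exact: h].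
by apply: filterS => y hy; apply/tri_bc => // k; exact: ltW.
Qed.

Lemma tri_compl t z : area t != 0 -> ~ tri t z -> \forall y \near z, ~ tri t y.
Proof.
move=> A h; have [k hk] : exists k, bc t k z < 0.
  apply/not_existsP => H; apply: h; apply/tri_bc => // k; rewrite leNgt; apply/negP; exact: H.
have hn : \forall y \near z, bc t k y < 0.
  have c : bc t k @ z --> bc t k z by exact: continuous_bc.
  exact: (cvgr_lt _ c _ hk).
by apply: filterS hn => y hy /tri_bc - /(_ A k); rewrite leNgt hy.
Qed.

Lemma continuous_segpt u w : continuous (fun s : R => segpt u w s).
Proof.
move=> s; apply: cvgD.
  by apply: cvgZr_tmp; apply: cvgB; [exact: cvg_cst|exact: cvg_id].
by apply: cvgZr_tmp; exact: cvg_id.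
Qed.

Lemma edge_bc t k z : edge t k z -> area t != 0 -> bc t k z = 0.
Proof.
move=> [s _ <-] A; rewrite bc_segpt !bc_vtx //.
have [n01 n02 n10 n12 [n20 n21]] := I3_neq.
by elim/I3_case: k; rewrite !ordS3E ?n01 ?n02 ?n10 ?n12 ?n20 ?n21 !mulr0 addr0.
Qed.

Lemma segpt0 u w : segpt u w 0 = u. Proof. by rewrite /segpt subr0 scale1r scale0r addr0. Qed.
Lemma segpt1 u w : segpt u w 1 = w. Proof. by rewrite /segpt subrr scale1r scale0r add0r. Qed.
Lemma segpt_rev u w (s : R) : segpt u w s = segpt w u (1 - s).
Proof. by rewrite /segpt subKr addrC. Qed.

Lemma segpt_inj u w (s s' : R) : u != w -> segpt u w s = segpt u w s' -> s = s'.
Proof.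
move=> uw /eqP; rewrite -subr_eq0 => /eqP h; apply/eqP.
have : (s - s') *: (w - u) = 0 by rewrite -h; apply: cV2_ext; rewrite !mxE; ring.
by move/eqP; rewrite scaler_eq0 !subr_eq0 (eq_sym w) (negbTE uw) orbF.
Qed.

Lemma segpt_segpt u w (s s' r : R) : segpt (segpt u w s) (segpt u w s') r = segpt u w ((1 - r) * s + r * s').
Proof. by apply: cV2_ext; rewrite !mxE; ring. Qed.

(** End points are extreme: in the parameter along (u, w), the value 0 is a convex combination of
    the parameters of [a] and [b], both in [0, 1], so one of them is 0; likewise for 1. *)
Lemma segment_ends u w a b : u != w -> segment u w = segment a b ->
  (a = u /\ b = w) \/ (a = w /\ b = u).
Proof.
move=> uw E.
have [s /andP[s0 s1] aE] : segment u w a.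
  by rewrite E; exists 0; [rewrite /= lexx ler01|rewrite segpt0].
have [s' /andP[s0' s1'] bE] : segment u w b.
  by rewrite E; exists 1; [rewrite /= lexx ler01|rewrite segpt1].
have [t /andP[t0 t1] uE] : segment a b u.
  by rewrite -E; exists 0; [rewrite /= lexx ler01|rewrite segpt0].
have [t' /andP[t0' t1'] wE] : segment a b w.
  by rewrite -E; exists 1; [rewrite /= lexx ler01|rewrite segpt1].
move: uE wE; rewrite -aE -bE !segpt_segpt => uE wE.
have e0 : (1 - t) * s + t * s' = 0 by apply: (segpt_inj uw); rewrite uE segpt0.
have e1 : (1 - t') * s + t' * s' = 1 by apply: (segpt_inj uw); rewrite wE segpt1.
have z1 : (1 - t) * s = 0.
  have p1 : 0 <= (1 - t) * s by apply: mulr_ge0; rewrite ?subr_ge0.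
  have p2 : 0 <= t * s' by apply: mulr_ge0.
  lra.
have z2 : t * s' = 0 by lra.
move/eqP: z1; rewrite mulf_eq0 subr_eq0 => /orP[/eqP t1E|/eqP s0E].
  have s'0 : s' = 0 by rewrite -t1E mul1r in z2.
  right; rewrite s'0 segpt0; split => //.
  suff -> : s = 1 by rewrite segpt1.
  apply/eqP; rewrite eq_le s1 /= -[leLHS]e1 s'0 mulr0 addr0; apply: ler_piMl => //; lra.
left; rewrite s0E segpt0; split => //.
suff -> : s' = 1 by rewrite segpt1.
by apply/eqP; rewrite eq_le s1' /= -[leLHS]e1 s0E mulr0 add0r; apply: ler_piMl.
Qed.

End PlanarGeometry.

(** * Vertices and shared edges of the two meshes *)

Section MeshGeometry.
Context {R : realType}.
Local Notation R2 := ('cV[R]_2).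
Implicit Types (u w z : R2) (M : iso_mesh R).

(** Quadratic Lagrange interpolation with nodes at the two ends and the midpoint. *)
Lemma q2_segpt c u w (s : R) : plane (q2 c) (segpt u w s) =
  (1 - s) * (1 - 2 * s) * plane (q2 c) u + 4 * s * (1 - s) * plane (q2 c) (midpt u w) +
  s * (2 * s - 1) * plane (q2 c) w.
Proof. by rewrite /plane /q2 !mxE; field. Qed.

Lemma Pk2_segpt (F F' : R2 -> R2) u w : vec (Pk 2) F -> vec (Pk 2) F' ->
  F u = F' u -> F w = F' w -> F (midpt u w) = F' (midpt u w) ->
  forall s, F (segpt u w s) = F' (segpt u w s).
Proof.
move=> hF hF' Eu Ew Em s; apply/matrixP => i j; rewrite ord1.
have [c hc] := Pk2_q2 (hF i); have [c' hc'] := Pk2_q2 (hF' i).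
have H z : F z = F' z -> plane (q2 c) z = plane (q2 c') z.
  by move=> E; apply: etrans (esym (hc z)) _; rewrite E hc'.
by rewrite hc hc' (q2_segpt c) (q2_segpt c') (H u) // (H w) // (H (midpt u w)).
Qed.

Lemma midptC u w : midpt u w = midpt w u.
Proof. by apply: cV2_ext; rewrite !mxE; field. Qed.

Lemma midpt_id u : midpt u u = u.
Proof. by apply: cV2_ext; rewrite !mxE; field. Qed.

Lemma Faff_vtx (t : 'I_3 -> R2) k : Faff t (refv k) = t k.
Proof.
have [r0 r1 r2] := @refvE R; elim/I3_case: k; rewrite ?r0 ?r1 ?r2; apply: cV2_ext; rewrite !mxE /=; ring.
Qed.

Lemma Faff_segpt (t : 'I_3 -> R2) u w (s : R) : Faff t (segpt u w s) = segpt (Faff t u) (Faff t w) s.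
Proof. by apply: cV2_ext; rewrite !mxE; ring. Qed.

Lemma area_neq0 (t : 'I_3 -> R2) : injective (Faff t) -> area t != 0.
Proof.
move=> inj; apply/eqP => A.
pose p := t (inord 0) - t (inord 2); pose q := t (inord 1) - t (inord 2).
have K (s1 s2 : R) : s1 * p ord0 ord0 + s2 * q ord0 ord0 = 0 ->
    s1 * p ord_max ord0 + s2 * q ord_max ord0 = 0 -> s1 = 0 /\ s2 = 0.
  move=> e1 e2; have : mkpt s1 s2 = mkpt 0 0 :> R2.
    apply: inj; apply: cV2_ext; rewrite !mxE /=.
      by move: e1; rewrite /p /q !mxE => e1; lra.
    by move: e2; rewrite /p /q !mxE => e2; lra.
  by move=> E; have := congr1 (fun z : R2 => z ord0 ord0) E; have := congr1 (fun z : R2 => z ord_max ord0) E;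
   rewrite !mkpt0 !mkpt1 => -> ->.
have A' : p ord0 ord0 * q ord_max ord0 - p ord_max ord0 * q ord0 ord0 = 0.
  by rewrite -A /area /cross /p /q !mxE; ring.
(* With zero determinant the cofactor vectors lie in the kernel, hence vanish; the matrix is then
   zero and (1, 0) lies in the kernel as well. *)
have [q1 p1] : q ord0 ord0 = 0 /\ - p ord0 ord0 = 0 by apply: K; lra.
have [q2 p2] : q ord_max ord0 = 0 /\ - p ord_max ord0 = 0 by apply: K; lra.
have [/eqP] : (1 : R) = 0 /\ (0 : R) = 0 by apply: K; lra.
by rewrite oner_eq0.
Qed.

Section Admissible.
Variables (M : iso_mesh R) (Om : set R2) (K c1 c2 sigma h0 : R).
Hypothesis adm : admissible M Om K c1 c2 sigma h0.
Implicit Types (i j : 'I_(nelt M)) (k l : 'I_3).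

Let conf : conforming M. Proof. by case: adm => -[]. Qed.
Let Gok : G_ok M Om K. Proof. by case: adm. Qed.
Let Ghok : Gh_ok M K. Proof. by case: adm. Qed.
Let edges : edges_ok M. Proof. by case: adm. Qed.

Lemma vtx_area i : area (vtx i) != 0.
Proof. by apply: area_neq0; exact: (proj1 conf). Qed.

Lemma vtx_neq i k l : k != l -> vtx i k != vtx i l.
Proof.
move=> kl; apply/eqP => E; have := bc_vtx k l (vtx_area i).
by rewrite -E bc_vtx ?vtx_area // eqxx (negbTE kl) => /eqP; rewrite oner_eq0.
Qed.

Lemma Gh_mid i k l : Gh i (midpt (vtx i k) (vtx i l)) = Gmap M (midpt (vtx i k) (vtx i l)).
Proof. by have [_ h _ _] := Ghok i; exact: h. Qed.

Lemma Gh_vtx i k : Gh i (vtx i k) = vtx i k.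
Proof.
have := Gh_mid i k k; rewrite midpt_id => ->.
by have [_ _ _ h _] := Gok; exact: h.
Qed.

Lemma FT_vtx i k : FT i (refv k) = vtx i k.
Proof. by rewrite /FT /= /Ftil Faff_vtx Gh_vtx. Qed.

Lemma Tedge_Gh i k : Tedge i k = Gh i @` edge (vtx i) k.
Proof.
apply/seteqP; split=> [_ [_ [s hs <-] <-]|_ [_ [s hs <-] <-]].
  exists (segpt (vtx i (ordS k)) (vtx i (ordS (ordS k))) s); first by exists s.
  by rewrite /FT /= /Ftil Faff_segpt !Faff_vtx.
exists (segpt (refv (ordS k)) (refv (ordS (ordS k))) s); first by exists s.
by rewrite /FT /= /Ftil Faff_segpt !Faff_vtx.
Qed.

Lemma ordS_neq k : ordS k != k /\ ordS (ordS k) != k /\ ordS k != ordS (ordS k).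
Proof.
have [n01 n02 n10 n12 [n20 n21]] := I3_neq.
by elim/I3_case: k; rewrite !ordS3E ?n01 ?n02 ?n10 ?n12 ?n20 ?n21.
Qed.

(** The polynomials [Gh i] and [Gh j] may differ, but on the common edge both are quadratic and
    interpolate the same map at the ends and the midpoint. *)
Lemma shared_edge i j k l : edge (vtx i) k = edge (vtx j) l -> Tedge i k = Tedge j l.
Proof.
move=> E; rewrite !Tedge_Gh -E.
have [hPi _ _ _] := Ghok i; have [hPj _ _ _] := Ghok j.
set u := vtx i (ordS k); set w := vtx i (ordS (ordS k)).
have uw : u != w by apply: vtx_neq; have [_ []] := ordS_neq k.
have G3 : [/\ Gh i u = Gh j u, Gh i w = Gh j w & Gh i (midpt u w) = Gh j (midpt u w)].
  rewrite Gh_mid !Gh_vtx.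
  have [[e1 e2]|[e1 e2]] := segment_ends uw E.
    by rewrite -/u -/w -e1 -e2 Gh_mid !Gh_vtx.
  by rewrite -/u -/w -e1 -e2 midptC Gh_mid !Gh_vtx.
have [g1 g2 g3] := G3.
have H s := Pk2_segpt hPi hPj g1 g2 g3 s.
apply/seteqP; split=> [_ [_ [s hs <-] <-]|_ [_ [s hs <-] <-]].
  by exists (segpt u w s); [exists s|rewrite -H].
by exists (segpt u w s); [exists s|rewrite H].
Qed.

End Admissible.
End MeshGeometry.

(** * Edges at an interior vertex are interior edges *)

Section Orientation.
Context {R : realType}.
Local Notation R2 := ('cV[R]_2).
Implicit Types (u w z : R2).
Variables (M : iso_mesh R) (Om : set R2) (K c1 c2 sigma h0 : R).
Hypothesis adm : admissible M Om K c1 c2 sigma h0.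
Hypotheses (K0 : 0 < K) (c10 : 0 < c1).
Implicit Types (i j : 'I_(nelt M)) (k l : 'I_3).

Let conf : conforming M. Proof. by case: adm => -[]. Qed.

Lemma conform_bc i j z : i != j -> Ttil i z -> Ttil j z ->
  (exists k, z = vtx i k) \/
  exists k l, [/\ edge (vtx i) k = edge (vtx j) l & bc (vtx i) k z = 0].
Proof.
move=> ij Ti Tj; have Tij : (Ttil i `&` Ttil j) z by split.
have [E|[k [l [_ E]]]|[k [l [Ee E]]]] := (proj2 conf) i j ij; rewrite E in Tij.
- by [].
- by left; exists k.
- by right; exists k, l; split => //; apply: edge_bc => //; exact: vtx_area adm i.
Qed.

Lemma I3_others k l : l != k -> exists m, [/\ m != k, m != l & forall n, n = k \/ n = l \/ n = m].
Proof.
have [n01 n02 n10 n12 [n20 n21]] := I3_neq.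
have all n : n = inord 0 \/ n = inord 1 \/ n = inord 2 :> 'I_3 by elim/I3_case: n; auto.
have [->|[->|->]] := all k; have [->|[->|->]] := all l; rewrite ?eqxx // => _.
- by exists (inord 2); rewrite n20 n21; split => // n; have [->|[->|->]] := all n; auto.
- by exists (inord 1); rewrite n10 n12; split => // n; have [->|[->|->]] := all n; auto.
- by exists (inord 2); rewrite n20 n21; split => // n; have [->|[->|->]] := all n; auto.
- by exists (inord 0); rewrite n01 n02; split => // n; have [->|[->|->]] := all n; auto.
- by exists (inord 1); rewrite n10 n12; split => // n; have [->|[->|->]] := all n; auto.
- by exists (inord 0); rewrite n01 n02; split => // n; have [->|[->|->]] := all n; auto.
Qed.

Lemma segpt_tri (t : 'I_3 -> R2) k l (s : R) : area t != 0 -> k != l -> 0 <= s <= 1 ->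
  tri t (segpt (t k) (t l) s).
Proof.
move=> A kl /andP[s0 s1]; apply/tri_bc => // m; rewrite bc_segpt !bc_vtx //.
by apply: addr_ge0; apply: mulr_ge0; rewrite ?ler0n ?subr_ge0.
Qed.

(** Between the vertex and the centroid all barycentric coordinates are positive. *)
Lemma vtx_closure i k : closure (Omtil M) (vtx i k).
Proof.
have A := vtx_area adm i.
pose c := \sum_l 3^-1 *: vtx i l.
have cb l : bc (vtx i) l c = 3^-1.
  by rewrite bc_lin // sumr_const card_ord -[LHS]mulr_natl; field.
move=> U /= nU.
have cs := @continuous_segpt R (vtx i k) c 0; rewrite /continuous_at segpt0 in cs.
have nU' : \forall s \near (0 : R), U (segpt (vtx i k) c s) by exact: cs.
have nU'' : \forall s \near (0 : R)^'+, U (segpt (vtx i k) c s) by exact: cvg_within nU'.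
near (0 : R)^'+ => s.
have s1 : s < 1 by near: s; exact: nbhs_right_lt.
have s0 : 0 < s by near: s; exact: nbhs_right_gt.
exists (segpt (vtx i k) c s); split; last by near: s.
have : (Ttil i)° (segpt (vtx i k) c s).
  apply: tri_interior => // l; rewrite bc_segpt bc_vtx // cb.
  have b0 : 0 <= (l == k)%:R :> R by case: (l == k).
  have : 0 <= (1 - s) * (l == k)%:R by apply: mulr_ge0 => //; lra.
  lra.
by apply: filterS => z Tz; exists i.
Unshelve. all: by end_near. Qed.

(** Take [q] on the edge opposite to [l], close to the interior vertex. If another triangle contains
    [q], conformity makes the intersection a common edge, necessarily this one, since [q] is not a
    vertex. If none does, the triangle would be a neighbourhood of its own boundary point [q]. *)
Lemma edge_shared i k l : k != l -> ~ bdry (Omtil M) (vtx i k) ->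
  interior_edge M (Tedge i l).
Proof.
move=> kl nb; have A := vtx_area adm i.
have lk : l != k by rewrite eq_sym.
have [m [mk ml hm]] := I3_others lk.
have F1 : (l == k) = false by exact: negbTE.
have F2 : (m == k) = false by exact: negbTE.
have F3 : (m == l) = false by exact: negbTE.
have F4 : (k == m) = false by rewrite eq_sym.
have F5 : (l == m) = false by rewrite eq_sym.
have Pin : Omtil M (vtx i k).
  have [//|nP] := EM (Omtil M (vtx i k)); exfalso; apply: nb.
  by split; [exact: vtx_closure|move=> /interior_subset].
have cs := @continuous_segpt R (vtx i k) (vtx i m) 0; rewrite /continuous_at segpt0 in cs.
have oO : nbhs (vtx i k) (Omtil M) by apply: open_nbhs_nbhs; split => //; exact: open_interior.
have nO : \forall s \near (0 : R)^'+, Omtil M (segpt (vtx i k) (vtx i m) s).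
  have nO' : \forall s \near (0 : R), Omtil M (segpt (vtx i k) (vtx i m) s) by exact: cs.
  exact: cvg_within nO'.
near (0 : R)^'+ => s.
have s1 : s < 1 by near: s; exact: nbhs_right_lt.
have s0 : 0 < s by near: s; exact: nbhs_right_gt.
have Oq : Omtil M (segpt (vtx i k) (vtx i m) s) by near: s.
pose q := segpt (vtx i k) (vtx i m) s; rewrite -/q in Oq.
have Tq : Ttil i q by apply: segpt_tri => //; [rewrite eq_sym|apply/andP; split; exact: ltW].
have qb n : bc (vtx i) n q = (1 - s) * (n == k)%:R + s * (n == m)%:R by rewrite bc_segpt !bc_vtx.
have [[j [ij Tj]]|no] := EM (exists j, i != j /\ Ttil j q).
  have [[n E]|[n [l' [E b]]]] := conform_bc ij Tq Tj.
    have := qb n; rewrite E bc_vtx // eqxx.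
    by have [->|[->|->]] := hm n; rewrite ?eqxx ?F1 ?F2 ?F3 ?F4 ?F5 /= ?mulr1 ?mulr0 ?addr0 ?add0r => hs; exfalso; lra.
  have nl : n = l.
    by move: b; rewrite qb; have [->|[->|->]] := hm n => //;
     rewrite ?eqxx ?F1 ?F2 ?F3 ?F4 ?F5 /= ?mulr1 ?mulr0 ?addr0 ?add0r => hs; exfalso; lra.
  by rewrite nl in E; exists i, j, l, l'; split => //; exact: (shared_edge adm E).
exfalso.
have far : \forall y \near q, forall j, i != j -> ~ Ttil j y.
  apply: (@filter_forall _ _ (fun j (y : R2) => i != j -> ~ Ttil j y) _ (nbhs_filter q)) => j.
  have [e|ij] := eqVneq i j; first exact: nearW.
  have := tri_compl (vtx_area adm j) (fun Tj => no (ex_intro _ j (conj ij Tj))).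
  by apply: filterS.
have nT : \forall y \near q, Ttil i y.
  have nU : \forall y \near q, (\bigcup_(i in [set: 'I_(nelt M)]) Ttil i) y by exact: Oq.
  near=> y.
  have hy : forall j, i != j -> ~ Ttil j y by near: y.
  have [j _ Tj] : (\bigcup_(i in [set: 'I_(nelt M)]) Ttil i) y by near: y.
  have [->//|ij] := eqVneq i j.
  by have := hy j ij Tj.
have cq := @continuous_segpt R q (vtx i l) 0; rewrite /continuous_at segpt0 in cq.
(* Negative parameters lead from [q] away from the vertex [l], to points with negative barycentric
   coordinate at [l]. *)
have nq : \forall r \near (0 : R)^'-, Ttil i (segpt q (vtx i l) r).
  have nq' : \forall r \near (0 : R), Ttil i (segpt q (vtx i l) r) by exact: cq.
  exact: cvg_within nq'.
near (0 : R)^'- => r.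
have r0 : r < 0 by near: r; exact: nbhs_left_lt.
have Tr : Ttil i (segpt q (vtx i l) r) by near: r.
move/(tri_bc _ A) : Tr => /(_ l); rewrite bc_segpt qb bc_vtx // eqxx F1 F5.
by rewrite !mulr0 addr0 mulr0 add0r mulr1 leNgt r0.
Unshelve. all: by end_near. Qed.

End Orientation.

(** * Orientation of the triangles and the two sides of a shared edge *)

Section OppositeSides.
Context {R : realType}.
Local Notation R2 := ('cV[R]_2).
Implicit Types (u w z r : R2).

(** The tangential derivative is the chord plus a multiple of the second difference. The latter
    vanishes when the segment is mapped affinely, and the derivative is then the chord at every
    parameter. *)
Lemma q2_dir c r r' (s : R) :
  plane (q2x c) (segpt r r' s) * (r' - r) ord0 ord0 + plane (q2y c) (segpt r r' s) * (r' - r) ord_max ord0 =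
  plane (q2 c) r' - plane (q2 c) r +
  (2 * s - 1) * 2 * (plane (q2 c) r' + plane (q2 c) r - 2 * plane (q2 c) (midpt r r')).
Proof. by rewrite /plane /q2 /q2x /q2y !mxE; field. Qed.

Lemma q2_dir_affine (F : R2 -> R2) a b r r' u w :
  (forall z, F z = mkpt (plane (q2 a) z) (plane (q2 b) z)) ->
  (forall s, 0 <= s <= 1 -> F (segpt r r' s) = segpt u w s) ->
  forall s, mkpt (plane (q2x a) (segpt r r' s) * (r' - r) ord0 ord0 + plane (q2y a) (segpt r r' s) * (r' - r) ord_max ord0)
    (plane (q2x b) (segpt r r' s) * (r' - r) ord0 ord0 + plane (q2y b) (segpt r r' s) * (r' - r) ord_max ord0) = w - u.
Proof.
move=> FE Fs s; rewrite !q2_dir.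
have E0 : F r = u by rewrite -(segpt0 r r') Fs ?segpt0 // lexx ler01.
have E1 : F r' = w by rewrite -(segpt1 r r') Fs ?segpt1 // lexx ler01.
have E2 : F (midpt r r') = midpt u w by rewrite Fs //; apply/andP; split; lra.
rewrite FE in E0; rewrite FE in E1; rewrite FE in E2.
have X0 := congr1 (fun z : R2 => z ord0 ord0) E0; have Y0 := congr1 (fun z : R2 => z ord_max ord0) E0.
have X1 := congr1 (fun z : R2 => z ord0 ord0) E1; have Y1 := congr1 (fun z : R2 => z ord_max ord0) E1.
have X2 := congr1 (fun z : R2 => z ord0 ord0) E2; have Y2 := congr1 (fun z : R2 => z ord_max ord0) E2.
rewrite /= ?mkpt0 ?mkpt1 in X0 Y0 X1 Y1 X2 Y2.
by rewrite X0 Y0 X1 Y1 X2 Y2; apply: cV2_ext; rewrite !mxE /=; field.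
Qed.

Lemma area_refv : area (refv : 'I_3 -> R2) = 1.
Proof. by have [r0 r1 r2] := @refvE R; rewrite /area r0 r1 r2 /cross !mxE /=; ring. Qed.

Lemma ordS_cycle (k : 'I_3) : ordS (ordS (ordS k)) = k.
Proof. by elim/I3_case: k; rewrite !ordS3E. Qed.

Variables (M : iso_mesh R) (Om : set R2) (K c1 c2 sigma h0 : R).
Hypothesis adm : admissible M Om K c1 c2 sigma h0.
Hypotheses (K0 : 0 < K) (c10 : 0 < c1).
Implicit Types (i j : 'I_(nelt M)) (k l : 'I_3).

Lemma hT_le i : hT i <= h0.
Proof.
case: adm => -[_ _ hh _ _] _ _ _ _; apply: le_trans hh.
by rewrite /meshsize; apply: le_bigmax.
Qed.

Lemma hT_gt0 i : 0 < hT i.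
Proof.
case: adm => _ _ hG hM _.
by have [] := FT_chart K0 c10 hG hM (hT_le i).
Qed.

(** [F_T] is affine on a straight edge, hence determined there by its end values, which are the
    vertices fixed by [G_h]. *)
Lemma straight_edge i k : interior_edge M (Tedge i k) -> forall s, 0 <= s <= 1 ->
  FT i (segpt (refv (ordS k)) (refv (ordS (ordS k))) s) = segpt (vtx i (ordS k)) (vtx i (ordS (ordS k))) s.
Proof.
move=> ie s hs; case: (adm) => _ _ _ _ [h1 h2 _].
have [B [b hB]] := h2 _ _ (proj1 (h1 _ ie)).
have E t : 0 <= t <= 1 -> edge refv k (segpt (refv (ordS k)) (refv (ordS (ordS k))) t : R2) by move=> ht; exists t.
have i0 : 0 <= (0 : R) <= 1 by rewrite lexx ler01.
have i1 : 0 <= (1 : R) <= 1 by rewrite lexx ler01.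
have e0 := hB _ (E 0 i0); have e1 := hB _ (E 1 i1); rewrite segpt0 in e0; rewrite segpt1 in e1.
rewrite (FT_vtx adm) in e0; rewrite (FT_vtx adm) in e1.
rewrite hB; last exact: E.
rewrite e0 e1 /segpt mulmxDr -!scalemxAr; apply: cV2_ext; rewrite !mxE; ring.
Qed.

Lemma jac_pos i a b z : (forall z, FT i z = mkpt (plane (q2 a) z) (plane (q2 b) z)) -> That z ->
  0 < plane (jac a b) z.
Proof.
move=> FE Tz; case: (adm) => _ _ _ hM _; have [_ _ _ _ hdet] := hM i.
have /andP[h _] := hdet _ Tz; rewrite (det_q2 _ FE) in h; apply: lt_le_trans h.
by rewrite mulr_gt0 // exprn_gt0 // hT_gt0.
Qed.

(* At an interior vertex both edges are interior, hence straight, so there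
   DFT agrees with the linear part of the affine map. *)
Lemma area_pos i : 0 < area (vtx i).
Proof.
case: (adm) => -[_ _ _ [_ /(_ i) [k nb]] _] _ hG _ _.
have [PkG _ _ _] := hG i; have [a [b FE]] := FT_q2 PkG.
have [n1 [n2 n3]] := ordS_neq k.
have i1 : interior_edge M (Tedge i (ordS k)) by apply: (edge_shared adm) nb; rewrite eq_sym.
have i2 : interior_edge M (Tedge i (ordS (ordS k))) by apply: (edge_shared adm) nb; rewrite eq_sym.
(* The edge opposite to [ordS (ordS k)] starts at vertex [k] and the one opposite to [ordS k] ends
   there, hence the parameters 0 and 1. *)
have D1 := q2_dir_affine FE (straight_edge i2) 0.
have D2 := q2_dir_affine FE (straight_edge i1) 1.
rewrite segpt0 !ordS_cycle in D1; rewrite segpt1 !ordS_cycle in D2.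
have J := jac_pos FE (That_refv k).
have A1 := area_cyc (refv : 'I_3 -> R2) k; rewrite area_refv in A1.
rewrite (area_cyc _ k) -D1 -[vtx i (ordS (ordS k)) - _]opprB -D2.
suff -> : cross
  (mkpt (plane (q2x a) (refv k) * (refv (ordS k) - refv k) ord0 ord0 + plane (q2y a) (refv k) * (refv (ordS k) - refv k) ord_max ord0)
     (plane (q2x b) (refv k) * (refv (ordS k) - refv k) ord0 ord0 + plane (q2y b) (refv k) * (refv (ordS k) - refv k) ord_max ord0))
  (- mkpt (plane (q2x a) (refv k) * (refv k - refv (ordS (ordS k))) ord0 ord0 + plane (q2y a) (refv k) * (refv k - refv (ordS (ordS k))) ord_max ord0)
     (plane (q2x b) (refv k) * (refv k - refv (ordS (ordS k))) ord0 ord0 + plane (q2y b) (refv k) * (refv k - refv (ordS (ordS k))) ord_max ord0))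
  = plane (jac a b) (refv k) * cross (refv (ordS k) - refv k) (refv (ordS (ordS k)) - refv k).
  by rewrite -A1 mulr1.
rewrite /cross /plane /jac !mxE /=; ring.
Qed.

(** If both triangles traversed the edge in the same direction, then, both being positively
    oriented, they would lie on the same side of it. A point slightly off the midpoint towards
    vertex [k] would be interior to both, which conformity forbids. *)
Lemma shared_opposite i j k l : i != j -> edge (vtx i) k = edge (vtx j) l ->
  vtx j (ordS l) = vtx i (ordS (ordS k)) /\ vtx j (ordS (ordS l)) = vtx i (ordS k).
Proof.
move=> ij E; have [n1 [n2 n3]] := ordS_neq k; have [m1 [m2 m3]] := ordS_neq l.
set u := vtx i (ordS k); set w := vtx i (ordS (ordS k)).
have uw : u != w by apply: (vtx_neq adm).
have [[e1 e2]|[e1 e2]] := segment_ends uw E; last by rewrite -e1 -e2.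
exfalso; pose m := midpt u w; pose zz s := segpt m (vtx i k) s.
have Ai := area_pos i; have Aj := area_pos j.
have Ai0 := vtx_area adm i; have Aj0 := vtx_area adm j.
have cz n : continuous (fun s : R => bc (vtx j) n (zz s)).
  by move=> s; apply: continuous_comp; [exact: continuous_segpt|exact: continuous_bc].
have bj n : n != l -> 0 < bc (vtx j) n m.
  move=> nl; rewrite /m /midpt bc_segpt -e1 -e2 !bc_vtx //.
  have [t [t1 t2 ht]] := I3_others m3.
  have hn : n = ordS l \/ n = ordS (ordS l).
    have [h|[h|h]] := ht n; [by right|by left|].
    have [h'|[h'|h']] := ht l.
    - by move: m2; rewrite -h' eqxx.
    - by move: m1; rewrite -h' eqxx.
    by move: nl; rewrite h -h' eqxx.
  have m3' : (ordS (ordS l) == ordS l) = false by rewrite eq_sym (negbTE m3).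
  by case: hn => ->; rewrite ?eqxx ?(negbTE m3) ?m3' /=; lra.
have nj n : n != l -> \forall s \near (0 : R)^'+, 0 < bc (vtx j) n (zz s).
  move=> nl; have c := cz n 0.
  have h : \forall s \near (0 : R), 0 < bc (vtx j) n (zz s).
    by apply: (cvgr_gt _ c); rewrite /zz segpt0; exact: bj.
  exact: cvg_within h.
have njA : \forall s \near (0 : R)^'+, forall n, n != l -> 0 < bc (vtx j) n (zz s).
  apply: (@filter_forall _ _ (fun n s => n != l -> 0 < bc (vtx j) n (zz s))) => n.
  have [->|nl] := eqVneq n l; first exact: nearW.
  by have := nj n nl; apply: filterS.
near (0 : R)^'+ => s.
have bjn : forall n, n != l -> 0 < bc (vtx j) n (zz s) by near: s.
have s0 : 0 < s by near: s; exact: nbhs_right_gt.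
have s1 : s < 1 by near: s; exact: nbhs_right_lt.
have bi n : 0 < bc (vtx i) n (zz s).
  rewrite /zz bc_segpt /m /midpt bc_segpt !bc_vtx //.
  have [t [t1 t2 ht]] := I3_others n3.
  have hk : t = k.
    have [h|[h|h]] := ht k => //; first by move: n2; rewrite -h eqxx.
    by move: n1; rewrite -h eqxx.
  rewrite hk in t1 t2 ht.
  have q1 : (ordS (ordS k) == ordS k) = false by rewrite eq_sym (negbTE n3).
  have q2 : (ordS k == k) = false by rewrite (negbTE n1).
  have q3 : (ordS (ordS k) == k) = false by rewrite (negbTE n2).
  by have [->|[->|->]] := ht n; rewrite ?eqxx ?(negbTE n3) ?q1 ?q2 ?q3 ?(negbTE t1) ?(negbTE t2) /=; lra.
have bjl : 0 < bc (vtx j) l (zz s).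
  rewrite /zz bc_segpt /m /midpt bc_segpt /bc e1 e2 -/u -/w.
  have -> : cross (w - u) (u - u) = 0 by rewrite /cross !mxE; ring.
  have -> : cross (w - u) (w - u) = 0 by rewrite /cross; ring.
  have -> : cross (w - u) (vtx i k - u) = area (vtx i).
    rewrite (area_cyc _ k) /u /w /cross !mxE; ring.
  rewrite !mul0r !mulr0 addr0 mulr0 add0r; apply: mulr_gt0 => //; exact: divr_gt0.
have Ti : Ttil i (zz s) by apply/tri_bc => // n; exact: ltW.
have Tj : Ttil j (zz s).
  apply/tri_bc => // n; apply: ltW; have [->//|nl] := eqVneq n l.
  exact: bjn.
have [[n En]|[n [_ [_ b0]]]] := conform_bc adm ij Ti Tj; last by have := bi n; rewrite b0 ltxx.
have [nS _] := ordS_neq n.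
by have := bi (ordS n); rewrite En bc_vtx // (negbTE nS) ltxx.
Unshelve. all: by end_near. Qed.

End OppositeSides.

(** * The side to which an outward normal points *)

Section OutwardNormal.
Context {R : realType}.
Local Notation R2 := ('cV[R]_2).
Implicit Types (u w z : R2).

Lemma bc_refv z : [/\ bc refv (inord 0) z = z ord0 ord0, bc refv (inord 1) z = z ord_max ord0 &
  bc refv (inord 2) z = 1 - z ord0 ord0 - z ord_max ord0].
Proof.
have [r0 r1 r2] := @refvE R.
by split; rewrite /bc area_refv divr1 !ordS3E ?r0 ?r1 ?r2 /cross !mxE /=; ring.
Qed.

Lemma bc_refv_lip (m : 'I_3) z z' :
  `|bc refv m z - bc refv m z'| <= `|z ord0 ord0 - z' ord0 ord0| + `|z ord_max ord0 - z' ord_max ord0|.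
Proof.
have [e0 e1 e2] := bc_refv z; have [e0' e1' e2'] := bc_refv z'.
elim/I3_case: m; rewrite ?e0 ?e0' ?e1 ?e1' ?e2 ?e2'; [by rewrite lerDl|by rewrite lerDr|].
rewrite (_ : _ - _ = - (z ord0 ord0 - z' ord0 ord0) - (z ord_max ord0 - z' ord_max ord0)); last by ring.
by apply: le_trans (ler_normB _ _) _; rewrite normrN.
Qed.

Lemma bc_cross (t : 'I_3 -> R2) k z z' : bc t k z - bc t k z' =
  cross (t (ordS (ordS k)) - t (ordS k)) (z - z') / area t.
Proof. by rewrite /bc -mulrBl; congr (_ / _); rewrite /cross !mxE; ring. Qed.

(** Here the constants may depend on the element, because only a sign will be drawn from them. *)
Lemma quad_local_nondeg a b (x0 y0 : R) : 0 <= x0 <= 2^-1 -> 0 <= y0 <= 2^-1 -> 0 < jac a b x0 y0 ->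
  exists K r : R, [/\ 0 < K, 0 < r & nondeg K (jac a b x0 y0 / 2) a b (box x0 y0 r)].
Proof.
move=> /andP[x00 x01] /andP[y00 y01] J0.
pose k : R := \sum_(i < 6) (`|a i| + `|b i|).
have ak i : (0 < i < 6)%N -> `|a i| <= k /\ `|b i| <= k.
  move=> /andP[_ hi]; rewrite /k (bigD1 (Ordinal hi)) //=.
  have S0 : 0 <= \sum_(j < 6 | j != Ordinal hi) (`|a j| + `|b j|).
    by apply: sumr_ge0 => *; rewrite addr_ge0.
  by have := normr_ge0 (a i); have := normr_ge0 (b i) => ? ?; split; lra.
have k0 : 0 <= k by apply: sumr_ge0 => *; rewrite addr_ge0.
have hD x y : box x0 y0 (2^-1) x y -> `|x| <= 1 /\ `|y| <= 1.
  by rewrite /box !ler_norml => -[/andP[? ?] /andP[? ?]]; split; apply/andP; split; lra.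
have [ax ay] := lipb_q2xy k0 (fun i hi => proj1 (ak i hi)) hD.
have [bx by_] := lipb_q2xy k0 (fun i hi => proj2 (ak i hi)) hD.
have J := lipbB (lipbM ax by_) (lipbM ay bx).
set L := 3 * _ + _ in J.
have L0 : 0 <= L by case: J.
pose r := Num.min (2^-1) (jac a b x0 y0 / (4 * (L + 1))).
have L1 : 0 < 4 * (L + 1) by lra.
have r0 : 0 < r by rewrite lt_min invr_gt0 ltr0n /= divr_gt0.
have rL : r * (4 * (L + 1)) <= jac a b x0 y0.
  by rewrite -ler_pdivlMr // /r ge_min lexx orbT.
have r2 : r <= 2^-1 by rewrite /r ge_min lexx.
exists (40 * k + 1), r; split => //; first lra.
move=> x y [bx0 by0].
have b' : box x0 y0 (2^-1) x y by split; apply: le_trans r2.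
have b0 : box x0 y0 (2^-1) x0 y0 by split; rewrite subrr normr0 invr_ge0.
have up (v : R) : `|v| <= 40 * k -> `|v| <= 40 * k + 1 by lra.
split; [case: ax => _ /(_ _ _ b')|case: ay => _ /(_ _ _ b')|case: bx => _ /(_ _ _ b')|
        case: by_ => _ /(_ _ _ b')|]; try by move=> h _; exact: up.
case: J => _ _ /(_ _ _ _ _ b' b0); rewrite -/(jac a b x y) -/(jac a b x0 y0).
rewrite ler_norml => /andP[+ _].
have : L * (`|x - x0| + `|y - y0|) <= L * (2 * r) by apply: ler_wpM2l => //; lra.
lra.
Qed.

(** Suppose the cross product is nonnegative. It is not zero, since [n] would be both parallel and
    orthogonal to the edge. If it is positive, local surjectivity gives [midpt u w + s n] a preimage
    near the midpoint of the reference edge; its coordinate at [k] is a positive multiple of s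
    cross(w - u, n) + O(s^2), and the other two stay close to 1/2. The point then lies in the
    element for all small s, so [n] does not point outwards. *)
Lemma outward_sign (M : iso_mesh R) (i : 'I_(nelt M)) (k : 'I_3) a b u w n :
  (forall z, FT i z = mkpt (plane (q2 a) z) (plane (q2 b) z)) ->
  (forall z, That z -> 0 < plane (jac a b) z) ->
  (forall s, 0 <= s <= 1 -> FT i (segpt (refv (ordS k)) (refv (ordS (ordS k))) s) = segpt u w s) ->
  u != w -> enorm n = 1 -> dot (w - u) n = 0 ->
  (\forall s \near 0^'+, ~ Tel i (midpt u w + s *: n)) -> cross (w - u) n < 0.
Proof.
move=> FE Jpos Fs uw n1 dn out; rewrite ltNge; apply/negP => cr0.
have dw : (w - u) ord0 ord0 * n ord0 ord0 + (w - u) ord_max ord0 * n ord_max ord0 = 0.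
  move: dn; rewrite /dot !big_ord_recl big_ord0 addr0.
  by rewrite (_ : lift ord0 ord0 = ord_max) //; exact/val_inj.
have cr : 0 < cross (w - u) n.
  rewrite lt_neqAle cr0 andbT; apply/eqP => /esym c0.
  pose N2 := (w - u) ord0 ord0 ^+ 2 + (w - u) ord_max ord0 ^+ 2.
  have e1 : N2 * n ord0 ord0 = 0.
    have -> : N2 * n ord0 ord0 = (w - u) ord0 ord0 * ((w - u) ord0 ord0 * n ord0 ord0 + (w - u) ord_max ord0 * n ord_max ord0)
       - (w - u) ord_max ord0 * cross (w - u) n by rewrite /N2 /cross; ring.
    by rewrite dw c0 !mulr0 subr0.
  have e2 : N2 * n ord_max ord0 = 0.
    have -> : N2 * n ord_max ord0 = (w - u) ord_max ord0 * ((w - u) ord0 ord0 * n ord0 ord0 + (w - u) ord_max ord0 * n ord_max ord0)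
       + (w - u) ord0 ord0 * cross (w - u) n by rewrite /N2 /cross; ring.
    by rewrite dw c0 !mulr0 addr0.
  have N0 : N2 != 0.
    apply/eqP => /eqP; rewrite paddr_eq0 ?sqr_ge0 // !sqrf_eq0 => /andP[/eqP h1 /eqP h2].
    move: uw; rewrite eq_sym -subr_eq0 => /eqP; apply; apply: cV2_ext; first by rewrite h1 mxE.
    by rewrite h2 mxE.
  have : n = 0.
    move/eqP: e1; rewrite mulf_eq0 (negbTE N0) /= => /eqP h1.
    move/eqP: e2; rewrite mulf_eq0 (negbTE N0) /= => /eqP h2.
    by apply: cV2_ext; rewrite ?h1 ?h2 mxE.
  move=> nz; move/eqP: n1; rewrite nz /enorm big1; last first.
    by move=> ? _; rewrite big1 // => ? _; rewrite mxE expr0n.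
  by rewrite sqrtr0 eq_sym oner_eq0.
have nle j : `|n j ord0| <= 1 by rewrite -n1; exact: entry_le_enorm.
pose rr : R2 := refv (ordS k); pose rr' : R2 := refv (ordS (ordS k)).
pose z0 := midpt rr rr'; pose x0 := z0 ord0 ord0; pose y0 := z0 ord_max ord0.
have half : 0 <= (2^-1 : R) <= 1 by apply/andP; split; lra.
have [_ Tz0] := @ct_edge R k _ half; rewrite -/rr -/rr' -/(midpt rr rr') -/z0 in Tz0.
have [r0 r1 r2] := @refvE R.
have xy0 : 0 <= x0 <= 2^-1 /\ 0 <= y0 <= 2^-1.
  rewrite /x0 /y0 /z0 /rr /rr'; clear -r0 r1 r2; elim/I3_case: k; rewrite !ordS3E ?r0 ?r1 ?r2 !mxE /=;
  by split; apply/andP; split; lra.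
have J0 : 0 < jac a b x0 y0 by exact: (Jpos _ Tz0).
have [K [rho [K0 rho0 nd]]] := quad_local_nondeg (proj1 xy0) (proj2 xy0) J0.
have c0 : 0 < jac a b x0 y0 / 2 by rewrite divr_gt0.
pose k' : R := \sum_(j < 6) (`|a j| + `|b j|).
have ak j : (j < 6)%N -> `|a j| <= k' /\ `|b j| <= k'.
  move=> hj; rewrite /k' (bigD1 (Ordinal hj)) //=.
  have S0 : 0 <= \sum_(l < 6 | l != Ordinal hj) (`|a l| + `|b l|).
    by apply: sumr_ge0 => *; rewrite addr_ge0.
  by have := normr_ge0 (a j); have := normr_ge0 (b j) => ? ?; split; lra.
have k0 : 0 <= k' by apply: sumr_ge0 => *; rewrite addr_ge0.
(* By [quad_lower_lip] the preimage is within [Lam s] of the reference midpoint. The quadratic part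
   of [F_T] at this displacement is at most [k' (Lam s)^2], and its effect on the cross product at
   most [B s^2]. *)
pose Lam := 4 * K / (jac a b x0 y0 / 2).
have Lam0 : 0 < Lam by rewrite divr_gt0 // mulr_gt0.
pose W := `|(w - u) ord0 ord0| + `|(w - u) ord_max ord0|.
have W0 : 0 <= W by rewrite addr_ge0.
pose B := W * (k' * Lam ^+ 2) + 1.
have B0 : 0 < B.
  by rewrite ltr_wpDl //; apply: mulr_ge0 => //; apply: mulr_ge0 => //; exact: sqr_ge0.
have b1 : 0 < jac a b x0 y0 / 2 * rho / (8 * K) / 2 by rewrite !divr_gt0 // !mulr_gt0.
have b2 : 0 < 2^-1 / Lam by rewrite divr_gt0.
have b3 : 0 < cross (w - u) n / B by rewrite divr_gt0.
have fm : FT i z0 = midpt u w by rewrite /z0 /midpt Fs.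
have key s : 0 < s -> s < jac a b x0 y0 / 2 * rho / (8 * K) / 2 -> s < 2^-1 / Lam ->
    s < cross (w - u) n / B -> Tel i (midpt u w + s *: n).
  move=> s0 s1 s2 s3.
  pose zt := midpt u w + s *: n.
  have m0 : midpt u w ord0 ord0 = q2 a x0 y0 by rewrite -fm FE mkpt0.
  have m1 : midpt u w ord_max ord0 = q2 b x0 y0 by rewrite -fm FE mkpt1.
  have zt0 : zt ord0 ord0 - q2 a x0 y0 = s * n ord0 ord0 by rewrite /zt mxE m0 mxE; ring.
  have zt1 : zt ord_max ord0 - q2 b x0 y0 = s * n ord_max ord0 by rewrite /zt mxE m1 mxE; ring.
  have sn j : `|s * n j ord0| <= s.
    by rewrite normrM (gtr0_norm s0) -[leRHS]mulr1; apply: ler_wpM2l => //; exact: ltW.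
  have dist : `|zt ord0 ord0 - q2 a x0 y0| + `|zt ord_max ord0 - q2 b x0 y0| < jac a b x0 y0 / 2 * rho / (8 * K).
    by rewrite zt0 zt1; have := sn ord0; have := sn ord_max; lra.
  have [x [y [bxy ex ey]]] := quad_surj K0 c0 rho0 nd dist.
  have ztE : zt = FT i (mkpt x y) by rewrite FE /plane !mkpt0 !mkpt1 ex ey mkptE.
  rewrite -/zt ztE; exists (mkpt x y) => //.
  have bb : box x0 y0 rho x0 y0 by split; rewrite subrr normr0 ltW.
  have low := quad_lower_lip c0 nd bxy bb; rewrite ex ey zt0 zt1 in low.
  have dl : `|x - x0| + `|y - y0| <= Lam * s.
    rewrite /Lam mulrAC ler_pdivlMr // mulrC; apply: le_trans low _.
    have : 2 * K * (`|s * n ord0 ord0| + `|s * n ord_max ord0|) <= 2 * K * (2 * s).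
      apply: ler_wpM2l; first by apply: mulr_ge0 => //; exact: ltW.
      by have := sn ord0; have := sn ord_max; lra.
    lra.
  have ar : area (refv : 'I_3 -> R2) != 0 by rewrite area_refv oner_eq0.
  have [n1' [n2' n3']] := ordS_neq k.
  have q1 : (ordS (ordS k) == ordS k) = false by rewrite eq_sym (negbTE n3').
  have q2' : (k == ordS k) = false by rewrite eq_sym (negbTE n1').
  have q3 : (k == ordS (ordS k)) = false by rewrite eq_sym (negbTE n2').
  have bz0 m : bc refv m z0 = 2^-1 * (m == ordS k)%:R + 2^-1 * (m == ordS (ordS k))%:R.
    by rewrite /z0 /midpt bc_segpt /rr /rr' !bc_vtx //; field.
  apply/(tri_bc _ ar) => m.
  have [mk|mk] := eqVneq m k; last first.
    have hz : bc refv m z0 = 2^-1.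
      have [t [t1 t2 ht]] := I3_others n3'.
      rewrite bz0.
      have [e|[e|e]] := ht m; rewrite ?e ?eqxx ?q1 ?(negbTE n3') /= ?mulr1 ?mulr0 ?addr0 ?add0r //.
      have [h|[h|h]] := ht k.
      - by move: n2'; rewrite -h eqxx.
      - by move: n1'; rewrite -h eqxx.
      by move: mk; rewrite e h eqxx.
    have := bc_refv_lip m (mkpt x y) z0; rewrite mkpt0 mkpt1 hz -/x0 -/y0 ler_norml => /andP[+ _].
    have : Lam * s <= 2^-1 by rewrite mulrC -ler_pdivlMr // ltW.
    by move: dl; clear => *; lra.
  have hz : bc refv k z0 = 0 by rewrite bz0 q2' q3 !mulr0 addr0.
  have -> : bc refv m (mkpt x y) = cross (rr' - rr) (mkpt x y - z0).
    by rewrite mk -[LHS]subr0 -[X in _ - X]hz bc_cross area_refv divr1.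
  have D := q2_dir_affine FE Fs (2^-1); rewrite -/rr -/rr' -/(midpt rr rr') -/z0 in D.
  have D0 := congr1 (fun z : R2 => z ord0 ord0) D; have D1 := congr1 (fun z : R2 => z ord_max ord0) D.
  rewrite /= mkpt0 in D0; rewrite /= mkpt1 in D1.
  pose d1 := x - x0; pose d2 := y - y0.
  have T0 : s * n ord0 ord0 = q2x a x0 y0 * d1 + q2y a x0 y0 * d2 +
      (a 3%N * d1 ^+ 2 + a 4%N * (d1 * d2) + a 5%N * d2 ^+ 2).
    by rewrite -zt0 -ex -{1}(subrK x0 x) -{1}(subrK y0 y) (addrC _ x0) (addrC _ y0) q2_taylor /d1 /d2; ring.
  have T1 : s * n ord_max ord0 = q2x b x0 y0 * d1 + q2y b x0 y0 * d2 +
      (b 3%N * d1 ^+ 2 + b 4%N * (d1 * d2) + b 5%N * d2 ^+ 2).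
    by rewrite -zt1 -ey -{1}(subrK x0 x) -{1}(subrK y0 y) (addrC _ x0) (addrC _ y0) q2_taylor /d1 /d2; ring.
  set Q0 := a 3%N * _ + _ + _ in T0; set Q1 := b 3%N * _ + _ + _ in T1.
  (* A linear map multiplies the cross product by its determinant: DF sends [rr' - rr] to [w - u],
     and the displacement to [s n] minus the quadratic part (Q0, Q1). *)
  have Ecr : jac a b x0 y0 * cross (rr' - rr) (mkpt x y - z0) =
      s * cross (w - u) n - ((w - u) ord0 ord0 * Q1 - (w - u) ord_max ord0 * Q0).
    have -> : s * cross (w - u) n = (w - u) ord0 ord0 * (s * n ord_max ord0) - (w - u) ord_max ord0 * (s * n ord0 ord0).
      by rewrite /cross; ring.
    rewrite T0 T1 -D0 -D1 /jac /cross /plane -/x0 -/y0 [(mkpt x y - z0) ord0 ord0]mxE [(mkpt x y - z0) ord_max ord0]mxE.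
    rewrite mkpt0 mkpt1 [(- z0) ord0 ord0]mxE [(- z0) ord_max ord0]mxE -/x0 -/y0 -/d1 -/d2; ring.
  have dd : (`|d1| + `|d2|) ^+ 2 <= (Lam * s) ^+ 2.
    by apply: lerXn2r => //; rewrite nnegrE ?addr_ge0 // mulr_ge0 // ltW.
  have Qb (f : nat -> R) : (forall j, (j < 6)%N -> `|f j| <= k') ->
      `|f 3%N * d1 ^+ 2 + f 4%N * (d1 * d2) + f 5%N * d2 ^+ 2| <= k' * (Lam * s) ^+ 2.
    move=> hf; apply: le_trans (_ : k' * (`|d1| + `|d2|) ^+ 2 <= _); last exact: ler_wpM2l.
    apply: le_trans (_ : k' * (`|d1| * `|d1|) + k' * (`|d1| * `|d2|) + k' * (`|d2| * `|d2|) <= _).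
      apply: le_trans (ler_normD _ _) _; apply: lerD; first (apply: le_trans (ler_normD _ _) _; apply: lerD);
       rewrite ?expr2 !normrM; apply: ler_wpM2r; rewrite ?mulr_ge0 //; exact: hf.
    have p : 0 <= k' * (`|d1| * `|d2|) by apply: mulr_ge0 => //; exact: mulr_ge0.
    have -> : k' * (`|d1| + `|d2|) ^+ 2 = k' * (`|d1| * `|d1|) + 2 * (k' * (`|d1| * `|d2|)) + k' * (`|d2| * `|d2|) by ring.
    by move: p; clear => *; lra.
  have Q0b := Qb a (fun j hj => proj1 (ak j hj)); have Q1b := Qb b (fun j hj => proj2 (ak j hj)).
  rewrite -/Q0 in Q0b; rewrite -/Q1 in Q1b.
  have Qc : `|(w - u) ord0 ord0 * Q1 - (w - u) ord_max ord0 * Q0| <= W * (k' * (Lam * s) ^+ 2).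
    apply: le_trans (ler_normB _ _) _; rewrite !normrM /W mulrDl; apply: lerD; exact: ler_wpM2l.
  suff : 0 <= jac a b x0 y0 * cross (rr' - rr) (mkpt x y - z0) by rewrite (pmulr_rge0 _ J0).
  rewrite Ecr.
  have sB : s * B <= cross (w - u) n by rewrite -ler_pdivlMr // ltW.
  have h1 : s * (s * B) <= s * cross (w - u) n by apply: ler_wpM2l => //; exact: ltW.
  have h2 : W * (k' * (Lam * s) ^+ 2) <= s * (s * B).
    have -> : s * (s * B) = W * (k' * (Lam * s) ^+ 2) + s * s by rewrite /B; ring.
    by rewrite lerDl mulr_ge0 // ltW.
  by move: Qc h1 h2; clear; rewrite ler_norml => /andP[? ?] *; lra.
near (0 : R)^'+ => s.
have nT : ~ Tel i (midpt u w + s *: n) by near: s.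
apply: nT; apply: key; near: s.
- exact: nbhs_right_gt.
- exact: nbhs_right_lt.
- exact: nbhs_right_lt.
- exact: nbhs_right_lt.
Unshelve. all: by end_near. Qed.

End OutwardNormal.

(** * The jump across an interior edge *)

Section Jump.
Context {R : realType}.
Local Notation R2 := ('cV[R]_2).
Implicit Types (u w z d n : R2).

(** By Lagrange's identity cross^2 + dot^2 = |d|^2 |n|^2, both cross products have absolute value
    |d|; their signs and the vanishing dot products determine the vectors. *)
Lemma normals_opposite d n n' : enorm n = 1 -> enorm n' = 1 -> dot d n = 0 -> dot d n' = 0 ->
  cross d n < 0 -> 0 < cross d n' -> n' = - n.
Proof.
have l0 : lift ord0 ord0 = ord_max :> 'I_2 by exact/val_inj.
have dE m : dot d m = d ord0 ord0 * m ord0 ord0 + d ord_max ord0 * m ord_max ord0.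
  by rewrite /dot !big_ord_recl big_ord0 addr0 l0.
have nE m : enorm m = 1 -> (m : R2) ord0 ord0 ^+ 2 + m ord_max ord0 ^+ 2 = 1.
  move=> h; have := congr1 (fun x => x ^+ 2) h; rewrite /enorm sqr_sqrtr; last first.
    by apply: sumr_ge0 => *; apply: sumr_ge0 => *; exact: sqr_ge0.
  by rewrite !big_ord_recl !big_ord0 !addr0 l0 expr1n.
move=> /nE N1 /nE N2; rewrite !dE => D1 D2 cn cn'.
pose S := d ord0 ord0 ^+ 2 + d ord_max ord0 ^+ 2.
have C1 : cross d n ^+ 2 = S.
  rewrite -[RHS]mulr1 -N1 -[RHS]subr0 -[X in _ - X](expr0n R 2) -D1 /cross /S; ring.
have C2 : cross d n' ^+ 2 = S.
  rewrite -[RHS]mulr1 -N2 -[RHS]subr0 -[X in _ - X](expr0n R 2) -D2 /cross /S; ring.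
have S0 : 0 < S by rewrite -C2 exprn_gt0.
have CC : cross d n' = - cross d n.
  apply/eqP; rewrite -(eqrXn2 (n := 2)) ?ltW ?oppr_gt0 //.
  by rewrite sqrrN C1 C2.
have Sn (m : R2) : S * m ord0 ord0 = d ord0 ord0 * (d ord0 ord0 * m ord0 ord0 + d ord_max ord0 * m ord_max ord0)
   - d ord_max ord0 * cross d m /\
   S * m ord_max ord0 = d ord_max ord0 * (d ord0 ord0 * m ord0 ord0 + d ord_max ord0 * m ord_max ord0)
   + d ord0 ord0 * cross d m by rewrite /S /cross; split; ring.
have [e1 e2] := Sn n; have [e1' e2'] := Sn n'.
have inj := mulfI (lt0r_neq0 S0).
apply: cV2_ext; apply: inj; rewrite mxE mulrN.
  by rewrite e1 e1' D1 D2 CC; ring.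
by rewrite e2 e2' D1 D2 CC; ring.
Qed.

Lemma enorm_le (m n : nat) (A : 'M[R]_(m, n)) (B : R) : (m * n <= 4)%N -> 0 <= B ->
  (forall i j, `|A i j| <= B) -> enorm A <= 2 * B.
Proof.
move=> mn B0 h; rewrite -[2 * B]ger0_norm ?mulr_ge0 // -sqrtr_sqr /enorm ler_sqrt ?sqr_ge0 //.
apply: le_trans (_ : \sum_(i < m) \sum_(j < n) B ^+ 2 <= _).
  apply: ler_sum => i _; apply: ler_sum => j _.
  by rewrite -real_normK ?num_real // ler_pXn2r ?nnegrE.
rewrite !sumr_const !card_ord -mulrnA exprMn -natrX mulr_natl ler_wpMn2l ?sqr_ge0 //.
by rewrite mulnC.
Qed.

Lemma cub_rev (e : nat -> R) : exists e', forall t, cub e' t = cub e (1 - t).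
Proof.
exists (fun k => nth 0 [:: e 0%N + e 1%N + e 2%N + e 3%N; - (e 1%N + 2 * e 2%N + 3 * e 3%N);
  e 2%N + 3 * e 3%N; - e 3%N] k) => t.
by rewrite /cub /=; ring.
Qed.

Variables (M : iso_mesh R) (Om : set R2) (K c1 c2 sigma h0 : R).
Hypothesis adm : admissible M Om K c1 c2 sigma h0.
Hypotheses (K0 : 0 < K) (c10 : 0 < c1) (h00 : 0 < h0).
Implicit Types (i j : 'I_(nelt M)) (k l : 'I_3).

Lemma Tedge_straight i k : interior_edge M (Tedge i k) -> Tedge i k = edge (vtx i) k.
Proof.
move=> ie; have S := straight_edge adm ie.
apply/seteqP; split=> [_ [_ [s hs <-] <-]|_ [s hs <-]].
  by exists s => //; rewrite S.
by exists (segpt (refv (ordS k)) (refv (ordS (ordS k))) s); [exists s|rewrite S].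
Qed.

(** The end points are images of reference vertices under [F_T], whose derivative bound measures the
    edge. *)
Lemma edge_length i k : enorm (vtx i (ordS (ordS k)) - vtx i (ordS k)) <= 16 * (K * (1 + h0)) * hT i.
Proof.
case: (adm) => _ _ hG hM _.
have [hp [a [b [FE ab _ _]]]] := FT_chart K0 c10 hG hM (hT_le adm i).
have K1 : 0 < K * (1 + h0) by apply: mulr_gt0 => //; exact: addr_gt0.
have -> : 16 * (K * (1 + h0)) * hT i = 2 * (8 * (K * (1 + h0)) * hT i) by ring.
have [u0 u1 u2] := That_coord (That_refv (ordS k) : That (refv (ordS k) : R2)).
have [w0 w1 w2] := That_coord (That_refv (ordS (ordS k)) : That (refv (ordS (ordS k)) : R2)).
have B (c : nat -> R) : (forall j : nat, (0 < j < 6)%N -> `|c j| <= K * (1 + h0)) ->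
   `|hT i * plane (q2 c) (refv (ordS (ordS k))) - hT i * plane (q2 c) (refv (ordS k))| <= 8 * (K * (1 + h0)) * hT i.
  move=> hc; rewrite -mulrBr normrM (gtr0_norm hp) mulrC ler_pM2r // /plane q2_sub.
  set x := (refv (ordS (ordS k)) : R2) ord0 ord0 in w0 w2 *; set y := (refv (ordS (ordS k)) : R2) ord_max ord0 in w1 w2 *.
  set x' := (refv (ordS k) : R2) ord0 ord0 in u0 u2 *; set y' := (refv (ordS k) : R2) ord_max ord0 in u1 u2 *.
  have [|||hx hy] := @q2xy_bound R (K * (1 + h0)) c ((x + x') / 2) ((y + y') / 2).
  - by rewrite ler_norml; apply/andP; split; lra.
  - by rewrite ler_norml; apply/andP; split; lra.
  - exact: hc.
  have -> : 8 * (K * (1 + h0)) = 4 * (K * (1 + h0)) * 1 + 4 * (K * (1 + h0)) * 1 by ring.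
  apply: le_trans (ler_normD _ _) _; rewrite !normrM; apply: lerD; apply: ler_pM => //.
    by rewrite ler_norml; apply/andP; split; lra.
  by rewrite ler_norml; apply/andP; split; lra.
apply: enorm_le => //; first by apply: mulr_ge0; [apply: mulr_ge0 => //|]; exact: ltW.
move=> r s; rewrite (ord1 s) -!(FT_vtx adm) !FE !mxE.
by case: ifP => _; apply: B => j hj; have [] := ab j hj.
Qed.

(** [Psi] prescribes values at the displaced nodes [Gh i a]; on a straight edge [Gh i] also fixes
    the midpoint, so the prescribed values do not depend on the side. *)
Lemma Psi_nodes i k vt (v : 'I_(nelt M) -> R2 -> R2) : Psi vt v -> interior_edge M (Tedge i k) ->
  let u := vtx i (ordS k) in let w := vtx i (ordS (ordS k)) in
  [/\ v i u = vt u, v i w = vt w & v i (midpt u w) = vt (midpt u w)].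
Proof.
move=> hP ie u w; have [_ hv] := hP i.
have F m : Ftil i (refv m) = vtx i m by rewrite /Ftil Faff_vtx.
have V m : v i (vtx i m) = vt (vtx i m).
  rewrite -{1}(Gh_vtx adm i m); apply: hv; exists (refv m); last exact: F.
  by exists (Some m), (Some m); rewrite midpt_id.
split; [exact: V|exact: V|].
have mE : Ftil i (midpt (refv (ordS k)) (refv (ordS (ordS k)))) = midpt u w.
  by rewrite /Ftil /midpt Faff_segpt !Faff_vtx.
have GE : Gh i (midpt u w) = midpt u w.
  have := straight_edge adm ie (s := 2^-1); rewrite /FT /= -/(midpt _ _) mE; apply.
  by apply/andP; split; lra.
rewrite -{1}GE; apply: hv; exists (midpt (refv (ordS k)) (refv (ordS (ordS k)))) => //.
by exists (Some (ordS k)), (Some (ordS (ordS k))).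
Qed.

Lemma normal_sign i k a b n : interior_edge M (Tedge i k) ->
  let u := vtx i (ordS k) in let w := vtx i (ordS (ordS k)) in
  (a = u /\ b = w) \/ (a = w /\ b = u) -> outward_normal (Tel i) a b n ->
  dot (w - u) n = 0 /\ cross (w - u) n < 0.
Proof.
move=> ie u w abE [n1 dn out].
have half : 0 < (2^-1 : R) < 1 by apply/andP; split; lra.
have mE : segpt a b 2^-1 = midpt u w.
  by case: abE => -[-> ->] //; rewrite -/(midpt _ _) midptC.
have {}dn : dot (w - u) n = 0.
  case: abE dn => -[-> ->] // h; rewrite -[RHS]oppr0 -h /dot -sumrN.
  by apply: eq_bigr => m _; rewrite !mxE; ring.
split => //; have {}out := out _ half; rewrite mE in out.
case: (adm) => _ _ hG _ _; have [PkG _ _ _] := hG i; have [A [B FE]] := FT_q2 PkG.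
apply: (outward_sign FE) out => //.
- by move=> z Tz; exact: (jac_pos adm K0 c10 FE Tz).
- exact: (straight_edge adm ie).
by apply: (vtx_neq adm); have [_ []] := ordS_neq k.
Qed.

End Jump.

Theorem lemma4p6 (R : realType) (m : nat) (Om : set 'cV[R]_2)
    (K c1 c2 sigma h0 : R) :
  (0 < m)%N -> smooth_domain m Om ->
  0 < K -> 0 < c1 -> 0 < c2 -> 0 < sigma -> 0 < h0 ->
  exists2 C : R, 0 < C &
    forall M : iso_mesh R, admissible M Om K c1 c2 sigma h0 ->
    forall (e : set 'cV[R]_2) (i j : 'I_(nelt M)),
      interior_edge M e -> i != j ->
      (exists k, e = Tedge i k) -> (exists l, e = Tedge j l) ->
      e = bdry (Tel i) `&` bdry (Tel j) ->
    forall a b ni nj : 'cV[R]_2,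
      e = segment a b ->
      outward_normal (Tel i) a b ni -> outward_normal (Tel j) a b nj ->
    forall v, Vh v ->
      ((enorm (seg_int a b
          (fun x => (tensor (v i x) ni + tensor (v j x) nj)%R)))%:E <=
       (C * Num.max (hT i) (hT j) ^+ 3)%:E *
       (gradL2 i (v i) + gradL2 j (v j)))%E.
Proof.
move=> _ _ K0 c10 c20 _ h00.
have [C C0 hC] := elt_edge_cubic K0 c10 h00.
pose Cb : R := 16 * (K * (1 + h0)).
have Cb0 : 0 < Cb by apply: mulr_gt0 => //; apply: mulr_gt0 => //; exact: addr_gt0.
(* One factor 2 passes from the entries to the Frobenius norm, the other comes from [simpson_bound];
   [Cb] is the ratio of edge length to mesh size. *)
exists (4 * (C * Cb)); first by apply: mulr_gt0 => //; exact: mulr_gt0.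
move=> M adm e i j ie ij [k ek] [l el] _ a b ni nj eab oi oj v [vt [_ hP]].
have iek : interior_edge M (Tedge i k) by rewrite -ek.
have jel : interior_edge M (Tedge j l) by rewrite -el.
have Ei := Tedge_straight adm iek; have Ej := Tedge_straight adm jel.
have Eij : edge (vtx i) k = edge (vtx j) l by rewrite -Ei -Ej -ek el.
pose u := vtx i (ordS k); pose w := vtx i (ordS (ordS k)).
have [ju jw] := shared_opposite adm K0 c10 ij Eij; rewrite -/u -/w in ju jw.
have uw : u != w by apply: (vtx_neq adm); have [_ []] := ordS_neq k.
have abi : (a = u /\ b = w) \/ (a = w /\ b = u).
  by apply: segment_ends => //; rewrite -eab ek Ei.
have [di ci] := normal_sign adm K0 c10 iek abi oi.
have abj : (a = vtx j (ordS l) /\ b = vtx j (ordS (ordS l))) \/ (a = vtx j (ordS (ordS l)) /\ b = vtx j (ordS l)).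
  by rewrite ju jw; case: abi; [right|left].
have [dj cj] := normal_sign adm K0 c10 jel abj oj; rewrite ju jw in dj cj.
have nji : nj = - ni.
  case: oi => ni1 _ _; case: oj => nj1 _ _; apply: (normals_opposite ni1 nj1 di) ci _.
    rewrite -[RHS]oppr0 -dj /dot -sumrN; apply: eq_bigr => m' _; rewrite !mxE; ring.
  by rewrite -oppr_lt0 (_ : - cross _ _ = cross (u - w) nj) // /cross !mxE; ring.
have hi0 := hT_gt0 adm K0 c10 i; have hj0 := hT_gt0 adm K0 c10 j.
set h := Num.max (hT i) (hT j).
have hih : hT i <= h by rewrite le_max lexx.
have hjh : hT j <= h by rewrite le_max lexx orbT.
have hp : 0 < h by exact: lt_le_trans hih.
have Gi0 : (0 <= gradL2 i (v i))%E by exact: Lnorm_ge0.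
have Gj0 : (0 <= gradL2 j (v j))%E by exact: Lnorm_ge0.
have Ch : 0 < 4 * (C * Cb) * h ^+ 3.
  by apply: mulr_gt0; [apply: mulr_gt0 => //; exact: mulr_gt0|exact: exprn_gt0].
(* If one of the gradient norms is infinite, so is the right-hand side. *)
case Gi : (gradL2 i (v i)) Gi0 => [Ni| |//] Ni0; last first.
  by rewrite addye ?gt0_muley ?leey ?lte_fin // -ltNye (lt_le_trans _ Gj0) // ltNy0.
case Gj : (gradL2 j (v j)) Gj0 => [Nj| |//] Nj0; last first.
  by rewrite addey // gt0_muley ?leey ?lte_fin.
rewrite lee_fin in Ni0; rewrite lee_fin in Nj0.
rewrite -EFinD -EFinM lee_fin.
case: (adm) => _ _ hG hM _.
have cubic i' k' N (p : 'I_2) : interior_edge M (Tedge i' k') ->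
    (a = vtx i' (ordS k') /\ b = vtx i' (ordS (ordS k'))) \/ (a = vtx i' (ordS (ordS k')) /\ b = vtx i' (ordS k')) ->
    (gradL2 i' (v i') <= N%:E)%E -> hT i' <= h -> 0 <= N ->
    exists e, forall t, 0 <= t <= 1 -> `|v i' (segpt a b t) p ord0 - cub e t| <= C * (h ^+ 2 * N).
  move=> ie' ab' hN hh N0; have S := straight_edge adm ie'.
  have [f hf] := hC M c2 i' k' (v i') N hG hM (hT_le adm i') (proj1 (hP i')) hN p.
  have le : C * (hT i' ^+ 2 * N) <= C * (h ^+ 2 * N).
    apply: ler_wpM2l; first exact: ltW.
    apply: ler_wpM2r => //; apply: lerXn2r => //; rewrite nnegrE; apply: ltW => //.
    exact: (hT_gt0 adm K0 c10).
  (* The segment may be parametrised against the direction of the element's edge, in which case the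
     cubic is reversed. *)
  case: ab' => -[-> ->].
    by exists f => t ht; rewrite -S //; apply: le_trans le; exact: hf.
  have [f' hf'] := cub_rev f; exists f' => t ht; rewrite hf' segpt_rev -S; last first.
    by case/andP: ht => ? ?; apply/andP; split; lra.
  by apply: le_trans le; apply: hf; case/andP: ht => ? ?; apply/andP; split; lra.
have [niu niw nim] := Psi_nodes adm hP iek; have [nju njw njm] := Psi_nodes adm hP jel.
rewrite ju jw in nju njw njm.
have node x : [\/ x = u, x = w | x = midpt u w] -> v i x = v j x.
  case=> ->; rewrite ?niu ?niw ?nim ?nju ?njw //.
  by rewrite midptC njm.
have ab0 : v i (segpt a b 0) = v j (segpt a b 0).
  by apply: node; rewrite segpt0; case: abi => -[-> _]; [constructor 1|constructor 2].
have ab1 : v i (segpt a b 1) = v j (segpt a b 1).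
  by apply: node; rewrite segpt1; case: abi => -[_ ->]; [constructor 2|constructor 1].
have ab2 : v i (segpt a b 2^-1) = v j (segpt a b 2^-1).
  apply: node; constructor 3; case: abi => -[-> ->] //.
  by rewrite -/(midpt _ _) midptC.
have lab : enorm (b - a) <= Cb * h.
  have L := edge_length adm K0 c10 h00 i k; rewrite -/u -/w in L.
  have L' : enorm (b - a) = enorm (w - u).
    case: abi => -[-> ->] //; rewrite /enorm; congr Num.sqrt; apply: eq_bigr => m1 _.
    by apply: eq_bigr => m2 _; rewrite !mxE -sqrrN opprB.
  by rewrite L'; apply: le_trans L _; apply: ler_wpM2l => //; exact: ltW.
have E : 4 * (C * Cb) * h ^+ 3 * (Ni + Nj) = 2 * (Cb * h * (2 * (C * (h ^+ 2 * Ni) + C * (h ^+ 2 * Nj)))) by ring.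
have B0 : 0 <= C * (h ^+ 2 * Ni) + C * (h ^+ 2 * Nj).
  by apply: addr_ge0; (apply: mulr_ge0; [exact: ltW|apply: mulr_ge0 => //; exact: sqr_ge0]).
rewrite E; apply: enorm_le => // [|p q].
  by apply: mulr_ge0; apply: mulr_ge0 => //; exact: ltW.
rewrite mxE normrM; apply: ler_pM => //.
  by rewrite ger0_norm // sqrtr_ge0.
have [f hf] := cubic i k Ni p iek abi ltac:(by rewrite Gi) hih Ni0.
have [g hg] := cubic j l Nj p jel abj ltac:(by rewrite Gj) hjh Nj0.
(* With opposite normals the jump is the difference of the traces times [ni], so the difference of
   the two cubics approximates it and it vanishes at the three Simpson nodes. *)
have Fe t : (tensor (v i (segpt a b t)) ni + tensor (v j (segpt a b t)) nj) p q =
    (v i (segpt a b t) p ord0 - v j (segpt a b t) p ord0) * ni q ord0.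
  by rewrite nji !mxE; ring.
have nq : `|ni q ord0| <= 1 by case: oi => <- _ _; exact: entry_le_enorm.
apply: (@simpson_bound _ _ (fun m => (f m - g m) * ni q ord0)).
- move=> t ht; rewrite Fe (_ : cub _ t = (cub f t - cub g t) * ni q ord0); last by rewrite /cub; ring.
  rewrite -mulrBl normrM -[leRHS]mulr1; apply: ler_pM => //.
  rewrite (_ : _ - _ = (v i (segpt a b t) p ord0 - cub f t) - (v j (segpt a b t) p ord0 - cub g t)); last by ring.
  by apply: le_trans (ler_normB _ _) _; apply: lerD; [exact: hf|exact: hg].
- by rewrite Fe ab0 subrr mul0r.
- by rewrite Fe ab2 subrr mul0r.
- by rewrite Fe ab1 subrr mul0r.
Qed.
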